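(* Suppose that either $\mathbb{X}^n=\Lambda^n$ with $n$ even, or $\mathbb{X}^n=\mathbb{S}^n$ with $n$ arbitrary. Then all branches of the multi-valued analytic function $\widetilde{V}_{\mathbb{X}^n}(C)$ are real at all points of $\mathcal{C}_{\mathbb{X}^n}$; that is, for every path in $\mathcal{G}_{(n)}(\mathbb{C})\setminus X$ starting and ending in $\mathcal{C}_{\mathbb{X}^n}$, the analytic continuation of $V_{\mathbb{X}^n}$ along it takes a real value at the endpoint.
   Context: $\mathcal{G}_{(n)}(\mathbb{C})$ (resp. $\mathcal{G}_{(n)}(\mathbb{R})$) is the affine space of complex (resp. real) symmetric $(n+1)\times(n+1)$ matrices with units on the diagonal; $X\subset\mathcal{G}_{(n)}(\mathbb{C})$ is the hypersurface of matrices at least one of whose principal minors vanishes. $\Lambda^n$ is the Lobachevsky space of curvature $-1$ and $\mathbb{S}^n$ the unit sphere (curvature $1$). For a non-degenerate (in the Lobachevsky case bounded) simplex in $\mathbb{X}^n$ with vertices $v_0,\dots,v_n$ and edge lengths $\ell_{jk}$ put $c_{jk}=\cosh\ell_{jk}$ if $\mathbb{X}^n=\Lambda^n$, $c_{jk}=\cos\ell_{jk}$ if $\mathbb{X}^n=\mathbb{S}^n$, and $c_{jj}=1$ (so $C=(c_{jk})$ is the Gram matrix of the vertices in the standard vector model). $\mathcal{C}_{\mathbb{X}^n}\subset\mathcal{G}_{(n)}(\mathbb{R})$ is the (connected) domain of all such matrices, and $V_{\mathbb{X}^n}(C)$ is the real-analytic function on $\mathcal{C}_{\mathbb{X}^n}$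 giving the volume of the corresponding simplex. It is known (Aomoto) that $V_{\mathbb{X}^n}$ admits analytic continuation along every path in $\mathcal{G}_{(n)}(\mathbb{C})\setminus X$; $\widetilde{V}_{\mathbb{X}^n}$ is the resulting multi-valued analytic function. *)

(* Defs.v *)
From mathcomp Require Import all_boot all_order all_algebra.
From mathcomp Require Import all_classical all_reals all_analysis.
From mathcomp Require Import complex.
Import Order.TTheory GRing.Theory Num.Theory.

Set Implicit Arguments.
Unset Strict Implicit.
Unset Printing Implicit Defensive.

Local Open Scope classical_set_scope.
Local Open Scope ring_scope.

Inductive geometry := Lobachevsky | Sphere.

Section Real.
Variable R : realType.

(* ---- n-dimensional Lebesgue measure, as an iterated Lebesgue integral ----
   Points of R^k are encoded as functions nat -> R (only the first k
   coordinates matter).  For Borel sets A, by Tonelli this is the Lebesgue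
   measure of A in R^k. *)
Definition ncons (x : R) (y : nat -> R) : nat -> R :=
  fun i => if i is i'.+1 then y i' else x.

Fixpoint leb_n (k : nat) (A : set (nat -> R)) : \bar R :=
  match k with
  | 0 => if `[< A (fun _ => 0) >] then 1%E else 0%E
  | k'.+1 => (\int[@lebesgue_measure R]_(x in [set: R])
                 leb_n k' [set y | A (ncons x y)])%E
  end.

(* ---- the vector models ----
   Lambda^n = { x in R^{n+1} : x_0^2 - x_1^2 - ... - x_n^2 = 1, x_0 > 0 }
   S^n      = { x in R^{n+1} : x_0^2 + ... + x_n^2 = 1 }
   The bilinear form of the model: J = diag(1,-1,...,-1) resp. the identity;
   with these conventions the Gram matrix (x_j . x_k) has entries
   cosh(l_jk), resp. cos(l_jk). *)
Definition model_form (g : geometry) (n : nat) : 'M[R]_n.+1 :=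
  match g with
  | Lobachevsky => diag_mx (\row_(j < n.+1) if j == ord0 then 1 else -1)
  | Sphere => 1%:M
  end.

(* vertices are the rows of a (n+1)x(n+1) real matrix v *)
Definition gram (g : geometry) (n : nat) (v : 'M[R]_n.+1) : 'M[R]_n.+1 :=
  v *m model_form g n *m v^T.

(* v_0, ..., v_n are points of X^n spanning a non-degenerate simplex
   (in Lambda^n the vertices are genuine points, so the simplex is bounded) *)
Definition simplex_vertices (g : geometry) (n : nat) (v : 'M[R]_n.+1) : Prop :=
  [/\ v \in unitmx,
      (forall i, gram g v i i = 1) &
      (g = Lobachevsky -> forall i, 0 < v i ord0)].

Definition unit_cone (g : geometry) (n : nat) (v : 'M[R]_n.+1)
  : set (nat -> R) :=
  [set x | exists t : 'rV[R]_n.+1,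
     [/\ (forall i, 0 <= t 0 i),
         (forall j : 'I_n.+1, x (nat_of_ord j) = (t *m v) 0 j) &
         ((t *m v) *m model_form g n *m (t *m v)^T) 0 0 <= 1]].

(* Volume of the simplex with vertices v in X^n: in both models the
   (Riemannian) volume of a region D of X^n is (n+1) times the Lebesgue
   measure in R^{n+1} of { r u : u in D, 0 <= r <= 1 } (polar coordinates
   dx = r^n dr dvol(u)). *)
Definition simplex_volume (g : geometry) (n : nat) (v : 'M[R]_n.+1) : R :=
  fine ((n.+1)%:R%:E * leb_n n.+1 (unit_cone g v))%E.

Definition gram_domain (g : geometry) (n : nat) : set 'M[R]_n.+1 :=
  [set C | exists v, simplex_vertices g v /\ gram g v = C].

Local Notation C := R[i].

Definition cplx (x : R) : C := Complex x 0.
Definition cplx_mx (n : nat) (A : 'M[R]_n) : 'M[C]_n := map_mx cplx A.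

Definition Gmat (n : nat) : set 'M[C]_n.+1 :=
  [set A | A^T = A /\ forall i, A i i = 1].

Definition principal_minor (n : nat) (A : 'M[C]_n) (S : {set 'I_n}) : C :=
  \det (\matrix_(i < #|S|, j < #|S|) A (enum_val i) (enum_val j)).

Definition Xdisc (n : nat) : set 'M[C]_n.+1 :=
  [set A | exists S : {set 'I_n.+1}, (0 < #|S|)%N /\ principal_minor A S = 0].

Definition mnorm (n : nat) (A : 'M[C]_n) : C := \sum_i \sum_j `|A i j|.

Definition mball (n : nat) (z : 'M[C]_n) (r : C) : set 'M[C]_n :=
  [set w | mnorm (w - z) < r].

(* f is holomorphic on U /\ G_(n)(C), i.e. complex (Frechet) differentiable
   at every point of U /\ G_(n)(C) as a function of the affine coordinates
   of G_(n)(C) *)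
Definition holomorphic_on_G (n : nat) (f : 'M[C]_n.+1 -> C)
  (U : set 'M[C]_n.+1) : Prop :=
  forall z, U z -> Gmat z ->
    exists L : 'M[C]_n.+1,
      forall e : C, 0 < e -> exists d : C, 0 < d /\
        forall w, Gmat w -> mnorm (w - z) < d ->
          `|f w - f z - \sum_i \sum_j L i j * (w - z) i j|
            <= e * mnorm (w - z).

Definition path_in (n : nat) (U : set 'M[C]_n.+1) (gam : R -> 'M[C]_n.+1)
  : Prop :=
  (forall t, 0 <= t <= 1 -> U (gam t)) /\
  (forall t, 0 <= t <= 1 -> forall e : C, 0 < e ->
     exists d : R, 0 < d /\
       forall s, 0 <= s <= 1 -> `|s - t| < d -> mnorm (gam s - gam t) < e).

Definition continuation_along (n : nat) (gam : R -> 'M[C]_n.+1)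
  (f : R -> 'M[C]_n.+1 -> C) (r : R -> C) : Prop :=
  (forall t, 0 <= t <= 1 ->
     0 < r t /\ holomorphic_on_G (f t) (mball (gam t) (r t))) /\
  (forall t, 0 <= t <= 1 -> exists d : R, 0 < d /\
     forall s, 0 <= s <= 1 -> `|s - t| < d ->
       mball (gam t) (r t) (gam s) /\
       forall w, Gmat w -> mball (gam t) (r t) w ->
         mball (gam s) (r s) w -> f s w = f t w).

Definition starts_with_volume (g : geometry) (n : nat)
  (gam : R -> 'M[C]_n.+1) (f : R -> 'M[C]_n.+1 -> C) (r : R -> C) : Prop :=
  forall v : 'M[R]_n.+1, simplex_vertices g v ->
    mball (gam 0) (r 0) (cplx_mx (gram g v)) ->
    f 0 (cplx_mx (gram g v)) = cplx (simplex_volume g v).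

End Real.

(* Main.v *)
Require Import Defs.
From HB Require Import structures.
From mathcomp Require Import all_boot all_order all_algebra.
From mathcomp Require Import fingroup perm zify.
From mathcomp Require Import all_classical all_reals all_analysis.
From mathcomp Require Import measurable_realfun complex ring lra.
Import Order.TTheory GRing.Theory Num.Theory.
Import numFieldNormedType.Exports.
Set Implicit Arguments.
Unset Strict Implicit.
Unset Printing Implicit Defensive.
Local Open Scope classical_set_scope.
Local Open Scope ring_scope.
Local Open Scope complex_scope.

(** Write [N = n + 1] and [J M] for the integral of [exp (- s M s / 2)] over the positive
    orthant of [R^N]. Polar coordinates and the layer cake formula give
    [V(C)^2 = kappa^2 det(C) J(C)^2] on the domain of Gram matrices, hence near the starting
    point. [J (u C u^T) det u] is the integral of [exp (- q_C / 2)] over the cone spanned by the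
    rows of [u] in [C^N]; it is a cocycle in [u] as long as [Re q_C > 0] on the cone, so it
    extends to maps of a simplex into [{Re q_C > 0}] after a fine barycentric subdivision, and
    is invariant under homotopies that keep the faces in the coordinate hyperplanes. If no
    principal minor of [C] vanishes, the flow [x_i += tau |x_i|^2 conj((C x)_i)] increases
    [Re q_C] uniformly, so a chain can be transported to nearby matrices; hence along the whole
    path the square of the continued volume is [a det(C)] times the square of the integral over
    a chain.

    At the end point the chain is pushed into a real form of [C^N] on which [q_C] is positive
    definite: [R^N] for the sphere, and [R e_k + i e_k^perp] for Lobachevsky space. On this real
    form the integral is real, up to [i^n], so the continued volume has a nonnegative real
    square. In the Lobachevsky case the retraction moves the hyperplane [x_k = 0], so only a pair
    of maps that agree on that facet may be pushed; for even [n] such pairs are obtained at the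
    identity matrix, where [2 J] is the telescoping sum over the orthants with the first [k]
    signs flipped, and are transported to the starting point first. *)

(** * Complex differentiability and the identity theorem *)

(** Squares are used because [|\det v|] is only one of two roots of [\det C], whereas
    [kappa^2 \det(C) J(C)^2] is one holomorphic function, and a number with a nonnegative real
    square is real. Signs therefore count at the end: for a form of signature [(1, n)] the
    determinant is positive when [n] is even, the parity that also makes [i^n] real. The obstacle is
    uniformity. A chain lives where [Re q_C > 0], and its margin of positivity could shrink to zero
    along the path. The flow gains at least a multiple of [|x|^2] whose factor depends on the matrix
    only, so the radius within which a chain can be moved does not depend on the chain, and a
    supremum argument covers the path. Homotopy invariance compares the old and the new chain only
    near the old matrix; the identity theorem on complex lines carries the equality across the whole
    neighbourhood. No chain complex is built: cochains, functions of a matrix of vertices, are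
    subdivided instead, and nonlinear chains are compared for all sufficiently large numbers of
    subdivisions. *)

Section Complex.
Variable R : realType.
Local Notation C := R[i].
Local Notation Re := (@complex.Re R).
Local Notation Im := (@complex.Im R).
Implicit Types (z w h : C) (x y : R).

(** The norm of [R[i]] takes its values in [R[i]]; this is the same modulus as an element of [R],
    where the real inequalities live. *)
Definition cn z : R := ComplexField.Normc.normc z.

Lemma cnE z : `|z| = (cn z)%:C. Proof. by case: z. Qed.
Lemma cn_ge0 z : 0 <= cn z. Proof. by case: z => a b; exact: sqrtr_ge0. Qed.
Lemma cn0 : cn 0 = 0. Proof. exact: ComplexField.Normc.normc0. Qed.
Lemma cn1 : cn 1 = 1. Proof. exact: ComplexField.Normc.normc1. Qed.
Lemma cnD z w : cn (z + w) <= cn z + cn w. Proof. exact: le_normcD. Qed.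
Lemma cnM z w : cn (z * w) = cn z * cn w. Proof. exact: ComplexField.Normc.normcM. Qed.
Lemma cnN z : cn (- z) = cn z. Proof. exact: normcN. Qed.
Lemma cnV z : cn z^-1 = (cn z)^-1. Proof. exact: ComplexField.Normc.normcV. Qed.
Lemma cn_eq0 z : (cn z == 0) = (z == 0).
Proof.
apply/eqP/eqP => [|->]; [exact: ComplexField.Normc.eq0_normc|exact: cn0].
Qed.
Lemma cn_gt0 z : (0 < cn z) = (z != 0).
Proof. by rewrite lt_def cn_eq0 cn_ge0 andbT. Qed.
Lemma cnR x : cn x%:C = `|x|.
Proof. by rewrite /cn /= expr0n addr0 sqrtr_sqr. Qed.
Lemma cnX z n : cn (z ^+ n) = cn z ^+ n.
Proof. by elim: n => [|n IH]; rewrite ?expr0 ?cn1 // !exprS cnM IH. Qed.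
Lemma cnB z w : cn (z - w) <= cn z + cn w.
Proof. by rewrite (le_trans (cnD _ _))// cnN. Qed.
Lemma cn_sub z w : cn (z - w) = cn (w - z). Proof. by rewrite -cnN opprB. Qed.

Lemma cn_sum (I : Type) (r : seq I) (P : pred I) (F : I -> C) :
  cn (\sum_(i <- r | P i) F i) <= \sum_(i <- r | P i) cn (F i).
Proof.
elim/big_ind2: _ => [|a b c d ab cd|//]; first by rewrite cn0.
by rewrite (le_trans (cnD _ _))// lerD.
Qed.
Lemma cn2E z : cn z ^+ 2 = Re z ^+ 2 + Im z ^+ 2.
Proof. by case: z => a b; rewrite /cn /= sqr_sqrtr// addr_ge0// sqr_ge0. Qed.
Lemma Re_le_cn z : `|Re z| <= cn z.
Proof.
by rewrite -(ler_pXn2r (n := 2))// ?nnegrE ?cn_ge0// real_normK ?num_real//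
  cn2E lerDl sqr_ge0.
Qed.
Lemma Im_le_cn z : `|Im z| <= cn z.
Proof.
by rewrite -(ler_pXn2r (n := 2))// ?nnegrE ?cn_ge0// real_normK ?num_real//
  cn2E lerDr sqr_ge0.
Qed.
Lemma cn_le_ReIm z : cn z <= `|Re z| + `|Im z|.
Proof.
rewrite -(ler_pXn2r (n := 2))// ?nnegrE ?cn_ge0 ?addr_ge0// cn2E sqrrD.
by rewrite !real_normK ?num_real// lerD2r lerDl mulrn_wge0// mulr_ge0.
Qed.
Lemma cn_conj z : cn (z^*) = cn z.
Proof. by case: z => a b; rewrite /cn /= sqrrN. Qed.

Lemma ReD z w : Re (z + w) = Re z + Re w. Proof. by case: z; case: w. Qed.
Lemma ImD z w : Im (z + w) = Im z + Im w. Proof. by case: z; case: w. Qed.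
Lemma ReN z : Re (- z) = - Re z. Proof. by case: z. Qed.
Lemma ImN z : Im (- z) = - Im z. Proof. by case: z. Qed.
Lemma cReM z w : Re (z * w) = Re z * Re w - Im z * Im w.
Proof. by case: z; case: w. Qed.
Lemma cImM z w : Im (z * w) = Re z * Im w + Im z * Re w.
Proof. by case: z; case: w. Qed.
Lemma Re_sum (I : Type) (r : seq I) (P : pred I) (F : I -> C) :
  Re (\sum_(i <- r | P i) F i) = \sum_(i <- r | P i) Re (F i).
Proof. by elim/big_ind2: _ => [//|? a ? b <- <-|//]; rewrite ReD. Qed.
Lemma Im_sum (I : Type) (r : seq I) (P : pred I) (F : I -> C) :
  Im (\sum_(i <- r | P i) F i) = \sum_(i <- r | P i) Im (F i).
Proof. by elim/big_ind2: _ => [//|? a ? b <- <-|//]; rewrite ImD. Qed.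
Lemma ReMR z x : Re (z * x%:C) = Re z * x.
Proof. by rewrite cReM /= mulr0 subr0. Qed.
Lemma ImMR z x : Im (z * x%:C) = Im z * x.
Proof. by rewrite cImM /= mulr0 add0r. Qed.
Lemma C_eq z w : Re z = Re w -> Im z = Im w -> z = w.
Proof. by case: z => a b; case: w => c d /= -> ->. Qed.

Definition cexp z : C := (expR (Re z) * cos (Im z)) +i* (expR (Re z) * sin (Im z)).

Lemma cexpD z w : cexp (z + w) = cexp z * cexp w.
Proof.
apply: C_eq; rewrite ?cReM ?cImM /= ReD ImD expRD ?cosD ?sinD; ring.
Qed.
Lemma cexp0 : cexp 0 = 1.
Proof. by apply: C_eq; rewrite /= ?expR0 ?cos0 ?sin0 ?mulr1 ?mulr0. Qed.
Lemma cn_cexp z : cn (cexp z) = expR (Re z).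
Proof.
apply/eqP; rewrite -(eqrXn2 (n := 2))// ?cn_ge0 ?expR_ge0// cn2E /= !exprMn.
by rewrite -mulrDr cos2Dsin2 mulr1.
Qed.
Lemma cexp_neq0 z : cexp z != 0. Proof. by rewrite -cn_gt0 cn_cexp expR_gt0. Qed.

Lemma MVT_le (u du : R -> R) (K : R) :
  (forall t : R, is_derive t (1 : R) u (du t)) -> (forall t, 0 <= t <= 1 -> `|du t| <= K) ->
  `|u 1 - u 0| <= K.
Proof.
move=> dU dK; have [c c01 ->] : exists2 c, c \in `[0, 1] & u 1 - u 0 = du c * (1 - 0).
  apply: MVT_segment => //; apply: derivable_within_continuous => t _.
  by have [] := dU t.
by rewrite subr0 mulr1; apply: dK; move: c01; rewrite in_itv.
Qed.

Lemma is_derive_cexp_ray (h : C) (t : R) :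
  is_derive t (1 : R) (fun t => Re (cexp (t%:C * h))) (Re (h * cexp (t%:C * h))) /\
  is_derive t (1 : R) (fun t => Im (cexp (t%:C * h))) (Im (h * cexp (t%:C * h))).
Proof.
case: h => a b.
have E t' : cexp (t'%:C * (a +i* b)) =
    (expR (t' * a) * cos (t' * b)) +i* (expR (t' * a) * sin (t' * b)).
  by rewrite /cexp cReM cImM /= !mul0r subr0 addr0.
split.
- rewrite (_ : (fun _ => _) = fun t => expR (t * a) * cos (t * b)); last first.
    by apply/funext => t'; rewrite E.
  rewrite E cReM /=; apply: trigger_derive; rewrite /GRing.scale /=; ring.
- rewrite (_ : (fun _ => _) = fun t => expR (t * a) * sin (t * b)); last first.
    by apply/funext => t'; rewrite E.
  rewrite E cImM /=; apply: trigger_derive; rewrite /GRing.scale /=; ring.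
Qed.

(** Mean value theorem along the ray from [0] to [h], for the real and the imaginary part
    separately, whence the factor [2]. *)
Lemma cexp_sub1_le h : cn (cexp h - 1) <= 2 * cn h * expR (cn h).
Proof.
have bnd t : 0 <= t <= 1 -> cn (h * cexp (t%:C * h)) <= cn h * expR (cn h).
  move=> /andP[t0 t1]; rewrite cnM cn_cexp ler_wpM2l ?cn_ge0// ler_expR.
  rewrite cReM /= mul0r subr0 (le_trans (ler_norm _))// normrM ger0_norm//.
  by rewrite (le_trans (ler_piMl _ t1))// Re_le_cn.
have hR := MVT_le (fun t => (is_derive_cexp_ray h t).1)
  (fun t ht => le_trans (Re_le_cn _) (bnd t ht)).
have hI := MVT_le (fun t => (is_derive_cexp_ray h t).2)
  (fun t ht => le_trans (Im_le_cn _) (bnd t ht)).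
rewrite (le_trans (cn_le_ReIm _))// -mulrA mulr2n mulrDl mul1r ReD ImD ReN ImN.
by move: hR hI; rewrite !mul1r !mul0r cexp0 => hR hI; rewrite lerD.
Qed.

(** The mean value theorem again, for [cexp (t h) - t h], whose derivative [h (cexp (t h) - 1)] is
    bounded by the previous lemma; adding the two components turns [2] into [4]. *)
Lemma cexp_taylor1 h : cn (cexp h - 1 - h) <= 4 * cn h ^+ 2 * expR (cn h).
Proof.
have bnd t : 0 <= t <= 1 -> cn (h * cexp (t%:C * h) - h) <= 2 * cn h ^+ 2 * expR (cn h).
  move=> /andP[t0 t1]; rewrite -[X in _ - X]mulr1 -mulrBr cnM.
  rewrite (_ : 2 * _ * _ = cn h * (2 * cn h * expR (cn h))); last by ring.
  rewrite ler_wpM2l ?cn_ge0// (le_trans (cexp_sub1_le _))// cnM cnR ger0_norm//.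
  have th : t * cn h <= cn h by rewrite ler_piMl// cn_ge0.
  rewrite ler_pM ?mulr_ge0 ?expR_ge0 ?cn_ge0//; last by rewrite ler_expR.
  by rewrite ler_wpM2l.
have hR : `|Re (cexp h - 1 - h)| <= 2 * cn h ^+ 2 * expR (cn h).
  pose u t := Re (cexp (t%:C * h)) - t * Re h.
  have := @MVT_le u (fun t => Re (h * cexp (t%:C * h) - h)) _ _
    (fun t ht => le_trans (Re_le_cn _) (bnd t ht)).
  rewrite /u !mul1r !mul0r subr0 cexp0 !ReD !ReN /=.
  rewrite addrAC; apply => t; have [D _] := is_derive_cexp_ray h t.
  have D2 : is_derive t (1 : R) (fun t => t * Re h) (Re h).
    by apply: trigger_derive; rewrite /GRing.scale /=; ring.
  by rewrite ReD ReN; exact: (is_deriveB D D2).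
have hI : `|Im (cexp h - 1 - h)| <= 2 * cn h ^+ 2 * expR (cn h).
  pose u t := Im (cexp (t%:C * h)) - t * Im h.
  have := @MVT_le u (fun t => Im (h * cexp (t%:C * h) - h)) _ _
    (fun t ht => le_trans (Im_le_cn _) (bnd t ht)).
  rewrite /u !mul1r !mul0r subr0 cexp0 !ImD !ImN /=.
  rewrite addrAC; apply => t; have [_ D] := is_derive_cexp_ray h t.
  have D2 : is_derive t (1 : R) (fun t => t * Im h) (Im h).
    by apply: trigger_derive; rewrite /GRing.scale /=; ring.
  by rewrite ImD ImN; exact: (is_deriveB D D2).
by rewrite (le_trans (cn_le_ReIm _))// (le_trans (lerD hR hI))//; lra.
Qed.

End Complex.

(** * Complex differentiability in slope form *)

Section Differentiable.
Variable R : realType.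
Local Notation C := R[i].
Local Notation Re := (@complex.Re R).
Local Notation Im := (@complex.Im R).
Implicit Types (h k s : C -> C) (z w : C).

Definition ccont s z := forall e : R, 0 < e ->
  exists2 d : R, 0 < d & forall w, cn (w - z) < d -> cn (s w - s z) < e.

Lemma ccont_cst c z : ccont (fun=> c) z.
Proof. by move=> e e0; exists 1 => // w _; rewrite subrr cn0. Qed.

Lemma ccont_id z : ccont id z.
Proof. by move=> e e0; exists e. Qed.

Lemma ccontD s k z : ccont s z -> ccont k z -> ccont (fun w => s w + k w) z.
Proof.
move=> cs ck e e0; have e20 : 0 < e / 2 by rewrite divr_gt0.
have [d1 d10 h1] := cs _ e20; have [d2 d20 h2] := ck _ e20.
exists (Num.min d1 d2) => [|w]; first by rewrite lt_min d10.
rewrite lt_min => /andP[w1 w2]; rewrite opprD addrACA (le_lt_trans (cnD _ _))//.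
by rewrite (splitr e) ltrD ?h1 ?h2.
Qed.

Lemma ccont_bounded s z : ccont s z ->
  exists M, exists2 d : R, 0 < d & forall w, cn (w - z) < d -> cn (s w) <= M.
Proof.
move=> /(_ 1 ltr01)[d d0 hd]; exists (1 + cn (s z)), d => // w /hd /ltW sw.
by rewrite -(subrK (s z) (s w)) (le_trans (cnD _ _))// lerD2r.
Qed.

Lemma ccontM s k z : ccont s z -> ccont k z -> ccont (fun w => s w * k w) z.
Proof.
move=> cs ck e e0; have [M [d3 d30 hM]] := ccont_bounded ck.
have M0 : 0 <= M by rewrite (le_trans (cn_ge0 (k z)))// hM// subrr cn0.
pose A := 1 + cn (s z); pose B := 1 + M.
have A0 : 0 < A by rewrite ltr_wpDr ?cn_ge0.
have B0 : 0 < B by rewrite ltr_wpDr.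
have [d1 d10 h1] := cs _ (divr_gt0 (divr_gt0 e0 (ltr0Sn _ 1)) B0 : 0 < e / 2%:R / B).
have [d2 d20 h2] := ck _ (divr_gt0 (divr_gt0 e0 (ltr0Sn _ 1)) A0 : 0 < e / 2%:R / A).
exists (Num.min d3 (Num.min d1 d2)) => [|w]; first by rewrite !lt_min d10 d30.
rewrite !lt_min => /and3P[w3 w1 w2].
rewrite (_ : _ - _ = (s w - s z) * k w + s z * (k w - k z)); last by ring.
rewrite (le_lt_trans (cnD _ _))// !cnM (splitr e) ltr_leD//.
- rewrite (@le_lt_trans _ _ (cn (s w - s z) * B))//.
    by rewrite ler_wpM2l ?cn_ge0// (le_trans (hM _ w3))// lerDr.
  by rewrite -ltr_pdivlMr// h1.
- rewrite (@le_trans _ _ (A * cn (k w - k z)))//.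
    by rewrite ler_wpM2r ?cn_ge0// lerDr.
  by rewrite mulrC -ler_pdivlMr// ltW// h2.
Qed.

Lemma ccont_comp s k z : ccont s z -> ccont k (s z) -> ccont (fun w => k (s w)) z.
Proof.
move=> cs ck e /ck[d d0 hd]; have [d' d'0 hd'] := cs _ d0.
by exists d' => // w /hd' /hd.
Qed.

Lemma ccontV z : z != 0 -> ccont (fun w : C => w^-1) z.
Proof.
move=> z0 e e0; have nz0 : 0 < cn z by rewrite cn_gt0.
have p0 : 0 < e * (cn z ^+ 2 / 2) by rewrite !mulr_gt0// invr_gt0.
exists (Num.min (cn z / 2) (e * (cn z ^+ 2 / 2))) => [|w].
  by rewrite lt_min p0 divr_gt0.
rewrite lt_min => /andP[w1 w2].
have wz : cn z / 2 < cn w.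
  have := cnB w (w - z); rewrite opprB addrC subrK => h.
  by rewrite -(ltrD2r (cn z / 2)) -splitr (le_lt_trans h)// ltrD2l.
have w0 : w != 0 by rewrite -cn_gt0 (lt_trans _ wz)// divr_gt0.
have nw0 : 0 < cn w by rewrite cn_gt0.
rewrite (_ : _ - _ = (z - w) * (w^-1 * z^-1)); last by field; rewrite w0 z0.
rewrite !cnM !cnV cn_sub -invfM ltr_pdivrMr ?mulr_gt0//.
rewrite (lt_le_trans w2)// ler_wpM2l ?(ltW e0)// expr2 -mulrA mulrC.
by rewrite ler_wpM2r ?(ltW nz0)// ltW.
Qed.

Lemma ccont_near s k z d : 0 < d -> (forall w, cn (w - z) < d -> s w = k w) ->
  ccont s z -> ccont k z.
Proof.
move=> d0 sk cs e /cs[d' d'0 hd']; exists (Num.min d d') => [|w].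
  by rewrite lt_min d0.
rewrite lt_min => /andP[w1 w2]; rewrite -sk// -sk ?subrr ?cn0//.
exact: hd'.
Qed.

(** Caratheodory's form of differentiability: the difference quotient extends to a function
    continuous at [z]. The rules for products, compositions and inverses then follow by algebra from
    those for [ccont]. *)
Definition cdiff h z :=
  exists2 s, ccont s z & forall w, h w = h z + s w * (w - z).

Lemma cdiffP h z l : (forall e : R, 0 < e -> exists2 d : R, 0 < d &
    forall w, cn (w - z) < d -> cn (h w - h z - l * (w - z)) <= e * cn (w - z)) ->
  cdiff h z.
Proof.
move=> hl; exists (fun w => if w == z then l else (h w - h z) / (w - z)); last first.
  move=> w; have [->|wz] := eqVneq w z; first by rewrite subrr mulr0 addr0.
  by rewrite mulfVK ?subr_eq0// addrC subrK.
move=> e e0; have [d d0 hd] := hl _ (divr_gt0 e0 (ltr0Sn _ 1) : 0 < e / 2%:R).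
exists d => // w /hd hw; rewrite eqxx; case: eqVneq hw => [_ _|wz hw].
  by rewrite subrr cn0.
have wz0 : w - z != 0 by rewrite subr_eq0.
rewrite (_ : _ - l = (h w - h z - l * (w - z)) / (w - z)); last first.
  by rewrite [RHS]mulrBl mulfK.
rewrite cnM cnV ltr_pdivrMr ?cn_gt0// (le_lt_trans hw)//.
by rewrite ltr_pM2r ?cn_gt0// gtr_pMr// invf_lt1// ltrDl.
Qed.

Lemma cdiff_expand h z : cdiff h z -> exists l, forall e : R, 0 < e -> exists2 d : R, 0 < d &
  forall w, cn (w - z) < d -> cn (h w - h z - l * (w - z)) <= e * cn (w - z).
Proof.
move=> [s cs hs]; exists (s z) => e /cs[d d0 hd]; exists d => // w /hd /ltW sw.
by rewrite hs (addrC (h z)) addrK -mulrBl cnM ler_wpM2r ?cn_ge0.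
Qed.

Lemma cdiff_ccont h z : cdiff h z -> ccont h z.
Proof.
move=> [s cs hs]; have : ccont (fun w => h z + s w * (w - z)) z.
  apply: ccontD; [exact: ccont_cst|apply: ccontM => //].
  by apply: ccontD; [exact: ccont_id|exact: ccont_cst].
by apply: (@ccont_near _ _ _ 1) => // w _; rewrite -hs.
Qed.

Lemma cdiff_cst c z : cdiff (fun=> c) z.
Proof. by exists (fun=> 0) => [|w]; [exact: ccont_cst|rewrite mul0r addr0]. Qed.

Lemma cdiff_id z : cdiff id z.
Proof. by exists (fun=> 1) => [|w]; [exact: ccont_cst|rewrite mul1r addrC subrK]. Qed.

Lemma cdiffD h k z : cdiff h z -> cdiff k z -> cdiff (fun w => h w + k w) z.
Proof.
move=> [s cs hs] [t ct ht]; exists (fun w => s w + t w); first exact: ccontD.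
by move=> w; rewrite hs ht; ring.
Qed.

Lemma cdiffM h k z : cdiff h z -> cdiff k z -> cdiff (fun w => h w * k w) z.
Proof.
move=> dh dk; have ck := cdiff_ccont dk; move: dh dk => [s cs hs] [t ct ht].
exists (fun w => s w * k w + h z * t w).
  by apply: ccontD; [exact: ccontM|apply: ccontM => //; exact: ccont_cst].
by move=> w; rewrite [in LHS]hs mulrDl [in h z * k w]ht; ring.
Qed.

Lemma cdiffN h z : cdiff h z -> cdiff (fun w => - h w) z.
Proof.
move=> /(cdiffM (cdiff_cst (-1) z)) [s cs hs]; exists s => // w.
by rewrite -mulN1r hs mulN1r.
Qed.

Lemma cdiffB h k z : cdiff h z -> cdiff k z -> cdiff (fun w => h w - k w) z.
Proof. by move=> dh dk; apply: cdiffD => //; exact: cdiffN. Qed.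

Lemma cdiffX h n z : cdiff h z -> cdiff (fun w => h w ^+ n) z.
Proof.
move=> dh; elim: n => [|n IH]; first exact: cdiff_cst.
have [s cs hs] := cdiffM dh IH; exists s => // w.
by rewrite !exprS hs.
Qed.

Lemma cdiff_sum (I : Type) (r : seq I) (P : pred I) (F : I -> C -> C) z :
  (forall i, cdiff (F i) z) -> cdiff (fun w => \sum_(i <- r | P i) F i w) z.
Proof.
move=> dF; elim: r => [|i r IH].
  have [s cs hs] := cdiff_cst 0 z; exists s => // w; rewrite !big_nil; exact: hs.
have [s cs hs] : cdiff (fun w => (if P i then F i w else 0) + \sum_(j <- r | P j) F j w) z.
  by apply: cdiffD => //; case: (P i) => //; exact: cdiff_cst.
by exists s => // w; rewrite !big_cons; move: (hs w); case: (P i); rewrite ?add0r.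
Qed.

Lemma cdiff_prod (I : Type) (r : seq I) (P : pred I) (F : I -> C -> C) z :
  (forall i, cdiff (F i) z) -> cdiff (fun w => \prod_(i <- r | P i) F i w) z.
Proof.
move=> dF; elim: r => [|i r IH].
  have [s cs hs] := cdiff_cst 1 z; exists s => // w; rewrite !big_nil; exact: hs.
have [s cs hs] : cdiff (fun w => (if P i then F i w else 1) * \prod_(j <- r | P j) F j w) z.
  by apply: cdiffM => //; case: (P i) => //; exact: cdiff_cst.
by exists s => // w; rewrite !big_cons; move: (hs w); case: (P i); rewrite ?mul1r.
Qed.

Lemma cdiff_comp h k z : cdiff h z -> cdiff k (h z) -> cdiff (fun w => k (h w)) z.
Proof.
move=> dh [t ct ht]; have ch := cdiff_ccont dh; have [s cs hs] := dh.
exists (fun w => t (h w) * s w).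
  by apply: ccontM => //; exact: (@ccont_comp h t).
by move=> w; rewrite ht [in X in _ * X]hs; ring.
Qed.

Lemma cdiffV z : z != 0 -> cdiff (fun w : C => w^-1) z.
Proof.
(* The slope is [- (w^-1 * z^-1)]; at [w = 0], where [w^-1] is [0] by convention, the identity
   required by [cdiff] forces the value [z^-1 * z^-1]. *)
move=> z0; pose t (w : C) := if w == 0 then z^-1 * z^-1 else - (w^-1 * z^-1).
exists t; last first.
  move=> w; rewrite /t; have [->|w0] := eqVneq w 0.
    by rewrite invr0; field.
  by field; rewrite w0 z0.
apply: (@ccont_near (fun w => (-1) * (w^-1 * z^-1)) _ _ (cn z)).
- by rewrite cn_gt0.
- move=> w wz; rewrite /t; have [w0|w0] := eqVneq w 0; last by rewrite mulN1r.
  by move: wz; rewrite w0 sub0r cnN ltxx.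
apply: ccontM; first exact: ccont_cst.
by apply: ccontM; [exact: ccontV|exact: ccont_cst].
Qed.

Lemma cdiff_near h k z d : 0 < d -> (forall w, cn (w - z) < d -> h w = k w) ->
  cdiff h z -> cdiff k z.
Proof.
move=> d0 hk /cdiff_expand[l hl]; apply: (@cdiffP _ _ l) => e /hl[d' d'0 hd'].
exists (Num.min d d') => [|w]; first by rewrite lt_min d0.
by rewrite lt_min => /andP[w1 w2]; rewrite -hk// -hk ?subrr ?cn0//; exact: hd'.
Qed.

Lemma cdiff_cexp z : cdiff (@cexp R) z.
Proof.
apply: (@cdiffP _ _ (cexp z)) => e e0.
pose K := cn (cexp z) * 4 * expR 1.
have K0 : 0 < K by rewrite !mulr_gt0 ?expR_gt0// cn_gt0 cexp_neq0.
exists (Num.min 1 (e / K)) => [|w]; first by rewrite lt_min ltr01 divr_gt0.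
rewrite lt_min => /andP[w1 w2].
have -> : cexp w - cexp z - cexp z * (w - z) = cexp z * (cexp (w - z) - 1 - (w - z)).
  have -> : cexp w = cexp (w - z) * cexp z by rewrite -cexpD subrK.
  by ring.
rewrite cnM (le_trans (ler_wpM2l (cn_ge0 _) (cexp_taylor1 _)))//.
rewrite (@le_trans _ _ (K * cn (w - z) * cn (w - z)))//.
  have -> : K * cn (w - z) * cn (w - z) =
      cn (cexp z) * (4 * cn (w - z) ^+ 2 * expR 1) by rewrite /K; ring.
  by rewrite !ler_wpM2l ?mulr_ge0 ?cn_ge0 ?sqr_ge0// ler_expR ltW.
by rewrite ler_wpM2r ?cn_ge0// mulrC -ler_pdivlMr// ltW.
Qed.

End Differentiable.

(** * Integrals over segments and bisection of rectangles *)

Section Goursat.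
Variable R : realType.
Local Notation C := R[i].
Local Notation Re := (@complex.Re R).
Local Notation Im := (@complex.Im R).
Local Notation mu := (@lebesgue_measure R).

Definition rcont (u : R -> C) a b := forall x : R, a <= x <= b -> forall e : R, 0 < e ->
  exists2 d : R, 0 < d & forall y, `|y - x| < d -> cn (u y - u x) < e.

Lemma rcontB u v a b : rcont u a b -> rcont v a b -> rcont (fun x => u x - v x) a b.
Proof.
move=> cu cv x xab e e0; have e20 : 0 < e / 2 by rewrite divr_gt0.
have [d1 d10 h1] := cu x xab _ e20; have [d2 d20 h2] := cv x xab _ e20.
exists (Num.min d1 d2) => [|y]; first by rewrite lt_min d10.
rewrite lt_min => /andP[y1 y2]; rewrite opprB addrACA -opprB opprD addrACA.
rewrite (_ : _ + _ = (u y - u x) - (v y - v x)); last by ring.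
by rewrite (le_lt_trans (cnB _ _))// (splitr e) ltrD ?h1 ?h2.
Qed.

Lemma rcont_Re u a b : rcont u a b -> {within `[a, b], continuous (fun x => Re (u x))}.
Proof.
move=> cu; apply: continuous_in_subspaceT => x; rewrite inE /= in_itv /= => xab.
apply/cvgrPdist_lt => e e0; have [d d0 hd] := cu x xab e e0.
near=> y; rewrite -ReN -ReD; apply: (le_lt_trans (Re_le_cn _)).
rewrite cn_sub; apply: hd.
near: y; apply/nbhs_ballP; exists d => // y; by rewrite /ball /= distrC.
Unshelve. all: by end_near. Qed.

Lemma rcont_Im u a b : rcont u a b -> {within `[a, b], continuous (fun x => Im (u x))}.
Proof.
move=> cu; apply: continuous_in_subspaceT => x; rewrite inE /= in_itv /= => xab.
apply/cvgrPdist_lt => e e0; have [d d0 hd] := cu x xab e e0.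
near=> y; rewrite -ImN -ImD; apply: (le_lt_trans (Im_le_cn _)).
rewrite cn_sub; apply: hd.
near: y; apply/nbhs_ballP; exists d => // y; by rewrite /ball /= distrC.
Unshelve. all: by end_near. Qed.

Definition sint (u : R -> C) a b : C :=
  (\int[mu]_(x in `[a, b]) Re (u x)) +i* (\int[mu]_(x in `[a, b]) Im (u x)).

Lemma segment_integrable (v : R -> R) a b : {within `[a, b], continuous v} ->
  mu.-integrable `[a, b] (EFin \o v).
Proof. by move=> cv; apply: continuous_compact_integrable => //; exact: segment_compact. Qed.

Lemma Rintegral_segment_split (v : R -> R) a b m : a <= m -> m <= b ->
  {within `[a, b], continuous v} ->
  \int[mu]_(x in `[a, b]) v x =
  \int[mu]_(x in `[a, m]) v x + \int[mu]_(x in `[m, b]) v x.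
Proof.
move=> am mb cv; have iv := segment_integrable cv.
have := Rintegral_itvB iv; move=> /(_ m); rewrite !bnd_simp => /(_ am mb).
rewrite Rintegral_itv_obnd_cbnd => [<-|]; first by rewrite addrC subrK.
apply: integrableS iv => //; apply: subset_itvr; by rewrite bnd_simp.
Qed.

Lemma sint_split u a b m : a <= m -> m <= b -> rcont u a b ->
  sint u a b = sint u a m + sint u m b.
Proof.
move=> am mb cu; apply: C_eq; rewrite ?ReD ?ImD /=.
  by apply: Rintegral_segment_split => //; exact: rcont_Re.
by apply: Rintegral_segment_split => //; exact: rcont_Im.
Qed.

Lemma Rintegral_segment_bound (v : R -> R) (c K a b : R) : a <= b ->
  {within `[a, b], continuous v} -> (forall x, a <= x <= b -> `|v x - c| <= K) ->
  `|\int[mu]_(x in `[a, b]) v x - c * (b - a)| <= K * (b - a).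
Proof.
move=> ab cv vK; have mI : @measurable _ (measurableTypeR R) `[a, b] by exact: measurable_itv.
have cI (r : R) : mu.-integrable `[a, b] (EFin \o fun=> r).
  apply: segment_integrable; apply: continuous_subspaceT => x; exact: cvg_cst.
have iv := segment_integrable cv.
have muE : fine (mu `[a, b]) = b - a.
  rewrite lebesgue_measure_itv /= lte_fin; case: ltP => // ba.
  by rewrite (@le_anti _ _ a b) ?subrr// ab.
have h1 : (c - K) * (b - a) <= \int[mu]_(x in `[a, b]) v x.
  rewrite -muE -Rintegral_cst//; apply: (le_Rintegral mI (cI _) iv) => x.
  by rewrite /= in_itv /= => /vK; rewrite ler_norml => /andP[h _]; lra.
have h2 : \int[mu]_(x in `[a, b]) v x <= (c + K) * (b - a).
  rewrite -muE -Rintegral_cst//; apply: (le_Rintegral mI iv (cI _)) => x.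
  by rewrite /= in_itv /= => /vK; rewrite ler_norml => /andP[_ h]; lra.
move: (\int[mu]_(x in `[a, b]) v x) h1 h2 => I0 h1 h2.
by clear -h1 h2; rewrite ler_norml; apply/andP; split; lra.
Qed.

Lemma sint_bound u (c : C) (K a b : R) : a <= b -> rcont u a b ->
  (forall x, a <= x <= b -> cn (u x - c) <= K) ->
  cn (sint u a b - c * (b - a)%:C) <= 2 * K * (b - a).
Proof.
move=> ab cu uK; rewrite (le_trans (cn_le_ReIm _))// !ReD !ImD !ReN !ImN ReMR ImMR.
rewrite -mulrA (mulr2n 1) mulrDl mul1r lerD//.
- apply: (Rintegral_segment_bound ab (rcont_Re cu)) => x /uK.
  by apply: le_trans; rewrite -ReN -ReD Re_le_cn.
- apply: (Rintegral_segment_bound ab (rcont_Im cu)) => x /uK.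
  by apply: le_trans; rewrite -ImN -ImD Im_le_cn.
Qed.

(** Nested bisection in contrapositive form. It is the only compactness argument in the plane, used
    both for the vanishing of contour integrals and for the boundedness of continuous functions. *)
Lemma rect_induction (P : R -> R -> R -> R -> Prop) (a c W H : R) : 0 <= W -> 0 <= H ->
  (forall x y w h, a <= x -> x + w <= a + W -> c <= y -> y + h <= c + H -> 0 <= w -> 0 <= h ->
    P x y (w / 2) (h / 2) -> P (x + w / 2) y (w / 2) (h / 2) ->
    P x (y + h / 2) (w / 2) (h / 2) -> P (x + w / 2) (y + h / 2) (w / 2) (h / 2) ->
    P x y w h) ->
  (forall x0 y0, a <= x0 <= a + W -> c <= y0 <= c + H -> exists2 d : R, 0 < d &
    forall x y w h, a <= x -> x + w <= a + W -> c <= y -> y + h <= c + H ->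
      0 <= w < d -> 0 <= h < d -> x <= x0 <= x + w -> y <= y0 <= y + h -> P x y w h) ->
  P a c W H.
Proof.
move=> W0 H0 Pquad Ploc; apply/not_notP => nP.
pose w (j : nat) : R := W / 2 ^+ j; pose h (j : nat) : R := H / 2 ^+ j.
have w0 j : 0 <= w j by rewrite divr_ge0// exprn_ge0.
have h0 j : 0 <= h j by rewrite divr_ge0// exprn_ge0.
have wS j : w j.+1 = w j / 2 by rewrite /w exprSr invfM mulrA.
have hS j : h j.+1 = h j / 2 by rewrite /h exprSr invfM mulrA.
pose good j (p : R * R) := [/\ a <= p.1, p.1 + w j <= a + W, c <= p.2, p.2 + h j <= c + H
  & ~ P p.1 p.2 (w j) (h j)].
pose nxt j (p q : R * R) := good j p -> [/\ good j.+1 q, p.1 <= q.1, q.1 + w j.+1 <= p.1 + w j,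
  p.2 <= q.2 & q.2 + h j.+1 <= p.2 + h j].
have /choice[F HF] : forall jp : nat * (R * R), exists q, nxt jp.1 jp.2 q.
  move=> [j p] /=; have [[a1 b1 a2 b2 np]|ng] := pselect (good j p); last by exists p.
  have : exists q, [/\ p.1 <= q.1, q.1 + w j.+1 <= p.1 + w j,
      p.2 <= q.2, q.2 + h j.+1 <= p.2 + h j & ~ P q.1 q.2 (w j.+1) (h j.+1)].
    apply/not_existsP => hq; apply: np.
    have hw := w0 j; have hh := h0 j.
    have q1 := hq (p.1, p.2); have q2 := hq (p.1 + w j / 2, p.2).
    have q3 := hq (p.1, p.2 + h j / 2); have q4 := hq (p.1 + w j / 2, p.2 + h j / 2).
    move: q1 q2 q3 q4; rewrite /= wS hS => q1 q2 q3 q4.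
    apply: Pquad => //; apply/not_notP => np.
    - by apply: q1; split => //; lra.
    - by apply: q2; split => //; lra.
    - by apply: q3; split => //; lra.
    - by apply: q4; split => //; lra.
  move=> [q [q1 q2 q3 q4 q5]]; exists q => _; split => //; split => //; lra.
pose s := fix s (j : nat) : R * R := if j is j'.+1 then F (j', s j') else (a, c).
have gs j : good j (s j).
  elim: j => [|j IH] /=; first by split; rewrite /= /w /h ?expr0 ?divr1.
  by have [] := HF (j, s j) IH.
have mono j k : (s j).1 <= (s (j + k)%N).1 /\ (s (j + k)%N).1 + w (j + k)%N <= (s j).1 + w j
    /\ (s j).2 <= (s (j + k)%N).2 /\ (s (j + k)%N).2 + h (j + k)%N <= (s j).2 + h j.
  elim: k => [|k [m1 [m2 [m3 m4]]]]; first by rewrite addn0.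
  rewrite addnS; have [_ n1 n2 n3 n4] := HF ((j + k)%N, s (j + k)%N) (gs _).
  rewrite -/(s (j + k).+1) in n1 n2 n3 n4 *; move: n1 n2 n3 n4 => /= *; repeat split; lra.
have cross j k : (s j).1 <= (s k).1 + w k /\ (s j).2 <= (s k).2 + h k.
  have [jk|kj] := leqP j k.
    have [m1 [_ [m2 _]]] := mono j (k - j)%N; rewrite subnKC// in m1 m2.
    have := w0 k; have := h0 k; split; lra.
  have [_ [m1 [_ m2]]] := mono k (j - k)%N; rewrite subnKC ?(ltnW kj)// in m1 m2.
  have := w0 j; have := h0 j; split; lra.
(* By [cross], every lower corner lies below every upper corner, so the suprema of the lower corners
   are the coordinates of a point common to all the rectangles. *)
pose X := [set (s j).1 | j in [set: nat]]; pose Y := [set (s j).2 | j in [set: nat]].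
have hX : has_sup X.
  split; first by exists (s 0%N).1, 0%N.
  by exists ((s 0%N).1 + w 0%N) => _ [j _ <-]; have [] := cross j 0%N.
have hY : has_sup Y.
  split; first by exists (s 0%N).2, 0%N.
  by exists ((s 0%N).2 + h 0%N) => _ [j _ <-]; have [] := cross j 0%N.
have xin j : (s j).1 <= sup X <= (s j).1 + w j.
  apply/andP; split; first by apply: ub_le_sup => //; [exact: hX.2|exists j].
  by apply: ge_sup; [exact: hX.1|move=> _ [k _ <-]; have [] := cross k j].
have yin j : (s j).2 <= sup Y <= (s j).2 + h j.
  apply/andP; split; first by apply: ub_le_sup => //; [exact: hY.2|exists j].
  by apply: ge_sup; [exact: hY.1|move=> _ [k _ <-]; have [] := cross k j].
have x0in : a <= sup X <= a + W by have := xin 0%N; rewrite /= /w expr0 divr1.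
have y0in : c <= sup Y <= c + H by have := yin 0%N; rewrite /= /h expr0 divr1.
have [d d0 hd] := Ploc _ _ x0in y0in.
have [j [wj hj]] : exists j, w j < d /\ h j < d.
  have WH : 0 <= W + H by rewrite addr_ge0.
  pose j := (Num.truncn ((W + H) / d)).+1; exists j.
  have jd : W + H < d * 2 ^+ j.
    rewrite mulrC -ltr_pdivrMr// (lt_le_trans (truncnS_gt _))//.
    by rewrite -natrX ler_nat ltnW// ltn_expl.
  by split; rewrite /w /h ltr_pdivrMr ?exprn_gt0//; apply: le_lt_trans jd; lra.
have [g1 g2 g3 g4] := gs j; apply; apply: hd => //; rewrite ?w0 ?h0//.
Qed.

End Goursat.

Section Identity.
Variable R : realType.
Local Notation C := R[i].
Local Notation Re := (@complex.Re R).
Local Notation Im := (@complex.Im R).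
Local Notation mu := (@lebesgue_measure R).
Implicit Types (k : C -> C).

Lemma sintB (u v : R -> C) (a b : R) : rcont u a b -> rcont v a b ->
  sint u a b - sint v a b = sint (fun x => u x - v x) a b.
Proof.
move=> cu cv; have mI : @measurable _ (measurableTypeR R) `[a, b] by exact: measurable_itv.
apply: C_eq; rewrite ?ReD ?ImD ?ReN ?ImN /= -RintegralB//.
- by apply: eq_Rintegral => x _; rewrite ReD ReN.
- exact/segment_integrable/rcont_Re.
- exact/segment_integrable/rcont_Re.
- by apply: eq_Rintegral => x _; rewrite ImD ImN.
- exact/segment_integrable/rcont_Im.
- exact/segment_integrable/rcont_Im.
Qed.

Lemma rcont_vertical k (x c d : R) : (forall t, c <= t <= d -> ccont k (x +i* t)) ->
  rcont (fun t => k (x +i* t)) c d.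
Proof.
move=> ck t tcd e /(ck t tcd)[dl dl0 hd]; exists dl => // y yt; apply: hd.
rewrite (_ : _ - _ = 0 +i* (y - t)); last by apply: C_eq; rewrite ?ReD ?ImD ?ReN ?ImN /= ?subrr.
by rewrite (le_lt_trans (cn_le_ReIm _))//= normr0 add0r.
Qed.

Lemma rcont_horizontal k (y a b : R) : (forall t, a <= t <= b -> ccont k (t +i* y)) ->
  rcont (fun t => k (t +i* y)) a b.
Proof.
move=> ck t tab e /(ck t tab)[dl dl0 hd]; exists dl => // x xt; apply: hd.
rewrite (_ : _ - _ = (x - t) +i* 0); last by apply: C_eq; rewrite ?ReD ?ImD ?ReN ?ImN /= ?subrr.
by rewrite (le_lt_trans (cn_le_ReIm _))//= normr0 addr0.
Qed.

(** The contour integral of [k] along the boundary, counterclockwise: vertical sides carry the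
    factor [i]. *)
Definition rect_int k (x y w h : R) : C :=
  'i%C * (sint (fun t => k ((x + w) +i* t)) y (y + h) - sint (fun t => k (x +i* t)) y (y + h))
  - (sint (fun t => k (t +i* (y + h))) x (x + w) - sint (fun t => k (t +i* y)) x (x + w)).

Lemma rect_int_quad k (x y w h : R) : 0 <= w -> 0 <= h ->
  (forall s t, x <= s <= x + w -> y <= t <= y + h -> ccont k (s +i* t)) ->
  rect_int k x y w h =
    rect_int k x y (w / 2) (h / 2) + rect_int k (x + w / 2) y (w / 2) (h / 2)
  + (rect_int k x (y + h / 2) (w / 2) (h / 2)
    + rect_int k (x + w / 2) (y + h / 2) (w / 2) (h / 2)).
Proof.
move=> w0 h0 ck.
have xw : x + w / 2 + w / 2 = x + w by lra.
have yh : y + h / 2 + h / 2 = y + h by lra.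
rewrite /rect_int !xw !yh.
have V s : x <= s <= x + w -> sint (fun t => k (s +i* t)) y (y + h) =
    sint (fun t => k (s +i* t)) y (y + h / 2) + sint (fun t => k (s +i* t)) (y + h / 2) (y + h).
  move=> xs; rewrite (@sint_split _ _ _ _ (y + h / 2))//; try lra.
  by apply: rcont_vertical => t ty; apply: ck.
have H t : y <= t <= y + h -> sint (fun s => k (s +i* t)) x (x + w) =
    sint (fun s => k (s +i* t)) x (x + w / 2) + sint (fun s => k (s +i* t)) (x + w / 2) (x + w).
  move=> yt; rewrite (@sint_split _ _ _ _ (x + w / 2))//; try lra.
  by apply: rcont_horizontal => s xs; apply: ck.
rewrite !V ?H; try (apply/andP; split; lra).
by ring.
Qed.

(** Opposite sides differ by [l * w] and [l * (i h)] up to an error [2 e (w + h)]; the two main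
    terms give [i l w h] each and cancel. The remaining factor [2] comes from [sint_bound]. *)
Lemma rect_int_local k (x y w h e : R) (z l : C) : 0 <= w -> 0 <= h -> 0 < e ->
  (forall s t, x <= s <= x + w -> y <= t <= y + h -> ccont k (s +i* t)) ->
  (forall s t, x <= s <= x + w -> y <= t <= y + h ->
     cn (k (s +i* t) - k z - l * (s +i* t - z)) <= e * (w + h)) ->
  cn (rect_int k x y w h) <= 4 * e * (w + h) ^+ 2.
Proof.
move=> w0 h0 e0 ck kl.
have cV s : x <= s <= x + w -> rcont (fun t => k (s +i* t)) y (y + h).
  by move=> xs; apply: rcont_vertical => t ty; apply: ck.
have cH t : y <= t <= y + h -> rcont (fun s => k (s +i* t)) x (x + w).
  by move=> yt; apply: rcont_horizontal => s xs; apply: ck.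
have [x1 x2] : x <= x + w <= x + w /\ x <= x <= x + w by split; apply/andP; split; lra.
have [y1 y2] : y <= y + h <= y + h /\ y <= y <= y + h by split; apply/andP; split; lra.
rewrite /rect_int !sintB; [|exact: cH|exact: cH|exact: cV|exact: cV].
set U := sint _ _ _; set T := sint _ _ _.
have hU : cn (U - l * w%:C * h%:C) <= 2 * (2 * e * (w + h)) * h.
  have := @sint_bound _ (fun t => k ((x + w) +i* t) - k (x +i* t)) (l * w%:C) (2 * e * (w + h)) y (y + h).
  rewrite (addrC y h) addrK -(addrC y h); apply; first lra.
    exact: rcontB (cV _ x1) (cV _ x2).
  move=> t yt; have a1 := kl _ _ x1 yt; have a2 := kl _ _ x2 yt.
  rewrite (_ : _ - _ = (k ((x + w) +i* t) - k z - l * ((x + w) +i* t - z))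
     - (k (x +i* t) - k z - l * (x +i* t - z))).
    by rewrite (le_trans (cnB _ _))// (le_trans (lerD a1 a2))//; lra.
  rewrite (_ : w%:C = ((x + w) +i* t) - (x +i* t)); first by ring.
  by apply: C_eq; rewrite ?ReD ?ImD ?ReN ?ImN /=; ring.
have hT : cn (T - l * (0 +i* h) * w%:C) <= 2 * (2 * e * (w + h)) * w.
  have := @sint_bound _ (fun s => k (s +i* (y + h)) - k (s +i* y)) (l * (0 +i* h)) (2 * e * (w + h)) x (x + w).
  rewrite (addrC x w) addrK -(addrC x w); apply; first lra.
    exact: rcontB (cH _ y1) (cH _ y2).
  move=> s xs; have a1 := kl _ _ xs y1; have a2 := kl _ _ xs y2.
  rewrite (_ : _ - _ = (k (s +i* (y + h)) - k z - l * (s +i* (y + h) - z))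
     - (k (s +i* y) - k z - l * (s +i* y - z))).
    by rewrite (le_trans (cnB _ _))// (le_trans (lerD a1 a2))//; lra.
  rewrite (_ : 0 +i* h = (s +i* (y + h)) - (s +i* y)); first by ring.
  by apply: C_eq; rewrite ?ReD ?ImD ?ReN ?ImN /=; ring.
rewrite (_ : _ - T = 'i%C * (U - l * w%:C * h%:C) - (T - l * (0 +i* h) * w%:C)).
  rewrite (le_trans (cnB _ _))// cnM (_ : cn 'i%C = 1); last first.
    by rewrite /cn /= expr0n expr1n add0r sqrtr1.
  rewrite mul1r (le_trans (lerD hU hT))//; lra.
rewrite (_ : 0 +i* h = 'i%C * h%:C); first by ring.
by apply: C_eq; rewrite ?cReM ?cImM /=; ring.
Qed.

(** The bound [4 * e * (w + h) ^+ 2] reproduces itself exactly when summed over the four quarters,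
    so bisection passes it from small rectangles to the whole. *)
Theorem goursat k (a c W H : R) : 0 <= W -> 0 <= H ->
  (forall s t, a <= s <= a + W -> c <= t <= c + H -> cdiff k (s +i* t)) ->
  rect_int k a c W H = 0.
Proof.
move=> W0 H0 dk.
have key (e : R) : 0 < e -> cn (rect_int k a c W H) <= 4 * e * (W + H) ^+ 2.
  move=> e0; apply: (@rect_induction _
    (fun x y w h => cn (rect_int k x y w h) <= 4 * e * (w + h) ^+ 2) a c W H) => //.
  - move=> x y w h ax xw cy yh w0 h0 p1 p2 p3 p4; rewrite rect_int_quad//; last first.
      move=> s t /andP[s1 s2] /andP[t1 t2]; apply/cdiff_ccont/dk; lra.
    rewrite (le_trans (cnD _ _))// (le_trans (lerD (cnD _ _) (cnD _ _)))//.
    rewrite (le_trans (lerD (lerD p1 p2) (lerD p3 p4)))//.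
    by rewrite -mulrDl expr2; lra.
  - move=> x0 y0 hx hy; have [l hl] := cdiff_expand (dk _ _ hx hy).
    have [d d0 hd] := hl _ e0; exists (d / 2); first by rewrite divr_gt0.
    move=> x y w h ax xw cy yh /andP[w0 wd] /andP[h0 hd2] /andP[x1 x2] /andP[y1 y2].
    apply: (@rect_int_local _ _ _ _ _ _ (x0 +i* y0) l) => //.
      move=> s t /andP[s1 s2] /andP[t1 t2]; apply/cdiff_ccont/dk; lra.
    move=> s t /andP[s1 s2] /andP[t1 t2].
    have zz : cn (s +i* t - x0 +i* y0) <= w + h.
      rewrite (le_trans (cn_le_ReIm _))// ReD ImD ReN ImN /= lerD// ler_norml; lra.
    apply: le_trans (hd _ _) _; first by rewrite (le_lt_trans zz)//; lra.
    by rewrite ler_wpM2l// ltW.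
apply/eqP; rewrite -cn_eq0; apply/eqP/le_anti; rewrite cn_ge0 andbT.
apply/ler_addgt0Pl => e e0; rewrite addr0.
pose K := 4 * (W + H) ^+ 2 + 1.
have K0 : 0 < K by rewrite ltr_wpDl// mulr_ge0// sqr_ge0.
apply: le_trans (key _ (divr_gt0 e0 K0)) _.
rewrite (_ : 4 * (e / K) * _ = e * (4 * (W + H) ^+ 2 / K)); last by ring.
by rewrite ger_pMr// ler_pdivrMr// mul1r lerDl.
Qed.

End Identity.

(** * Maximum principle and identity theorem *)

Section IdentityTheorem.
Variable R : realType.
Local Notation C := R[i].
Local Notation Re := (@complex.Re R).
Local Notation Im := (@complex.Im R).
Local Notation mu := (@lebesgue_measure R).

(** Pulled back by [cexp], the annulus [expR (- W) <= |z| <= 1] becomes a rectangle of height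
    [2 pi]. Its integral vanishes, so the mean over the unit circle equals the mean over a tiny
    circle, which is close to [f 0]. The factor [2] is that of [sint_bound]. *)
Lemma center_le_circle (f : C -> C) (M : R) : (forall z, cn z <= 1 -> cdiff f z) ->
  (forall z, cn z = 1 -> cn (f z) <= M) -> cn (f 0) <= 2 * M.
Proof.
move=> df fM; apply/ler_addgt0Pl => e e0.
have e20 : 0 < e / 2 by rewrite divr_gt0.
have [d d0 hd] : exists2 d : R, 0 < d & forall w, cn (w - 0) < d -> cn (f w - f 0) < e / 2.
  by apply: cdiff_ccont; [apply: df; rewrite cn0|].
(* With this [W] the inner circle has radius below [d], since [expR W >= 1 + W > d^-1]. *)
pose W := d^-1; have W0 : 0 < W by rewrite invr_gt0.
have Wd : expR (- W) < d.
  rewrite expRN -[ltRHS]invrK ltf_pV2 ?posrE ?expR_gt0//.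
  by rewrite (lt_le_trans _ (expR_ge1Dx _))// ltrDr.
have pi0 : 0 < 2 * pi :> R by rewrite mulr_gt0 ?pi_gt0.
pose k z := f (cexp z).
have dk s t : - W <= s <= - W + W -> 0 <= t <= 0 + 2 * pi -> cdiff k (s +i* t).
  move=> /andP[_ s0] _; apply: (@cdiff_comp _ (@cexp R) f); first exact: cdiff_cexp.
  apply: df; rewrite cn_cexp /= -expR0 ler_expR; move: s0; lra.
have := goursat (ltW W0) (ltW pi0) dk; rewrite /rect_int add0r addNr.
(* The horizontal sides cancel by periodicity of [cexp]. *)
have -> : (fun t => k (t +i* (2 * pi))) = (fun t => k (t +i* 0)).
  apply/funext => t; rewrite /k /cexp /= cos0 sin0.
  by rewrite (_ : 2 * pi = pi *+ 2) ?cos2pi ?sin2pi// mulr_natl.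
have cV s : s <= 0 -> rcont (fun t => k (s +i* t)) 0 (2 * pi).
  move=> s0; apply: rcont_vertical => t _; apply: cdiff_ccont.
  apply: (@cdiff_comp _ (@cexp R) f); first exact: cdiff_cexp.
  by apply: df; rewrite cn_cexp /= -expR0 ler_expR.
have NW0 : - W <= 0 by rewrite oppr_le0 ltW.
rewrite subrr subr0 sintB; [|exact: cV|exact: cV].
move/eqP; rewrite mulf_eq0 => /orP[/eqP[]/eqP|/eqP sint0]; first by rewrite oner_eq0.
(* The integrand is compared with the constant [- f 0]: the outer circle contributes at most [M] to
   the difference, the inner one at most [e / 2]. *)
have := @sint_bound _ (fun x => k (0 +i* x) - k ((- W) +i* x)) (- f 0) (M + e / 2) 0 (2 * pi) (ltW pi0) (rcontB (cV _ (lexx _)) (cV _ NW0)).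
rewrite sint0 sub0r cnN cnM cnN cnR subr0 (gtr0_norm pi0) ler_pM2r//.
move=> h; rewrite (le_trans (h _)); [by []| |lra] => t _.
rewrite opprK -addrA (le_trans (cnD _ _))// lerD//.
  by apply: fM; rewrite cn_cexp /= expR0.
rewrite addrC cn_sub ltW// hd// subr0 cn_cexp; exact: Wd.
Qed.

(** [|1 + w^* xi|^2 - |xi + w|^2] factors as [(1 - |w|^2)(1 - |xi|^2)]; the same identity gives
    equality on the unit circle. *)
Lemma mobius_le (w xi : C) : cn w < 1 -> cn xi <= 1 -> cn (xi + w) <= cn (1 + w^* * xi).
Proof.
move=> w1 x1; rewrite -(ler_pXn2r (n := 2))// ?nnegrE ?cn_ge0//.
have hw : cn w ^+ 2 <= 1 by rewrite exprn_ile1 ?cn_ge0// ltW.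
have hx : cn xi ^+ 2 <= 1 by rewrite exprn_ile1 ?cn_ge0.
rewrite -subr_ge0 (_ : _ - _ = (1 - cn w ^+ 2) * (1 - cn xi ^+ 2)).
  by rewrite mulr_ge0// subr_ge0.
rewrite !cn2E; case: w {w1 hw} => a b; case: xi {x1 hx} => c d /=.
by ring.
Qed.

Lemma mobius_eq (w xi : C) : cn w < 1 -> cn xi = 1 -> cn (xi + w) = cn (1 + w^* * xi).
Proof.
move=> w1 x1; apply/eqP; rewrite -(eqrXn2 (n := 2))// ?cn_ge0// -subr_eq0.
have hx : cn xi ^+ 2 = 1 by rewrite x1 expr1n.
rewrite (_ : _ - _ = (cn w ^+ 2 - 1) * (1 - cn xi ^+ 2)); first by rewrite hx subrr mulr0.
rewrite !cn2E; case: w {w1} => a b; case: xi {x1 hx} => c d /=.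
by ring.
Qed.

(** Precomposition with the automorphism [psi] of the disc that sends [0] to [w] reduces to the
    centre. *)
Lemma disc_le_circle (f : C -> C) (M : R) (w : C) : (forall z, cn z <= 1 -> cdiff f z) ->
  (forall z, cn z = 1 -> cn (f z) <= M) -> cn w < 1 -> cn (f w) <= 2 * M.
Proof.
move=> df fM w1; pose psi (xi : C) := (xi + w) * (1 + w^* * xi)^-1.
have den xi : cn xi <= 1 -> 1 + w^* * xi != 0.
  move=> x1; apply/eqP => E; have := cn1 R.
  rewrite (_ : 1 = (1 + w^* * xi) - w^* * xi); last by rewrite addrK.
  rewrite E sub0r cnN cnM cn_conj => h.
  by have := le_lt_trans (ler_piMr (cn_ge0 w) x1) w1; rewrite h ltxx.
have psi0 : psi 0 = w by rewrite /psi add0r mulr0 addr0 invr1 mulr1.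
rewrite -{1}psi0; apply: (@center_le_circle (fun xi => f (psi xi))) => xi x1.
- apply: (@cdiff_comp _ psi f).
    apply: cdiffM; first by apply: cdiffD; [exact: cdiff_id|exact: cdiff_cst].
    apply: (@cdiff_comp _ (fun xi => 1 + w^* * xi) (fun z => z^-1)).
      apply: cdiffD; first exact: cdiff_cst.
      by apply: cdiffM; [exact: cdiff_cst|exact: cdiff_id].
    by apply: cdiffV; exact: den.
  apply: df; rewrite cnM cnV ler_pdivrMr ?cn_gt0 ?den// mul1r; exact: mobius_le.
- by apply: fM; rewrite cnM cnV mobius_eq// divff// cn_eq0 den ?x1.
Qed.

Lemma bounded_on_disc (f : C -> C) : (forall z, cn z < 2 -> ccont f z) ->
  exists M, forall z, cn z <= 1 -> cn (f z) <= M.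
Proof.
move=> cf; have [M hM] : exists M, forall s t, -1 <= s <= -1 + 2 -> -1 <= t <= -1 + 2 ->
    cn (f (s +i* t)) <= M.
  apply: (@rect_induction _ (fun x y w h => exists M, forall s t,
    x <= s <= x + w -> y <= t <= y + h -> cn (f (s +i* t)) <= M) (-1) (-1) 2 2) => //.
  - move=> x y w h _ _ _ _ w0 h0 [M1 h1] [M2 h2] [M3 h3] [M4 h4].
    exists (Num.max (Num.max M1 M2) (Num.max M3 M4)) => s t /andP[s1 s2] /andP[t1 t2].
    have [sx|sx] := leP s (x + w / 2); have [ty|ty] := leP t (y + h / 2); rewrite !le_max.
    + by rewrite h1//; apply/andP; split; lra.
    + by rewrite h3 ?orbT//; apply/andP; split; lra.
    + by rewrite h2 ?orbT//; apply/andP; split; lra.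
    + by rewrite h4 ?orbT//; apply/andP; split; lra.
  - move=> x0 y0 hx hy; have z2 : cn (x0 +i* y0) < 2.
      have : cn (x0 +i* y0) ^+ 2 <= 2.
        have : x0 ^+ 2 <= 1 by move: hx => /andP[a1 a2]; clear -a1 a2; nra.
        have : y0 ^+ 2 <= 1 by move: hy => /andP[a1 a2]; clear -a1 a2; nra.
        rewrite cn2E /=; lra.
      have := cn_ge0 (x0 +i* y0); set c := cn _ => c0 c2; rewrite ltNge; apply/negP => c3; nra.
    have [M [d d0 hd]] := ccont_bounded (cf _ z2).
    exists (d / 2); first by rewrite divr_gt0.
    move=> x y w h _ _ _ _ /andP[w0 wd] /andP[h0 hd2] /andP[x1 x2] /andP[y1 y2].
    exists M => s t /andP[s1 s2] /andP[t1 t2]; apply: hd.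
    rewrite (le_lt_trans (cn_le_ReIm _))// ReD ImD ReN ImN /= (splitr d) ltrD// ltr_norml; lra.
exists M => -[s t] z1; have := le_trans (Re_le_cn _) z1; have := le_trans (Im_le_cn _) z1.
by rewrite /= !ler_norml => /andP[? ?] /andP[? ?]; apply: hM; apply/andP; split; lra.
Qed.

(** The maximum principle applies to [f z / z^n], which is differentiable throughout because [f]
    vanishes near [0]. It gives [cn (f w) <= 2 M |w|^n] for every [n], and the right side tends to
    [0]. *)
Lemma open_identity (f : C -> C) (e : R) : (forall z, cn z < 2 -> cdiff f z) -> 0 < e ->
  (forall z, cn z < e -> f z = 0) -> forall w, cn w < 1 -> f w = 0.
Proof.
move=> df e0 f0 w w1.
have [->|wn0] := eqVneq w 0; first by apply: f0; rewrite cn0.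
have [M hM] := bounded_on_disc (fun z z2 => cdiff_ccont (df z z2)).
have key n : cn (f w) <= 2 * M * cn w ^+ n.
  pose g z := f z * z^-1 ^+ n.
  have := @disc_le_circle g M w _ _ w1.
  rewrite cnM cnX cnV exprVn ler_pdivrMr ?exprn_gt0 ?cn_gt0//; apply.
    move=> z z1; have z2 : cn z < 2 by rewrite (le_lt_trans z1)// ltr1n.
    have [->|z0] := eqVneq z 0.
      apply: (@cdiff_near _ (fun=> 0) _ _ e) => //; last exact: cdiff_cst.
      by move=> v; rewrite subr0 => /f0 fv; rewrite /g fv mul0r.
    apply: cdiffM; first exact: df.
    by apply: (@cdiffX _ (fun z : C => z^-1)); exact: cdiffV.
  by move=> z z1; rewrite cnM cnX cnV z1 invr1 expr1n mulr1 hM// z1.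
apply/eqP; rewrite -cn_eq0; apply/eqP/le_anti; rewrite cn_ge0 andbT.
have cv : (2 * M * cn w ^+ n) @[n --> \oo] --> (2 * M * 0 : R).
  apply: cvgM; first exact: cvg_cst.
  by apply: cvg_expr; rewrite ger0_norm ?cn_ge0.
rewrite mulr0 in cv; rewrite -(cvg_lim _ cv)//.
apply: limr_ge; first by apply/cvg_ex; exists 0.
by near=> n; exact: key.
Unshelve. all: by end_near. Qed.

(** The real interval is first thickened to an open set of zeros, to which [open_identity] applies.
    Radius [4] in the hypothesis against [1] in the conclusion leaves room for discs not centred at
    [0]. *)
Theorem real_identity (f : C -> C) (e : R) : (forall z, cn z < 4 -> cdiff f z) -> 0 < e ->
  (forall x : R, `|x| < e -> f x%:C = 0) -> forall z, cn z <= 1 -> f z = 0.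
Proof.
move=> df e0' f0'.
have [{e0' f0'} e [e0 e1 f0]] : exists e : R, [/\ 0 < e, e <= 1 & forall x : R, `|x| < e -> f x%:C = 0].
  exists (Num.min e 1); split; rewrite ?lt_min ?e0' ?ltr01 ?ge_min ?lexx ?orbT//.
  by move=> x; rewrite lt_min => /andP[/f0'].
(* [f] vanishes with its derivative on the interval, hence extending it by zero
   below the real axis keeps it differentiable. *)
pose u z := if 0 <= Im z then f z else 0.
have du z : cn z < e -> cdiff u z.
  move=> ze; have z4 : cn z < 4 by rewrite (lt_le_trans ze)// (le_trans e1)// ler1n.
  have [z0|z0|z0] := ltgtP (Im z) 0.
  - apply: (@cdiff_near _ (fun=> 0) _ _ (- Im z)); [by rewrite oppr_gt0| |exact: cdiff_cst].
    move=> v hv; rewrite /u leNgt; case: ltP => //= v0.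
    exfalso; have := le_lt_trans (Im_le_cn _) hv; rewrite ImD ImN ltr_norml.
    by clear -z0 v0 => /andP[]; lra.
  - apply: (@cdiff_near _ f _ _ (Im z)) => //; last exact: df.
    move=> v hv; rewrite /u leNgt; case: ltP => //= v0.
    exfalso; have := le_lt_trans (Im_le_cn _) hv; rewrite ImD ImN ltr_norml.
    by clear -z0 v0 => /andP[]; lra.
  - have zE : z = (Re z)%:C by apply: C_eq.
    have Rz : `|Re z| < e by rewrite (le_lt_trans (Re_le_cn _)).
    have fz : f z = 0 by rewrite zE f0.
    have [s cs hs] := df z z4.
    have sz : s z = 0.
      apply/eqP; rewrite -cn_eq0; apply/eqP/le_anti; rewrite cn_ge0 andbT.
      apply/ler_addgt0Pl => e' e'0; rewrite addr0; have [d d0 hd] := cs _ e'0.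
      pose r := Num.min (d / 2) ((e - `|Re z|) / 2).
      have r0 : 0 < r by rewrite lt_min !divr_gt0// subr_gt0.
      have rd : r < d by rewrite /r; have := ge_min (d/2) (d / 2) ((e - `|Re z|) / 2); rewrite lexx /=; lra.
      have re : r < e - `|Re z|.
        have : r <= (e - `|Re z|) / 2 by rewrite ge_min lexx orbT.
        by move=> h; apply: le_lt_trans h _; lra.
      have zr : z + r%:C - z = r%:C by rewrite addrC addKr.
      have F : f (z + r%:C) = 0.
        rewrite zE -rmorphD f0// (le_lt_trans (ler_normD _ _))// (gtr0_norm r0).
        by move: re; move: `|_| => p; clear; lra.
      have := hs (z + r%:C); rewrite F fz add0r zr => /esym/eqP.
      rewrite mulf_eq0 => /orP[/eqP h|/eqP[]/eqP]; last by rewrite gt_eqF.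
      by have := hd (z + r%:C); rewrite h sub0r cnN zr cnR gtr0_norm// => /(_ rd)/ltW.
    exists (fun v => if 0 <= Im v then s v else 0); last first.
      move=> v; rewrite /u z0 lexx; case: ifP => _; [exact: hs|by rewrite fz mul0r addr0].
    move=> e' e'0; have [d d0 hd] := cs _ e'0; exists d => // v /hd.
    by rewrite z0 lexx; case: ifP => // _; rewrite sz subrr cn0.
have [z1 [z1e fz1]] : exists z1, cn z1 <= 1 / 8 /\
    exists2 d : R, 0 < d & forall v, cn (v - z1) < d -> f v = 0.
  (* The disc of radius [e / 4] about [- i e / 8] crosses the real axis. Its concentric half lies
     below the axis, where [u] is zero; hence [u] vanishes on the whole disc, and [f] on its upper
     part. *)
  pose a : C := 0 +i* (- (e / 8)); pose b : C := (e / 4)%:C.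
  have ca : cn a = e / 8.
    by rewrite /cn /a /= expr0n add0r sqrrN sqrtr_sqr ger0_norm// divr_ge0// ltW.
  have cb : cn b = e / 4 by rewrite cnR gtr0_norm// divr_gt0.
  have b0 : b != 0 by rewrite -cn_gt0 cb divr_gt0.
  have g0 : forall w, cn w < 1 -> u (a + b * w) = 0.
    apply: (@open_identity (fun w => u (a + b * w)) (1 / 2)).
    - move=> z z2; apply: (@cdiff_comp _ (fun w => a + b * w) u).
        apply: cdiffD; first exact: cdiff_cst.
        by apply: cdiffM; [exact: cdiff_cst|exact: cdiff_id].
      apply: du; rewrite (le_lt_trans (cnD _ _))// cnM ca cb.
      by have := cn_ge0 z; clear -e0 z2 => z0; nra.
    - by rewrite divr_gt0.
    - move=> z zh; rewrite /u ImD cImM /= mul0r addr0; case: ifP => // h.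
      have := le_lt_trans (Im_le_cn _) zh; rewrite ltr_norml => /andP[_ z2].
      by exfalso; move: h z2; clear -e0; move: (Im z) => y; nra.
  exists (0 +i* (e / 16)); split.
    rewrite (le_trans (cn_le_ReIm _))//= normr0 add0r ger0_norm ?divr_ge0 ?(ltW e0)//.
    by clear -e1; lra.
  exists (e / 32); first by rewrite divr_gt0.
  move=> v hv; have v0 : 0 <= Im v.
    have := le_lt_trans (Im_le_cn _) hv; rewrite ImD ImN /= ltr_norml => /andP[h _].
    by clear -h e0; lra.
  have := g0 ((v - a) / b); rewrite (mulrCA b) divff// mulr1 (addrC a) subrK /u v0; apply.
  rewrite cnM cnV cb ltr_pdivrMr ?divr_gt0// mul1r.
  have -> : v - a = (v - (0 +i* (e / 16))) + (0 +i* (e / 16 + e / 8)).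
    by apply: C_eq; rewrite ?ReD ?ImD ?ReN ?ImN /=; ring.
  rewrite (le_lt_trans (cnD _ _))//.
  have : cn (0 +i* (e / 16 + e / 8)) <= e / 16 + e / 8.
    rewrite (le_trans (cn_le_ReIm _))//= normr0 add0r ger0_norm//.
    by rewrite addr_ge0// divr_ge0// ltW.
  by move: hv; move: (cn _) (cn _) => p q; clear -e0; lra.
have [d d0 hd] := fz1; move=> z hz.
(* The disc of radius [3 / 2] about [z1] contains the closed unit disc, as [cn z1 <= 1 / 8], and the
   disc of twice that radius stays within [cn z < 4]. *)
pose b : C := (3 / 2)%:C; have cb : cn b = 3 / 2 by rewrite cnR ger0_norm.
have b0 : b != 0 by rewrite -cn_gt0 cb.
have := @open_identity (fun w => f (z1 + b * w)) (d / 2) _ _ _ ((z - z1) / b).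
rewrite (mulrCA b) divff// mulr1 (addrC z1) subrK; apply.
- move=> w w2; apply: (@cdiff_comp _ (fun w => z1 + b * w) f).
    apply: cdiffD; first exact: cdiff_cst.
    by apply: cdiffM; [exact: cdiff_cst|exact: cdiff_id].
  apply: df; rewrite (le_lt_trans (cnD _ _))// cnM cb.
  by move: z1e w2; move: (cn z1) (cn w) => p q; clear; lra.
- by rewrite divr_gt0.
- move=> w wd; apply: hd; rewrite addrC addKr cnM cb.
  by move: wd (cn_ge0 w); move: (cn w) => p; clear -d0; lra.
- rewrite cnM cnV cb ltr_pdivrMr// mul1r (le_lt_trans (cnB _ _))//.
  by move: hz z1e; move: (cn z) (cn z1) => p q; clear; lra.
Qed.

End IdentityTheorem.

(** * Gaussian integrals over orthants *)

Section ProductMeasure.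
Context d1 d2 (T1 : measurableType d1) (T2 : measurableType d2) (R : realType).
Variable m1 : {sigma_finite_measure set T1 -> \bar R}.
Variable m2 : {sigma_finite_measure set T2 -> \bar R}.

(* The library keys its instances of [product_measure1] on subprobabilities, so
   sigma-finiteness of the product is attached to a copy. *)
Definition prod_meas := (m1 \x m2)%E.

HB.instance Definition _ := Measure.on prod_meas.

Let sigma_finite_prod_meas : sigma_finite setT prod_meas.
Proof.
have /sigma_finiteP[F [TF ndF Foo]] := sigma_finiteT m1.
have /sigma_finiteP[G [TG ndG Goo]] := sigma_finiteT m2.
exists (fun n => F n `*` G n); last first.
  move=> k; have [? ?] := Foo k; have [? ?] := Goo k; split.
    exact: measurableX.
  by rewrite [prod_meas _]product_measure1E// lte_mul_pinfty// ge0_fin_numE.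
rewrite -setXTT TF TG; apply/seteqP; split => -[x y].
  move=> [/= [n _ Fnx] [k _ Gky]]; exists (maxn n k) => //; split.
    by move: x Fnx; exact/subsetPset/ndF/leq_maxl.
  by move: y Gky; exact/subsetPset/ndG/leq_maxr.
by move=> [n _ []/= ? ?]; split; exists n.
Qed.

HB.instance Definition _ := Measure_isSigmaFinite.Build _ _ _ prod_meas
  sigma_finite_prod_meas.

End ProductMeasure.

Section Power.
Variable R : realType.

(** Each power carries its own measurable structure; packing type and measure together lets the
    [k]-fold product be defined by a fixpoint. *)
Record mspace := MSpace {
  ms_disp : measure_display;
  ms_type : measurableType ms_disp;
  ms_meas : {sigma_finite_measure set ms_type -> \bar R} }.

Definition prod_mspace (S : mspace) : mspace :=
  @MSpace _ (measurableTypeR R * ms_type S)%type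
   (prod_meas (@lebesgue_measure R) (ms_meas S)).

Definition unit_mspace : mspace := @MSpace _ unit (@dirac _ unit tt R).

Fixpoint pow_mspace (k : nat) : mspace :=
  if k is k'.+1 then prod_mspace (pow_mspace k') else unit_mspace.

Definition Rpow k := ms_type (pow_mspace k).
Definition Rleb k : {sigma_finite_measure set (Rpow k) -> \bar R} := ms_meas (pow_mspace k).

Fixpoint crd (k : nat) : Rpow k -> nat -> R :=
  match k return Rpow k -> nat -> R with
  | 0 => fun _ _ => 0
  | k'.+1 => fun p => Defs.ncons p.1 (@crd k' p.2)
  end.

Lemma measurable_crd k i : measurable_fun setT (fun p : Rpow k => crd p i).
Proof.
elim: k i => [|k IH] i /=; first exact: measurable_cst.
case: i => [|i] /=.
  exact: measurable_fst.
exact: (measurableT_comp (IH i) measurable_snd).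
Qed.

(** Inserts a coordinate at position [i]. The boundary relation of the Gaussian integrates out an
    arbitrary coordinate, so Tonelli is needed with any coordinate innermost. *)
Fixpoint insT (k : nat) (i : nat) : R * Rpow k -> Rpow k.+1 :=
  match i return R * Rpow k -> Rpow k.+1 with
  | 0 => id
  | i'.+1 => match k return R * Rpow k -> Rpow k.+1 with
     | 0 => id
     | k'.+1 => fun p => (p.2.1, @insT k' i' (p.1, p.2.2))
     end
  end.

Lemma measurable_insT k i : measurable_fun setT (@insT k i).
Proof.
elim: k i => [|k IH] [|i] //=.
apply: measurable_fun_pair.
  exact: (measurableT_comp measurable_fst measurable_snd).
apply: (measurableT_comp (IH i)).
apply: measurable_fun_pair; first exact: measurable_fst.
exact: (measurableT_comp measurable_snd measurable_snd).
Qed.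

Lemma tonelli_ins k i (H : Rpow k.+1 -> \bar R) :
  @measurable_fun _ _ (Rpow k.+1) (\bar R) setT H ->
  (forall p, 0 <= H p)%E -> (i <= k)%N ->
  (\int[Rleb k.+1]_p H p =
   \int[Rleb k]_t \int[@lebesgue_measure R]_x H (insT i (x, t)))%E.
Proof.
elim: k i H => [|k IH] [|i] H mH H0 ik //.
- by rewrite [LHS](@fubini_tonelli2 _ _ _ _ _ (@lebesgue_measure R) (Rleb 0)).
- by rewrite [LHS](@fubini_tonelli2 _ _ _ _ _ (@lebesgue_measure R) (Rleb k.+1)).
rewrite [LHS](@fubini_tonelli1 _ _ _ _ _ (@lebesgue_measure R) (Rleb k.+1))//.
rewrite [RHS](@fubini_tonelli1 _ _ _ _ _ (@lebesgue_measure R) (Rleb k)); last 2 first.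
- pose K (p : Rpow k.+1 * R) := H (insT i.+1 (p.2, p.1)).
  have mK : measurable_fun setT K.
    apply: (measurableT_comp mH).
    apply: (@measurableT_comp _ _ _ _ _ _ (@insT k.+1 i.+1)); first exact: measurable_insT.
    by apply: measurable_fun_pair; [exact: measurable_snd|exact: measurable_fst].
  exact: (@measurable_fun_fubini_tonelli_F _ _ _ _ _ (@lebesgue_measure R) K mK (fun p => H0 _)).
- move=> p; by apply: integral_ge0 => x _; apply: H0.
apply: eq_integral => x0 _; rewrite /fubini_F /=.
rewrite (IH i (fun t => H (x0, t)))//.
apply: (measurableT_comp mH).
apply: measurable_fun_pair => //; exact: measurable_cst.
Qed.

End Power.

(** * Dominated integrals over the orthant *)

Section Orthant.
Variable R : realType.
Local Notation C := R[i].
Local Notation Re := (@complex.Re R).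
Local Notation Im := (@complex.Im R).
Local Notation mu := (@lebesgue_measure R).
Local Notation T := (Rpow R).
Local Notation nu := (Rleb R).

Definition orthant k : set (T k) := [set p | forall i, (i < k)%N -> 0 <= crd p i].

Lemma orthantS k (p : T k.+1) : orthant p <-> 0 <= p.1 /\ orthant p.2.
Proof.
split => [h|[h0 h] [|i] //= ik]; last exact: h.
by split; [exact: (h 0%N)|move=> i ik; exact: (h i.+1)].
Qed.

Lemma measurable_orthant k : measurable (@orthant k).
Proof.
elim: k => [|k IH].
  by rewrite (_ : @orthant 0 = setT)//; apply/seteqP; split.
rewrite (_ : @orthant k.+1 = `[0, +oo[%classic `*` @orthant k).
  by apply: measurableX => //; exact: measurable_itv.
apply/seteqP; split => p; rewrite /setX /= in_itv /= andbT; by move/orthantS.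
Qed.

Definition csum k (p : T k) : R := \sum_(i < k) crd p i.

Lemma csumS k (p : T k.+1) : csum p = p.1 + csum p.2.
Proof. by rewrite /csum big_ord_recl. Qed.

Lemma csum_ge0 k (p : T k) : orthant p -> 0 <= csum p.
Proof. by move=> Dp; apply: sumr_ge0 => i _; apply: Dp. Qed.

Lemma crd_le_csum k (p : T k) (i : 'I_k) : orthant p -> crd p i <= csum p.
Proof.
by move=> Dp; rewrite /csum (bigD1 i)//= lerDl sumr_ge0// => j _; apply: Dp.
Qed.

Lemma measurable_csum k : measurable_fun setT (@csum k).
Proof.
apply: (@measurable_sum _ _ _ _ _ _ (fun (i : 'I_k) (p : T k) => crd p i)) => i.
exact: measurable_crd.
Qed.

Lemma int_expN (r : R) : 0 <= r ->
  (\int[mu]_(x in `[0%R, +oo[) (r * expR (- x))%:E = r%:E)%E.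
Proof.
move=> r0; rewrite (@ge0_continuous_FTC2y _ _ (fun x => - (r * expR (- x))) 0 0).
- by rewrite oppr0 expR0 mulr1 sub0e EFinN oppeK.
- by move=> x _; rewrite mulr_ge0 ?expR_ge0.
- apply: continuous_subspaceT => x; apply: cvgM; first exact: cvg_cst.
  apply: (@continuous_comp _ _ _ (fun x => - x) expR); last exact: continuous_expR.
  exact: opp_continuous.
- rewrite -[X in _ --> X]oppr0 -(mulr0 r); apply: cvgN; apply: cvgM; first exact: cvg_cst.
  exact: cvgr_expR.
- by move=> x _; apply: derivableN; apply: derivableM => //; apply: derivable1_comp.
- apply: cvg_at_right_filter; apply: cvgN; apply: cvgM; first exact: cvg_cst.
  apply: (@continuous_comp _ _ _ (fun x => - x) expR); last exact: continuous_expR.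
  exact: opp_continuous.
- move=> x _; rewrite derive1E.
  have D : is_derive x (1 : R) (fun x => - (r * expR (- x))) (r * expR (- x)).
    by apply: trigger_derive; rewrite /GRing.scale /=; ring.
  by have [_ ->] := D.
Qed.

Lemma int_csum k :
  (\int[nu k]_(p in @orthant k) (expR (- csum p))%:E = 1)%E.
Proof.
elim: k => [|k IH].
  rewrite (_ : @orthant 0 = setT); last by apply/seteqP; split.
  rewrite (_ : (fun _ => _) = cst 1%:E); last first.
    by apply/funext => p; rewrite /csum big_ord0 oppr0 expR0.
  by rewrite integral_cst// mul1e /= diracT.
have mE j : measurable_fun setT (fun p : T j => (expR (- csum p))%:E).
  apply/measurable_EFinP; apply: (measurableT_comp (@measurable_expR R)).
  by apply: measurable_funN; exact: measurable_csum.
rewrite integral_mkcond [LHS](@fubini_tonelli1 _ _ _ _ _ mu (nu k)); last 2 first.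
- apply/(measurable_restrictT _ (@measurable_orthant k.+1)).
  by apply: measurable_funS (mE k.+1).
- by move=> p; rewrite patchE; case: ifP => // _; rewrite lee_fin expR_ge0.
rewrite -[RHS](@int_expN 1 ler01) [RHS]integral_mkcond.
apply: eq_integral => x _; rewrite /fubini_F patchE.
rewrite (_ : (fun y => _) = (fun y => if x \in `[0%R, +oo[%classic then
    (expR (- x))%:E * ((fun y => (expR (- csum y))%:E) \_ (@orthant k)) y else 0))%E; last first.
  apply/funext => y; rewrite patchE; case: ifPn => [/set_mem/orthantS /= [x0 oy]|no].
    have xin : x \in `[0%R, +oo[%classic by rewrite mem_set//= in_itv /= x0.
    by rewrite xin patchE (mem_set oy) csumS opprD expRD EFinM.
  case: ifPn => // /set_mem /=; rewrite in_itv /= andbT => x0.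
  rewrite patchE; case: ifPn => [/set_mem oy|]; last by rewrite mule0.
  by move/negP: no; case; apply/mem_set/orthantS.
case: ifPn => xI; last by rewrite integral0.
rewrite ge0_integralZl//.
- by rewrite -integral_mkcond IH mule1 mul1r.
- apply/(measurable_restrictT _ (@measurable_orthant k)).
  by apply: measurable_funS (mE k).
- by move=> p _; rewrite patchE; case: ifP => // _; rewrite lee_fin expR_ge0.
Qed.

(** The weight [expR (- csum p)] has integral one over the orthant, so the constant [K] is itself a
    bound for the integral. *)
Definition dominated k (f : T k -> R) (K : R) :=
  measurable_fun setT f /\ forall p, orthant p -> `|f p| <= K * expR (- csum p).

Lemma integrable_csum k (K : R) :
  (nu k).-integrable (@orthant k) (EFin \o fun p => K * expR (- csum p)).
Proof.
have mE : measurable_fun setT (fun p : T k => expR (- csum p)).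
  apply: (measurableT_comp (@measurable_expR R)).
  by apply: measurable_funN; exact: measurable_csum.
have h1 : (nu k).-integrable (@orthant k) (fun p => (expR (- csum p))%:E).
  apply/integrableP; split.
    by apply/measurable_EFinP; apply: measurable_funS mE.
  rewrite (eq_integral (fun p => (expR (- csum p))%:E)) ?int_csum ?ltry// => p _.
  by rewrite gee0_abs// lee_fin expR_ge0.
have := @integrableZl _ _ _ (nu k) _ (@measurable_orthant k) K _ h1.
by congr (integrable _ _ _); apply/funext => p /=; rewrite EFinM.
Qed.

Lemma dominated_integrable k (f : T k -> R) K : dominated f K ->
  (nu k).-integrable (@orthant k) (EFin \o f).
Proof.
move=> [mf fK]; apply: (le_integrable (@measurable_orthant k) _ _ (integrable_csum k K)).
- by apply/measurable_EFinP; apply: measurable_funS mf.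
- by move=> p Dp /=; rewrite lee_fin (le_trans (fK p Dp))// ler_norm.
Qed.

Lemma dominated_bound k (f : T k -> R) K : dominated f K ->
  `|\int[nu k]_(p in @orthant k) f p| <= K.
Proof.
move=> df; have fi := dominated_integrable df; have mD := @measurable_orthant k.
rewrite (le_trans (le_normr_Rintegral mD fi))//.
have -> : K = \int[nu k]_(p in @orthant k) (K * expR (- csum p)).
  rewrite RintegralZl//; last first.
    by have := integrable_csum k 1; congr (integrable _ _ _); apply/funext => p /=; rewrite mul1r.
  by rewrite /Rintegral int_csum /= mulr1.
apply: le_Rintegral => //.
- exact: integrable_norm.
- exact: integrable_csum.
- by move=> p; exact: df.2.
Qed.

Definition cdominated k (f : T k -> C) (K : R) :=
  [/\ measurable_fun setT (fun p => Re (f p)), measurable_fun setT (fun p => Im (f p))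
   & forall p, orthant p -> cn (f p) <= K * expR (- csum p)].

Lemma cdominated_Re k (f : T k -> C) K : cdominated f K -> dominated (fun p => Re (f p)) K.
Proof. by move=> [mR mI fK]; split => // p /fK; apply: le_trans; exact: Re_le_cn. Qed.

Lemma cdominated_Im k (f : T k -> C) K : cdominated f K -> dominated (fun p => Im (f p)) K.
Proof. by move=> [mR mI fK]; split => // p /fK; apply: le_trans; exact: Im_le_cn. Qed.

Definition oint k (f : T k -> C) : C :=
  (\int[nu k]_(p in @orthant k) Re (f p)) +i* (\int[nu k]_(p in @orthant k) Im (f p)).

Lemma oint_bound k (f : T k -> C) K : cdominated f K -> cn (oint f) <= 2 * K.
Proof.
move=> df; rewrite (le_trans (cn_le_ReIm _))// /= mulr2n mulrDl mul1r.
by rewrite lerD// dominated_bound//; [exact: cdominated_Re|exact: cdominated_Im].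
Qed.

Lemma ointB k (f g : T k -> C) K L : cdominated f K -> cdominated g L ->
  oint f - oint g = oint (fun p => f p - g p).
Proof.
move=> df dg; have mD := @measurable_orthant k.
apply: C_eq; rewrite ?ReD ?ImD ?ReN ?ImN /= -RintegralB//.
- by apply: eq_Rintegral => x _; rewrite ReD ReN.
- exact: (dominated_integrable (cdominated_Re df)).
- exact: (dominated_integrable (cdominated_Re dg)).
- by apply: eq_Rintegral => x _; rewrite ImD ImN.
- exact: (dominated_integrable (cdominated_Im df)).
- exact: (dominated_integrable (cdominated_Im dg)).
Qed.

Lemma ointD k (f g : T k -> C) K L : cdominated f K -> cdominated g L ->
  oint f + oint g = oint (fun p => f p + g p).
Proof.
move=> df dg; have mD := @measurable_orthant k.
apply: C_eq; rewrite ?ReD ?ImD /= -RintegralD//.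
- by apply: eq_Rintegral => x _; rewrite ReD.
- exact: (dominated_integrable (cdominated_Re df)).
- exact: (dominated_integrable (cdominated_Re dg)).
- by apply: eq_Rintegral => x _; rewrite ImD.
- exact: (dominated_integrable (cdominated_Im df)).
- exact: (dominated_integrable (cdominated_Im dg)).
Qed.

Lemma ointZ k (f : T k -> C) (c : C) K : cdominated f K ->
  c * oint f = oint (fun p => c * f p).
Proof.
move=> df; have mD := @measurable_orthant k.
have iR := dominated_integrable (cdominated_Re df).
have iI := dominated_integrable (cdominated_Im df).
have iZ (a : R) (g : T k -> R) : (nu k).-integrable (@orthant k) (EFin \o g) ->
    (nu k).-integrable (@orthant k) (EFin \o (fun p => a * g p)).
  move=> ig; have := @integrableZl _ _ _ (nu k) _ mD a _ ig.
  by congr (integrable _ _ _); apply/funext => p /=; rewrite EFinM.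
apply: C_eq; rewrite ?cReM ?cImM /=.
- rewrite -!RintegralZl// -RintegralB//; [|exact: iZ|exact: iZ].
  by apply: eq_Rintegral => x _; rewrite cReM.
- rewrite -!RintegralZl// -RintegralD//; [|exact: iZ|exact: iZ].
  by apply: eq_Rintegral => x _; rewrite cImM.
Qed.

Lemma cdominatedD k (f g : T k -> C) K L : cdominated f K -> cdominated g L ->
  cdominated (fun p => f p + g p) (K + L).
Proof.
move=> [m1 m2 m3] [n1 n2 n3]; split.
- rewrite (_ : (fun _ => _) = (fun p => Re (f p) + Re (g p))); last first.
    by apply/funext => p; rewrite ReD.
  exact: measurable_funD.
- rewrite (_ : (fun _ => _) = (fun p => Im (f p) + Im (g p))); last first.
    by apply/funext => p; rewrite ImD.
  exact: measurable_funD.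
- by move=> p Dp; rewrite (le_trans (cnD _ _))// mulrDl lerD ?m3 ?n3.
Qed.

Lemma measurable_Mc k (f g : T k -> C) :
  measurable_fun setT (fun p => Re (f p)) -> measurable_fun setT (fun p => Im (f p)) ->
  measurable_fun setT (fun p => Re (g p)) -> measurable_fun setT (fun p => Im (g p)) ->
  measurable_fun setT (fun p => Re (f p * g p)) /\ measurable_fun setT (fun p => Im (f p * g p)).
Proof.
move=> m1 m2 n1 n2; split.
- rewrite (_ : (fun _ => _) = (fun p => Re (f p) * Re (g p) - Im (f p) * Im (g p))).
    by apply: measurable_funB; exact: measurable_funM.
  by apply/funext => p; rewrite cReM.
- rewrite (_ : (fun _ => _) = (fun p => Re (f p) * Im (g p) + Im (f p) * Re (g p))).
    by apply: measurable_funD; exact: measurable_funM.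
  by apply/funext => p; rewrite cImM.
Qed.

Lemma cdominatedZ k (f : T k -> C) (c : C) K : cdominated f K ->
  cdominated (fun p => c * f p) (cn c * K).
Proof.
move=> [m1 m2 m3]; have [n1 n2] := @measurable_Mc _ (fun=> c) _ (measurable_cst _) (measurable_cst _) m1 m2.
by split => // p Dp; rewrite cnM -mulrA ler_wpM2l ?cn_ge0// m3.
Qed.

Lemma oint_sum k (I : Type) (r : seq I) (f : I -> T k -> C) (K : I -> R) :
  (forall i, cdominated (f i) (K i)) ->
  cdominated (fun p => \sum_(i <- r) f i p) (\sum_(i <- r) K i) /\
  oint (fun p => \sum_(i <- r) f i p) = \sum_(i <- r) oint (f i).
Proof.
move=> df; elim: r => [|i r [IH1 IH2]].
  rewrite big_nil (_ : (fun _ => _) = fun=> 0); last by apply/funext => p; rewrite big_nil.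
  split; first by split => [||p _]; [exact: measurable_cst|exact: measurable_cst|rewrite cn0 mul0r].
  by rewrite big_nil; apply: C_eq; rewrite /= Rintegral_cst ?mul0r//; exact: measurable_orthant.
rewrite !big_cons (_ : (fun _ => _) = fun p => f i p + \sum_(j <- r) f j p); last first.
  by apply/funext => p; rewrite big_cons.
split; first exact: cdominatedD.
by rewrite -IH2 (ointD (df i) IH1).
Qed.

End Orthant.

Section Gaussian.
Variable R : realType.
Local Notation C := R[i].
Local Notation Re := (@complex.Re R).
Local Notation Im := (@complex.Im R).
Local Notation mu := (@lebesgue_measure R).
Local Notation T := (Rpow R).
Local Notation nu := (Rleb R).

Lemma crd_insT k i x (t : T k) : (i <= k)%N ->
  crd (insT i (x, t)) i = x /\ forall j, crd (insT i (x, t)) (bump i j) = crd t j.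
Proof.
elim: k i t => [|k IH] [|i] t ik //.
have [h1 h2] := IH i t.2 ik; split; first exact: h1.
move=> [|j] //; rewrite (_ : bump i.+1 j.+1 = (bump i j).+1); first exact: h2.
by rewrite /bump addnS.
Qed.

Lemma crd_insT_id k (i : 'I_k.+1) x (t : T k) : crd (insT i (x, t)) i = x.
Proof. by have [] := crd_insT x t (ltn_ord i). Qed.

Lemma crd_insT_lift k (i : 'I_k.+1) x (t : T k) (j : 'I_k) :
  crd (insT i (x, t)) (lift i j) = crd t j.
Proof. by have [_] := crd_insT x t (ltn_ord i); apply. Qed.

Lemma csum_insT k (i : 'I_k.+1) x (t : T k) : csum (insT i (x, t)) = x + csum t.
Proof.
rewrite /csum (bigD1_ord i)// crd_insT_id; congr (_ + _).
by apply: eq_bigr => j _; exact: crd_insT_lift.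
Qed.

Lemma orthant_insT k (i : 'I_k.+1) x (t : T k) :
  orthant (insT i (x, t)) <-> 0 <= x /\ orthant t.
Proof.
split => [h|[x0 ot] j jk].
  split; first by have := h i (ltn_ord i); rewrite crd_insT_id.
  by move=> j jk; have := h (lift i (Ordinal jk)) (ltn_ord _); rewrite crd_insT_lift.
change (0 <= crd (insT i (x, t)) (Ordinal jk)).
case: (unliftP i (Ordinal jk)) => [l ->|->]; last by rewrite crd_insT_id.
by rewrite crd_insT_lift; apply: ot.
Qed.

(** Tonelli is applied to the positive and the negative part separately, and the two inner integrals
    are recombined on each line. *)
Lemma oint_partial k (i : 'I_k.+1) (f : T k.+1 -> R) (e : T k -> R) K : dominated f K ->
  (forall t, orthant t ->
     (\int[mu]_(x in `[0%R, +oo[) (f (insT i (x, t)))%:E = (e t)%:E)%E) ->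
  \int[nu k.+1]_(p in @orthant R k.+1) f p = \int[nu k]_(t in @orthant R k) e t.
Proof.
move=> df fe; have [mf fK] := df.
have mD := @measurable_orthant R k.+1; have mD' := @measurable_orthant R k.
have fi := dominated_integrable df.
pose H : T k.+1 -> \bar R := (EFin \o f) \_ (@orthant R k.+1).
have mH : @measurable_fun _ _ (T k.+1) (\bar R) setT H.
  by apply/(measurable_restrictT _ mD)/measurable_EFinP; apply: measurable_funS mf.
have Hi : (nu k.+1).-integrable setT H by rewrite -integrable_mkcond.
have [Hp Hn] : (\int[nu k.+1]_p H^\+ p < +oo)%E /\ (\int[nu k.+1]_p H^\- p < +oo)%E.
  by split; [have := integrable_pos_fin_num measurableT Hi|have := integrable_neg_fin_num measurableT Hi];
    rewrite fin_numE => /andP[_]; rewrite ltey.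
have mHp : @measurable_fun _ _ (T k.+1) (\bar R) setT (H^\+)%E by exact: measurable_funepos.
have mHn : @measurable_fun _ _ (T k.+1) (\bar R) setT (H^\-)%E by exact: measurable_funeneg.
pose A (G : T k.+1 -> \bar R) t := (\int[mu]_x G (insT i (x, t)))%E.
have tonA G : @measurable_fun _ _ (T k.+1) (\bar R) setT G -> (forall p, 0 <= G p)%E ->
    (\int[nu k.+1]_p G p = \int[nu k]_t A G t)%E.
  by move=> mG G0; apply: tonelli_ins => //; rewrite -ltnS ltn_ord.
have mA G : @measurable_fun _ _ (T k.+1) (\bar R) setT G -> (forall p, 0 <= G p)%E ->
    measurable_fun setT (A G).
  move=> mG G0; pose K' (p : T k * R) := G (insT i (p.2, p.1)).
  have mK' : measurable_fun setT K'.
    apply: (measurableT_comp mG).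
    apply: (@measurableT_comp _ _ _ _ _ _ (@insT R k i)); first exact: measurable_insT.
    by apply: measurable_fun_pair; [exact: measurable_snd|exact: measurable_fst].
  exact: (@measurable_fun_fubini_tonelli_F _ _ _ _ _ mu K' mK' (fun p => G0 _)).
have iA G : @measurable_fun _ _ (T k.+1) (\bar R) setT G -> (forall p, 0 <= G p)%E ->
    (\int[nu k.+1]_p G p < +oo)%E -> (nu k).-integrable setT (A G).
  move=> mG G0 Gy; apply/integrableP; split; first exact: mA.
  rewrite (eq_integral (A G)) -?tonA// => t _.
  by rewrite gee0_abs// /A; apply: integral_ge0.
have AE t : (A H^\+ t - A H^\- t = ((EFin \o e) \_ (@orthant R k)) t)%E.
  rewrite /A (_ : (\int[mu]_x H^\+ (insT i (x, t)) - \int[mu]_x H^\- (insT i (x, t)))%E =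
    (\int[mu]_x H (insT i (x, t)))%E); last first.
    by rewrite [RHS]integralE; congr (_ - _)%E; apply: eq_integral => x _; rewrite ?funeposE ?funenegE.
  rewrite [RHS]patchE; case: ifPn => [/set_mem ot|/negP no].
    rewrite -[RHS]/((e t)%:E) -(fe t ot) [RHS]integral_mkcond; apply: eq_integral => x _.
    rewrite /H !patchE; case: ifPn => [/set_mem/orthant_insT[x0 _]|/negP nox].
      by rewrite mem_set//= in_itv /= x0.
    case: ifPn => // /set_mem /=; rewrite in_itv /= andbT => x0; case: nox.
    by apply/mem_set/orthant_insT.
  rewrite integral0_eq// => x _; rewrite /H patchE; case: ifPn => // /set_mem/orthant_insT[_ ot].
  by case: no; apply/mem_set.
rewrite /Rintegral; congr fine.
rewrite integral_mkcond [RHS]integral_mkcond -/H integralE.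
rewrite (tonA _ mHp)// (tonA _ mHn)//.
rewrite -integralB//; [|exact: iA|exact: iA].
by apply: eq_integral => t _; exact: AE.
Qed.

(** The integrand may change sign; [K * expR (- x)] is added to make it nonnegative and its known
    integral subtracted at the end. *)
Lemma FTC_halfline (u du : R -> R) (K : R) : (forall x, is_derive x (1 : R) u (du x)) ->
  continuous du -> (forall x, 0 <= x -> `|u x| <= K * expR (- x)) ->
  (forall x, 0 <= x -> `|du x| <= K * expR (- x)) ->
  (\int[mu]_(x in `[0%R, +oo[) (- du x)%:E = (u 0)%:E)%E.
Proof.
move=> dU cdu uK duK.
have K0 : 0 <= K by have := uK 0 (lexx _); rewrite oppr0 expR0 mulr1; apply: le_trans.
pose g x := K * expR (- x).
have cg : continuous g.
  move=> x; apply: cvgM; first exact: cvg_cst.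
  apply: (@continuous_comp _ _ _ (fun x => - x) expR); last exact: continuous_expR.
  exact: opp_continuous.
have g0 x : 0 <= g x by rewrite mulr_ge0 ?expR_ge0.
have gy : g x @[x --> +oo] --> (0 : R).
  by rewrite -(mulr0 K); apply: cvgM; [exact: cvg_cst|exact: cvgr_expR].
have uy : u x @[x --> +oo] --> (0 : R).
  apply/norm_cvg0P; apply: (@squeeze_cvgr _ _ _ _ (fun=> 0) g) => //; last exact: cvg_cst.
  near=> x; rewrite normr_ge0 /= uK//; near: x; exact: nbhs_pinfty_ge.
have cu : continuous u by move=> x; apply: differentiable_continuous; apply/derivable1_diffP; have [] := dU x.
have h1 : (\int[mu]_(x in `[0%R, +oo[) (g x - du x)%:E = (K + u 0)%:E)%E.
  rewrite (@ge0_continuous_FTC2y _ _ (fun x => - g x - u x) 0 0).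
  - by rewrite /g oppr0 expR0 mulr1 sub0e -EFinN opprB opprK addrC.
  - by move=> x x0; rewrite subr_ge0 (le_trans (ler_norm _))// duK.
  - by apply: continuous_subspaceT => x; apply: cvgB; [exact: cg|exact: cdu].
  - by rewrite -(subr0 0) -[X in X - _]oppr0; apply: cvgB => //; apply: cvgN.
  - move=> x _; apply: derivableB; last by have [] := dU x.
    by apply: derivableN; apply: derivableM => //; apply: derivable1_comp.
  - by apply: cvg_at_right_filter; apply: cvgB; [apply: cvgN; exact: cg|exact: cu].
  - move=> x _; rewrite derive1E.
    have D : is_derive x (1 : R) (fun x => - g x) (g x).
      by apply: trigger_derive; rewrite /GRing.scale /= /g; ring.
    by have [_ ->] := is_deriveB D (dU x).
have h2 : (\int[mu]_(x in `[0%R, +oo[) (g x)%:E = K%:E)%E by exact: int_expN.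
have mI : measurable (`[0%R, +oo[ : set (measurableTypeR R)) by exact: measurable_itv.
have ig : mu.-integrable `[0%R, +oo[ (EFin \o g).
  apply/integrableP; split.
    apply/measurable_EFinP; apply: (@measurable_funS _ _ _ _ setT) => //.
    exact: continuous_measurable_fun.
  suff -> : (\int[mu]_(x in `[0%R, +oo[) `|(EFin \o g) x| = K%:E)%E by rewrite ltry.
  by rewrite -h2; apply: eq_integral => x _; rewrite gee0_abs//= lee_fin.
have igd : mu.-integrable `[0%R, +oo[ (EFin \o fun x => g x - du x).
  apply/integrableP; split.
    apply/measurable_EFinP; apply: (@measurable_funS _ _ _ _ setT) => //.
    apply: continuous_measurable_fun.
    by move=> x; apply: cvgB; [exact: cg|exact: cdu].
  suff -> : (\int[mu]_(x in `[0%R, +oo[) `|(EFin \o fun x => (g x - du x)%R) x| = (K + u 0)%:E)%E.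
    by rewrite ltry.
  rewrite -h1; apply: eq_integral => x /set_mem /=; rewrite in_itv /= andbT => x0.
  by congr EFin; rewrite ger0_norm// subr_ge0 (le_trans (ler_norm _))// duK.
transitivity (\int[mu]_(x in `[0%R, +oo[)
    ((EFin \o fun x => (g x - du x)%R) x - (EFin \o g) x))%E.
  by apply: eq_integral => x _ /=; rewrite -EFinB addrAC subrr add0r.
by rewrite integralB// h1 h2 -EFinB addrAC subrr add0r.
Unshelve. all: by end_near. Qed.

End Gaussian.

(** * The Gaussian integral of a quadratic form and its boundary relation *)

Section GaussianIntegral.
#[local] Arguments crd : simpl never.
#[local] Arguments insT : simpl never.
Variable R : realType.
Local Notation C := R[i].
Local Notation Re := (@complex.Re R).
Local Notation Im := (@complex.Im R).
Local Notation mu := (@lebesgue_measure R).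
Local Notation T := (Rpow R).
Local Notation nu := (Rleb R).

Definition qf k (M : 'M[C]_k) (p : T k) : C :=
  \sum_i \sum_j M i j * (crd p i * crd p j)%:C.

Definition gexp k (M : 'M[C]_k) (p : T k) : C := cexp ((- 2^-1)%:C * qf M p).

Definition J k (M : 'M[C]_k) : C := oint (gexp M).

(** For symmetric [M] this is half the [i]-th partial derivative of [qf M], so
    [- lin M i p * gexp M p] is the [i]-th partial derivative of [gexp M]. *)
Definition lin k (M : 'M[C]_k) i (p : T k) : C := \sum_j M i j * (crd p j)%:C.

(** Strict copositivity of the real part, measured against [csum ^+ 2]: the quantitative condition
    for convergence over the orthant. *)
Definition adm_with k (c : R) (M : 'M[C]_k) := forall s : 'I_k -> R, (forall i, 0 <= s i) ->
  c * (\sum_i s i) ^+ 2 <= \sum_i \sum_j Re (M i j) * (s i * s j).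

Definition adm k (M : 'M[C]_k) := exists2 c : R, 0 < c & adm_with c M.

Lemma Re_qf k (M : 'M[C]_k) p : Re (qf M p) = \sum_i \sum_j Re (M i j) * (crd p i * crd p j).
Proof.
rewrite Re_sum; apply: eq_bigr => i _; rewrite Re_sum; apply: eq_bigr => j _.
by rewrite ReMR.
Qed.

Lemma Im_qf k (M : 'M[C]_k) p : Im (qf M p) = \sum_i \sum_j Im (M i j) * (crd p i * crd p j).
Proof.
rewrite Im_sum; apply: eq_bigr => i _; rewrite Im_sum; apply: eq_bigr => j _.
by rewrite ImMR.
Qed.

Lemma qf_ge k (M : 'M[C]_k) c p : adm_with c M -> orthant p -> c * csum p ^+ 2 <= Re (qf M p).
Proof. by move=> aM Dp; rewrite Re_qf; apply: (aM (fun i => crd p i)) => i; apply: Dp. Qed.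

Lemma measurable_quad k (a : 'I_k -> 'I_k -> R) :
  measurable_fun setT (fun p : T k => \sum_i \sum_j a i j * (crd p i * crd p j)).
Proof.
apply: (@measurable_sum _ _ _ _ _ _ (fun i (p : T k) => \sum_j a i j * (crd p i * crd p j))) => i.
apply: (@measurable_sum _ _ _ _ _ _ (fun j (p : T k) => a i j * (crd p i * crd p j))) => j.
apply: measurable_funM; first exact: measurable_cst.
by apply: measurable_funM; exact: measurable_crd.
Qed.

Lemma measurable_gexp k (M : 'M[C]_k) :
  measurable_fun setT (fun p => Re (gexp M p)) /\ measurable_fun setT (fun p => Im (gexp M p)).
Proof.
have h : measurable_fun setT (fun p => - 2^-1 * Re (qf M p)) /\ measurable_fun setT (fun p => - 2^-1 * Im (qf M p)).
  split; apply: measurable_funM; try exact: measurable_cst.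
    by under eq_fun do rewrite Re_qf; exact: measurable_quad.
  by under eq_fun do rewrite Im_qf; exact: measurable_quad.
have [hr hi] := h.
have E p : gexp M p = (expR (- 2^-1 * Re (qf M p)) * cos (- 2^-1 * Im (qf M p))) +i*
    (expR (- 2^-1 * Re (qf M p)) * sin (- 2^-1 * Im (qf M p))).
  by rewrite /gexp /cexp cReM cImM /= !mul0r subr0 addr0.
split; under eq_fun do rewrite E /=; apply: measurable_funM.
- exact: (measurableT_comp (@measurable_expR R) hr).
- apply: (measurableT_comp _ hi); apply: continuous_measurable_fun; exact: continuous_cos.
- exact: (measurableT_comp (@measurable_expR R) hr).
- apply: (measurableT_comp _ hi); apply: continuous_measurable_fun; exact: continuous_sin.
Qed.

Lemma cn_gexp k (M : 'M[C]_k) p : cn (gexp M p) = expR (- 2^-1 * Re (qf M p)).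
Proof. by rewrite cn_cexp cReM /= mul0r subr0. Qed.

(** [24] is [4!], from the exponential series at [1 + S]; [expR c^-1] comes from completing the
    square in [2 S - c S^2]. The fourth power is what the second order estimate of [J] requires. *)
Lemma gauss_tail (c : R) : 0 < c -> exists2 K : R, 0 < K &
  forall S, 0 <= S -> (1 + S) ^+ 4 * expR (- (c * S ^+ 2)) <= K * expR (- S).
Proof.
move=> c0; exists (24 * expR 1 * expR c^-1); first by rewrite !mulr_gt0 ?expR_gt0.
move=> S S0; have x0 : 0 <= 1 + S by rewrite addr_ge0.
have h : (1 + S) ^+ 4 <= 24 * expR (1 + S).
  have := @expR_ge1Dxn _ (1 + S) 3 x0; rewrite (_ : 4`!%:R = 24 :> R)//.
  by move: (expR _) ((1 + S) ^+ 4) => a b; lra.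
apply: (le_trans (ler_wpM2r (expR_ge0 _) h)).
rewrite -!mulrA -!expRD ler_wpM2l// ler_expR.
have : 2 * S - c * S ^+ 2 <= c^-1.
  rewrite -subr_ge0 (_ : _ - _ = c * (S - c^-1) ^+ 2); last by field; rewrite gt_eqF.
  by rewrite mulr_ge0// ?sqr_ge0// ltW.
by lra.
Qed.

Lemma gexp_dominated (c : R) : 0 < c -> exists2 K : R, 0 < K &
  forall k (M : 'M[C]_k) (a : T k -> C) A, adm_with c M -> 0 <= A ->
    measurable_fun setT (fun p => Re (a p)) -> measurable_fun setT (fun p => Im (a p)) ->
    (forall p, orthant p -> cn (a p) <= A * (1 + csum p) ^+ 4) ->
    cdominated (fun p => a p * gexp M p) (A * K).
Proof.
move=> c0; have [K K0 hK] := gauss_tail (divr_gt0 c0 (ltr0Sn _ 1) : 0 < c / 2%:R).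
exists K => // k M a A aM A0 m1 m2 aA.
have [g1 g2] := measurable_gexp M; have [n1 n2] := measurable_Mc m1 m2 g1 g2.
split => // p Dp; have S0 := csum_ge0 Dp.
rewrite cnM cn_gexp (@le_trans _ _ (A * (1 + csum p) ^+ 4 * expR (- (c / 2 * csum p ^+ 2))))//.
  rewrite ler_pM ?cn_ge0 ?expR_ge0 ?aA// ler_expR.
  by have := qf_ge aM Dp; move: (Re _) (csum p ^+ 2) => u v; lra.
by rewrite -2!(mulrA A) ler_wpM2l// hK.
Qed.

Lemma gexp_dominated1 k (M : 'M[C]_k) : adm M -> exists K, cdominated (gexp M) K.
Proof.
move=> [c c0 aM]; have [K K0 hK] := gexp_dominated c0; exists (1 * K).
have := hK k M (fun=> 1) 1 aM ler01 (measurable_cst _) (measurable_cst _).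
rewrite (_ : (fun p => 1 * gexp M p) = gexp M); last by apply/funext => p; rewrite mul1r.
apply=> p Dp; rewrite cn1 mul1r exprn_ege1// lerDl; exact: csum_ge0.
Qed.

Lemma is_derive_cexp_quad (al be ga : C) (x : R) :
  let z t := al + be * t%:C + ga * (t * t)%:C in
  is_derive x (1 : R) (fun t => Re (cexp (z t))) (Re ((be + 2%:R * ga * x%:C) * cexp (z x))) /\
  is_derive x (1 : R) (fun t => Im (cexp (z t))) (Im ((be + 2%:R * ga * x%:C) * cexp (z x))).
Proof.
case: al => a0 b0; case: be => a1 b1; case: ga => a2 b2 z.
have E t : cexp (z t) =
    (expR (a0 + a1 * t + a2 * (t * t)) * cos (b0 + b1 * t + b2 * (t * t))) +i*
    (expR (a0 + a1 * t + a2 * (t * t)) * sin (b0 + b1 * t + b2 * (t * t))).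
  by rewrite /cexp /z !ReD !ImD !ReMR !ImMR.
have F : (a1 +i* b1) + 2%:R * (a2 +i* b2) * x%:C = (a1 + 2 * a2 * x) +i* (b1 + 2 * b2 * x).
  rewrite (_ : 2%:R = (2 : R)%:C); last by rewrite rmorph_nat.
  by apply: C_eq; rewrite ?ReD ?ImD ?ReMR ?ImMR ?cReM ?cImM /=; ring.
rewrite F; split; under eq_fun do rewrite E /=; rewrite E ?cReM ?cImM /=;
  apply: trigger_derive; rewrite /GRing.scale /=; ring.
Qed.

Lemma continuous_cexp_quad (be be' al ga : C) :
  let z t := al + be * t%:C + ga * (t * t)%:C in
  continuous (fun t : R => Re ((be' + 2%:R * ga * t%:C) * cexp (z t))) /\
  continuous (fun t : R => Im ((be' + 2%:R * ga * t%:C) * cexp (z t))).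
Proof.
move=> z; have dz x := is_derive_cexp_quad al be ga x.
have c0 : continuous (fun t : R => Re (cexp (z t))) /\ continuous (fun t : R => Im (cexp (z t))).
  by split => x; apply: differentiable_continuous; apply/derivable1_diffP;
    have [[? _] [? _]] := dz x.
have [cR cI] := c0.
have cl (a b : R) : continuous (fun t : R => a + b * t).
  by move=> x; apply: cvgD; [exact: cvg_cst|apply: cvgM; [exact: cvg_cst|exact: cvg_id]].
split => x.
- rewrite (_ : (fun t => _) = (fun t : R => (Re be' + Re (2%:R * ga) * t) * Re (cexp (z t))
    - (Im be' + Im (2%:R * ga) * t) * Im (cexp (z t)))).
    by apply: cvgB; apply: cvgM; [exact: cl|exact: cR|exact: cl|exact: cI].
  by apply/funext => t; rewrite cReM ReD ImD ReMR ImMR.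
- rewrite (_ : (fun t => _) = (fun t : R => (Re be' + Re (2%:R * ga) * t) * Im (cexp (z t))
    + (Im be' + Im (2%:R * ga) * t) * Re (cexp (z t)))).
    by apply: cvgD; apply: cvgM; [exact: cl|exact: cI|exact: cl|exact: cR].
  by apply/funext => t; rewrite cImM ReD ImD ReMR ImMR.
Qed.

Lemma qf_insT k (M : 'M[C]_k.+1) (i : 'I_k.+1) x (t : T k) : M^T = M ->
  qf M (insT i (x, t)) = qf (row' i (col' i M)) t
    + (2%:R * \sum_j M i (lift i j) * (crd t j)%:C) * x%:C + M i i * (x * x)%:C.
Proof.
move=> sM; have sMij a b : M a b = M b a by rewrite -{1}sM mxE.
rewrite /qf (bigD1_ord i)// (bigD1_ord i)// !crd_insT_id.
have -> : \sum_(j < k) M i (lift i j) * (x * crd (insT i (x, t)) (lift i j))%:C =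
    (\sum_j M i (lift i j) * (crd t j)%:C) * x%:C.
  rewrite mulr_suml; apply: eq_bigr => j _.
  by rewrite crd_insT_lift mulrC rmorphM; ring.
have -> : \sum_(j < k) \sum_j0 M (lift i j) j0 *
     (crd (insT i (x, t)) (lift i j) * crd (insT i (x, t)) j0)%:C =
    (\sum_j M i (lift i j) * (crd t j)%:C) * x%:C + qf (row' i (col' i M)) t.
  rewrite mulr_suml -big_split; apply: eq_bigr => j _ /=.
  rewrite (bigD1_ord i)// crd_insT_id crd_insT_lift (sMij _ i); congr (_ + _).
    by rewrite rmorphM; ring.
  by apply: eq_bigr => l _; rewrite crd_insT_lift !mxE.
by rewrite -/(qf _ t) /=; ring.
Qed.

Lemma lin_insT k (M : 'M[C]_k.+1) (i : 'I_k.+1) x (t : T k) :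
  lin M i (insT i (x, t)) = \sum_j M i (lift i j) * (crd t j)%:C + M i i * x%:C.
Proof.
rewrite /lin (bigD1_ord i)// crd_insT_id addrC; congr (_ + _).
by apply: eq_bigr => j _; rewrite crd_insT_lift.
Qed.

Lemma measurable_lin k (M : 'M[C]_k) i :
  measurable_fun setT (fun p => Re (lin M i p)) /\ measurable_fun setT (fun p => Im (lin M i p)).
Proof.
split.
- under eq_fun do rewrite /lin Re_sum; under eq_fun do under eq_bigr do rewrite ReMR.
  apply: (@measurable_sum _ _ _ _ _ _ (fun j (p : T k) => Re (M i j) * crd p j)) => j.
  by apply: measurable_funM; [exact: measurable_cst|exact: measurable_crd].
- under eq_fun do rewrite /lin Im_sum; under eq_fun do under eq_bigr do rewrite ImMR.
  apply: (@measurable_sum _ _ _ _ _ _ (fun j (p : T k) => Im (M i j) * crd p j)) => j.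
  by apply: measurable_funM; [exact: measurable_cst|exact: measurable_crd].
Qed.

Lemma csum_le4 k (p : T k) : orthant p -> csum p <= (1 + csum p) ^+ 4.
Proof.
move=> Dp; have S0 := csum_ge0 Dp; rewrite (@le_trans _ _ (1 + csum p))// ?lerDr//.
by rewrite -[leLHS]expr1 ler_weXn2l// lerDl.
Qed.

Lemma lin_dominated k (M : 'M[C]_k) i : adm M -> exists K, cdominated (fun p => lin M i p * gexp M p) K.
Proof.
move=> [c c0 aM]; have [K K0 hK] := gexp_dominated c0.
have A0 : 0 <= \sum_j cn (M i j) by apply: sumr_ge0 => j _; exact: cn_ge0.
exists ((\sum_j cn (M i j)) * K); have [m1 m2] := measurable_lin M i.
apply: hK => // p Dp; rewrite (le_trans (cn_sum _ _ _))// mulr_suml ler_sum// => j _.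
rewrite cnM cnR ger0_norm; last exact: Dp.
by rewrite ler_wpM2l ?cn_ge0// (le_trans (crd_le_csum j Dp))// csum_le4.
Qed.

(** Integrating the [i]-th partial derivative of [gexp M] over the half-line in that coordinate
    leaves the boundary value at [0], the Gaussian of the matrix without row and column [i]. *)
Lemma J_minor k (M : 'M[C]_k.+1) (i : 'I_k.+1) : M^T = M -> adm M ->
  J (row' i (col' i M)) = oint (fun p => lin M i p * gexp M p).
Proof.
move=> sM aM; have [K dE] := gexp_dominated1 aM; have [L dL] := lin_dominated i aM.
pose b (t : T k) : C := \sum_j M i (lift i j) * (crd t j)%:C.
pose z (t : T k) (x : R) : C := ((- 2^-1)%:C * qf (row' i (col' i M)) t) + (- b t) * x%:C + ((- 2^-1)%:C * M i i) * (x * x)%:C.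
have gE (t : T k) x : gexp M (insT i (x, t)) = cexp (z t x).
  rewrite /gexp qf_insT// /z -/(b t); congr cexp.
  have -> : (- 2^-1)%:C = - (2%:R)^-1 :> C by rewrite rmorphN fmorphV rmorph_nat.
  by field.
have lE (t : T k) x : - (lin M i (insT i (x, t)) * gexp M (insT i (x, t))) =
    (- b t + 2%:R * ((- 2^-1)%:C * M i i) * x%:C) * cexp (z t x).
  rewrite lin_insT gE -/(b t) -mulNr; congr (_ * _).
  have -> : (- 2^-1)%:C = - (2%:R)^-1 :> C by rewrite rmorphN fmorphV rmorph_nat.
  by field.
have bnd (t : T k) (f : T k.+1 -> C) K' : orthant t -> cdominated f K' ->
    forall x, 0 <= x -> cn (f (insT i (x, t))) <= (K' * expR (- csum t)) * expR (- x).
  move=> ot [_ _ fK] x x0; rewrite (le_trans (fK _ _))//; first exact/orthant_insT.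
  by rewrite csum_insT opprD expRD -mulrA (mulrC (expR (- x))).
have z0 t : cexp (z t 0) = gexp (row' i (col' i M)) t.
  by rewrite /z !mulr0 !addr0.
apply: C_eq; apply/esym.
- apply: (@oint_partial _ k i _ _ L (cdominated_Re dL)) => t ot; rewrite -z0.
  pose du x := Re ((- b t + 2%:R * ((- 2^-1)%:C * M i i) * x%:C) * cexp (z t x)).
  have D x : is_derive x (1 : R) (fun x => Re (cexp (z t x))) (du x).
    by have [] := is_derive_cexp_quad ((- 2^-1)%:C * qf (row' i (col' i M)) t) (- b t)
      ((- 2^-1)%:C * M i i) x.
  have cD : continuous du.
    by have [] := continuous_cexp_quad (- b t) (- b t)
      ((- 2^-1)%:C * qf (row' i (col' i M)) t) ((- 2^-1)%:C * M i i).
  have h := @FTC_halfline _ _ _ (Num.max (K * expR (- csum t)) (L * expR (- csum t))) D cD.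
  rewrite -h.
  + by apply: eq_integral => x _; rewrite /du -lE ReN opprK.
  + move=> x x0; rewrite -gE (le_trans (Re_le_cn _))// (le_trans (bnd t _ _ ot dE x x0))//.
    by rewrite ler_wpM2r ?expR_ge0// le_max lexx.
  + move=> x x0; rewrite /du -lE (le_trans (Re_le_cn _))// cnN.
    rewrite (le_trans (bnd t _ _ ot dL x x0))//.
    by rewrite ler_wpM2r ?expR_ge0// le_max lexx orbT.
- apply: (@oint_partial _ k i _ _ L (cdominated_Im dL)) => t ot; rewrite -z0.
  pose du x := Im ((- b t + 2%:R * ((- 2^-1)%:C * M i i) * x%:C) * cexp (z t x)).
  have D x : is_derive x (1 : R) (fun x => Im (cexp (z t x))) (du x).
    by have [] := is_derive_cexp_quad ((- 2^-1)%:C * qf (row' i (col' i M)) t) (- b t)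
      ((- 2^-1)%:C * M i i) x.
  have cD : continuous du.
    by have [] := continuous_cexp_quad (- b t) (- b t)
      ((- 2^-1)%:C * qf (row' i (col' i M)) t) ((- 2^-1)%:C * M i i).
  have h := @FTC_halfline _ _ _ (Num.max (K * expR (- csum t)) (L * expR (- csum t))) D cD.
  rewrite -h.
  + by apply: eq_integral => x _; rewrite /du -lE ImN opprK.
  + move=> x x0; rewrite -gE (le_trans (Im_le_cn _))// (le_trans (bnd t _ _ ot dE x x0))//.
    by rewrite ler_wpM2r ?expR_ge0// le_max lexx.
  + move=> x x0; rewrite /du -lE (le_trans (Im_le_cn _))// cnN.
    rewrite (le_trans (bnd t _ _ ot dL x x0))//.
    by rewrite ler_wpM2r ?expR_ge0// le_max lexx orbT.
Qed.

(** By [J_minor] the sum is the integral of [\sum_i lam i * lin M i] against the Gaussian, and this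
    linear form is zero as [lam] annihilates [M]. *)
Theorem J_cocycle k (M : 'M[C]_k.+1) (lam : 'I_k.+1 -> C) : M^T = M -> adm M ->
  (forall j, \sum_i lam i * M i j = 0) -> \sum_i lam i * J (row' i (col' i M)) = 0.
Proof.
move=> sM aM lM.
have /choice[K dK] i := lin_dominated i aM.
have dl i : cdominated (fun p => lam i * (lin M i p * gexp M p)) (cn (lam i) * K i).
  exact: cdominatedZ.
transitivity (\sum_i oint (fun p => lam i * (lin M i p * gexp M p))).
  by apply: eq_bigr => i _; rewrite J_minor// (ointZ _ (dK i)).
have [_ <-] := oint_sum (index_enum 'I_k.+1) dl.
rewrite (_ : (fun p => _) = (fun=> 0)).
  by rewrite /oint; apply: C_eq => /=; rewrite Rintegral_cst ?mul0r//; exact: (@measurable_orthant R k.+1).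
apply/funext => p; under eq_bigr do rewrite mulrA; rewrite -mulr_suml /lin.
under eq_bigr do rewrite mulr_sumr; rewrite exchange_big big1 ?mul0r// => j _ /=.
by under eq_bigr do rewrite mulrA; rewrite -mulr_suml lM mul0r.
Qed.

End GaussianIntegral.

(** * The Gaussian cochain: cocycle relation and holomorphy *)

Section GaussianCochain.
#[local] Arguments crd : simpl never.
#[local] Arguments insT : simpl never.
Variable R : realType.
Local Notation C := R[i].
Local Notation Re := (@complex.Re R).
Local Notation Im := (@complex.Im R).
Local Notation T := (Rpow R).

Definition mx1 k m (A : 'M[C]_(k, m)) : R := \sum_i \sum_j cn (A i j).

Lemma mx1_ge0 k m (A : 'M[C]_(k, m)) : 0 <= mx1 A.
Proof. by apply: sumr_ge0 => i _; apply: sumr_ge0 => j _; exact: cn_ge0. Qed.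

Lemma entry_le_mx1 k m (A : 'M[C]_(k, m)) i j : cn (A i j) <= mx1 A.
Proof.
rewrite /mx1 (bigD1 i)//= (bigD1 j)//= -addrA lerDl addr_ge0//.
  by apply: sumr_ge0 => l _; exact: cn_ge0.
by apply: sumr_ge0 => l _; apply: sumr_ge0 => ? _; exact: cn_ge0.
Qed.

Lemma mx1Z k m (A : 'M[C]_(k, m)) z : mx1 (z *: A) = cn z * mx1 A.
Proof.
rewrite /mx1 mulr_sumr; apply: eq_bigr => i _; rewrite mulr_sumr.
by apply: eq_bigr => j _; rewrite mxE cnM.
Qed.

Lemma mx1D k m (A B : 'M[C]_(k, m)) : mx1 (A + B) <= mx1 A + mx1 B.
Proof.
rewrite /mx1 -big_split ler_sum// => i _; rewrite -big_split ler_sum// => j _.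
by rewrite mxE cnD.
Qed.

Lemma mx1N k m (A : 'M[C]_(k, m)) : mx1 (- A) = mx1 A.
Proof. by apply: eq_bigr => i _; apply: eq_bigr => j _; rewrite mxE cnN. Qed.

Lemma mx1B k m (A B : 'M[C]_(k, m)) : mx1 (A - B) = mx1 (B - A).
Proof. by rewrite -mx1N opprB. Qed.

Lemma mx1_tri k m (B A D : 'M[C]_(k, m)) : mx1 (A - D) <= mx1 (A - B) + mx1 (B - D).
Proof. by rewrite (le_trans _ (mx1D _ _))// addrA subrK. Qed.

Lemma mnormE n (A : 'M[C]_n) : mnorm A = (mx1 A)%:C.
Proof.
rewrite /mnorm /mx1 rmorph_sum; apply: eq_bigr => i _; rewrite rmorph_sum.
by apply: eq_bigr => j _; rewrite cnE.
Qed.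

Lemma adm_perturb k (M H : 'M[C]_k) c : adm_with c M -> adm_with (c - mx1 H) (M + H).
Proof.
move=> aM s s0; rewrite mulrBl.
have -> : \sum_i \sum_j Re ((M + H) i j) * (s i * s j) =
    \sum_i \sum_j Re (M i j) * (s i * s j) + \sum_i \sum_j Re (H i j) * (s i * s j).
  rewrite -big_split; apply: eq_bigr => i _; rewrite -big_split; apply: eq_bigr => j _ /=.
  by rewrite mxE ReD mulrDl.
rewrite lerD ?aM// lerNl -sumrN; apply: le_trans (_ : mx1 H * (\sum_i s i) ^+ 2 <= _) => //.
rewrite /mx1 mulr_suml ler_sum// => i _; rewrite -sumrN mulr_suml ler_sum// => j _.
rewrite -mulNr (@le_trans _ _ (cn (H i j) * (s i * s j)))//.
  rewrite ler_wpM2r ?mulr_ge0// (le_trans _ (Re_le_cn _))// -normrN; exact: ler_norm.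
have si l : s l <= \sum_i s i by rewrite (bigD1 l)//= lerDl sumr_ge0.
by rewrite ler_wpM2l ?cn_ge0// expr2 ler_pM.
Qed.

Lemma qf_bound k (H : 'M[C]_k) (p : T k) : orthant p -> cn (qf H p) <= mx1 H * csum p ^+ 2.
Proof.
move=> Dp; rewrite (le_trans (cn_sum _ _ _))// /mx1 mulr_suml ler_sum// => i _.
rewrite (le_trans (cn_sum _ _ _))// mulr_suml ler_sum// => j _.
have si := Dp i (ltn_ord i); have sj := Dp j (ltn_ord j).
rewrite cnM cnR ger0_norm ?mulr_ge0// ler_wpM2l ?cn_ge0// expr2 ler_pM//; exact: crd_le_csum.
Qed.

Lemma qfD k (M H : 'M[C]_k) (p : T k) : qf (M + H) p = qf M p + qf H p.
Proof.
rewrite /qf -big_split; apply: eq_bigr => i _; rewrite -big_split; apply: eq_bigr => j _ /=.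
by rewrite mxE mulrDl.
Qed.

Lemma qfZ k z (H : 'M[C]_k) (p : T k) : qf (z *: H) p = z * qf H p.
Proof.
rewrite /qf mulr_sumr; apply: eq_bigr => i _; rewrite mulr_sumr; apply: eq_bigr => j _ /=.
by rewrite mxE mulrA.
Qed.

Lemma measurable_qf k (M : 'M[C]_k) :
  measurable_fun setT (fun p => Re (qf M p)) /\ measurable_fun setT (fun p => Im (qf M p)).
Proof.
by split; [under eq_fun do rewrite Re_qf|under eq_fun do rewrite Im_qf]; exact: measurable_quad.
Qed.

(** Differentiation under the integral sign. The second order remainder of [cexp] is bounded by the
    square of the quadratic form, hence by a fourth power of [csum], against a Gaussian that keeps
    half of its decay. *)
Lemma J_cdiff0 k (M H : 'M[C]_k) : adm M -> cdiff (fun w => J (M + w *: H)) 0.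
Proof.
move=> [c c0 aM]; have c40 : 0 < c / 2 by rewrite divr_gt0.
have [K K0 hK] := gexp_dominated c0.
have [K' K'0 hK'] := gauss_tail (divr_gt0 c40 (ltr0Sn _ 1) : 0 < c / 2 / 2%:R).
pose q p : C := (- 2^-1)%:C * qf H p.
have cnh : cn ((- 2^-1)%:C : C) = 2^-1 by rewrite cnR normrN ger0_norm// invr_ge0.
have qb p : orthant p -> cn (q p) <= mx1 H * csum p ^+ 2.
  move=> Dp; rewrite cnM cnh (le_trans _ (qf_bound H Dp))// ler_piMl ?cn_ge0//.
  by rewrite invf_le1// ler1n.
have S4 (p : T k) : orthant p -> csum p ^+ 2 <= (1 + csum p) ^+ 4 /\ csum p ^+ 4 <= (1 + csum p) ^+ 4.
  move=> Dp; have S0 := csum_ge0 Dp; have S1 : csum p <= 1 + csum p by rewrite lerDr.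
  split; last by rewrite lerXn2r ?nnegrE ?addr_ge0.
  rewrite (@le_trans _ _ ((1 + csum p) ^+ 2))//; first by rewrite lerXn2r ?nnegrE ?addr_ge0.
  by rewrite ler_weXn2l// lerDl.
have [mq1 mq2] : measurable_fun setT (fun p => Re (q p)) /\ measurable_fun setT (fun p => Im (q p)).
  have [m1 m2] := measurable_qf H.
  exact: (@measurable_Mc _ _ (fun=> (- 2^-1)%:C) _ (measurable_cst _) (measurable_cst _) m1 m2).
have H0 := mx1_ge0 H.
have dq : cdominated (fun p => q p * gexp M p) (mx1 H * K).
  apply: (hK _ _ _ _ aM H0 mq1 mq2) => p Dp; rewrite (le_trans (qb p Dp))//.
  by rewrite ler_wpM2l//; have [] := S4 p Dp.
apply: (@cdiffP _ _ _ (oint (fun p => q p * gexp M p))) => e e0.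
(* [8] is the [4] of [cexp_taylor1] times the [2] of [oint_bound]. The other bound in [d] keeps
   [cn h * mx1 H] below [c / 4], half of the decay rate. *)
pose B := 8 * mx1 H ^+ 2 * K' + 1.
have B0 : 0 < B by rewrite ltr_wpDl// !mulr_ge0 ?sqr_ge0// ltW.
pose d := Num.min (e / B) (c / (4 * (mx1 H + 1))).
have H10 : 0 < mx1 H + 1 by rewrite ltr_wpDl.
exists d; first by rewrite lt_min !divr_gt0// mulr_gt0.
move=> h; rewrite subr0 lt_min => /andP[h1 h2].
have hH : cn h * mx1 H <= c / 4.
  move: h2; rewrite ltr_pdivlMr ?mulr_gt0// => h2.
  by have := cn_ge0 h; move: h2 H0; move: (cn h) (mx1 H) => u v; clear; nra.
have aMh : adm_with (c / 2) (M + h *: H).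
  move=> s s0; apply: le_trans (adm_perturb (h *: H) aM s0).
  by rewrite ler_wpM2r ?sqr_ge0// mx1Z; move: hH; move: (cn h * mx1 H) => u; lra.
have aM4 : adm_with (c / 2) M.
  move=> s s0; apply: le_trans (aM s s0); rewrite ler_wpM2r ?sqr_ge0//; lra.
rewrite scale0r addr0 {1}/J {1}/J.
have dM : exists K1, cdominated (gexp M) K1 by apply: gexp_dominated1; exists c.
have dMh : exists K1, cdominated (gexp (M + h *: H)) K1 by apply: gexp_dominated1; exists (c / 2).
have [K1 dK1] := dM; have [K2 dK2] := dMh.
rewrite (ointB dK2 dK1) mulrC (ointZ h dq).
have dB : cdominated (fun p => gexp (M + h *: H) p - gexp M p) (K2 + cn (-1) * K1).
  have := cdominatedD dK2 (cdominatedZ (-1) dK1).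
  by rewrite (_ : (fun p => _) = (fun p => gexp (M + h *: H) p - gexp M p))//;
    apply/funext => p; rewrite mulN1r.
rewrite (ointB dB (cdominatedZ h dq)).
have aE p : gexp (M + h *: H) p - gexp M p - h * (q p * gexp M p) =
    (cexp (h * q p) - 1 - h * q p) * gexp M p.
  rewrite {1}/gexp qfD qfZ mulrDr cexpD mulrCA -/(q p) -/(gexp M p); ring.
have bnd p : orthant p -> cn ((cexp (h * q p) - 1 - h * q p) * gexp M p) <=
    (4 * cn h ^+ 2 * mx1 H ^+ 2 * K') * expR (- csum p).
  move=> Dp; have S0 := csum_ge0 Dp; have hq : cn (h * q p) <= c / 4 * csum p ^+ 2.
    rewrite cnM (le_trans (ler_wpM2l (cn_ge0 _) (qb p Dp)))// mulrA ler_wpM2r ?sqr_ge0//.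
  rewrite cnM cn_gexp (le_trans (ler_wpM2r (expR_ge0 _) (cexp_taylor1 _)))//.
  have g1 : expR (cn (h * q p)) * expR (- 2^-1 * Re (qf M p)) <= expR (- (c / 2 / 2 * csum p ^+ 2)).
    rewrite -expRD ler_expR; have := qf_ge aM Dp; move: hq.
    by move: (cn _) (Re _) (csum p ^+ 2) => x y z; lra.
  rewrite -[leLHS]mulrA (le_trans (ler_wpM2l _ g1))//; first by rewrite mulr_ge0 ?sqr_ge0.
  have g2 : cn (h * q p) ^+ 2 <= cn h ^+ 2 * mx1 H ^+ 2 * (1 + csum p) ^+ 4.
    rewrite cnM exprMn -mulrA ler_wpM2l ?sqr_ge0//.
    rewrite (@le_trans _ _ ((mx1 H * csum p ^+ 2) ^+ 2))//.
      by rewrite lerXn2r ?nnegrE ?cn_ge0 ?mulr_ge0 ?sqr_ge0// qb.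
    by rewrite exprMn -exprM ler_wpM2l ?sqr_ge0//; have [] := S4 p Dp.
  rewrite (@le_trans _ _ (4 * (cn h ^+ 2 * mx1 H ^+ 2 * (1 + csum p) ^+ 4) *
      expR (- (c / 2 / 2 * csum p ^+ 2))))//.
    by rewrite ler_wpM2r ?expR_ge0// ler_wpM2l.
  have -> : 4 * (cn h ^+ 2 * mx1 H ^+ 2 * (1 + csum p) ^+ 4) * expR (- (c / 2 / 2 * csum p ^+ 2)) =
      (4 * cn h ^+ 2 * mx1 H ^+ 2) * ((1 + csum p) ^+ 4 * expR (- (c / 2 / 2 * csum p ^+ 2))) by ring.
  rewrite -[leRHS]mulrA; apply: ler_wpM2l; last exact: hK'.
  by apply: mulr_ge0; [apply: mulr_ge0 => //|]; exact: sqr_ge0.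
have cdom : cdominated (fun p => gexp (M + h *: H) p - gexp M p - h * (q p * gexp M p))
    (4 * cn h ^+ 2 * mx1 H ^+ 2 * K').
  have [m1 m2 _] := cdominatedD dB (cdominatedZ (- h) dq).
  split; last by move=> p Dp; rewrite aE bnd.
    by under eq_fun do rewrite -mulNr; exact: m1.
  by under eq_fun do rewrite -mulNr; exact: m2.
rewrite (le_trans (oint_bound cdom))//.
rewrite (_ : 2 * _ = (8 * mx1 H ^+ 2 * K') * cn h * cn h); last by ring.
rewrite ler_wpM2r ?cn_ge0//.
move: h1; rewrite ltr_pdivlMr// => h1; apply: le_trans (ltW h1).
by rewrite mulrC ler_wpM2l ?cn_ge0// lerDl.
Qed.

Lemma J_cdiff k (M H : 'M[C]_k) z : adm (M + z *: H) -> cdiff (fun w => J (M + w *: H)) z.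
Proof.
move=> aM; have d0 := J_cdiff0 H aM.
have : cdiff (fun w => (fun v => J ((M + z *: H) + v *: H)) (w - z)) z.
  apply: (@cdiff_comp _ (fun w => w - z) (fun v => J ((M + z *: H) + v *: H))).
    by apply: cdiffB; [exact: cdiff_id|exact: cdiff_cst].
  by rewrite subrr.
apply: (@cdiff_near _ _ _ _ 1); first exact: ltr01.
move=> w _ /=; congr J.
rewrite -addrA -scalerDl; congr (_ + _ *: _).
by rewrite addrC subrK.
Qed.

Lemma J_real k (M : 'M[C]_k) : (forall i j, Im (M i j) = 0) -> Im (J M) = 0.
Proof.
move=> rM; rewrite /J /=; rewrite (@eq_Rintegral _ _ _ _ _ (fun=> 0)); last first.
  move=> p _; rewrite /gexp /cexp cImM Im_qf big1 ?mulr0 ?mul0r ?addr0 ?sin0 ?mulr0// => i _.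
  by rewrite big1// => j _; rewrite rM mul0r.
by rewrite Rintegral_cst ?mul0r//; exact: measurable_orthant.
Qed.

Definition gcoch k (w u : 'M[C]_k) : C := \det u * J (u *m w *m u^T).

(** Cramer's relation among [k.+1] vectors of a [k]-dimensional space: expand a determinant in which
    column [j] occurs twice. *)
Lemma lin_rel_minors k (U : 'M[C]_(k.+1, k)) (j : 'I_k) :
  \sum_(i < k.+1) (-1) ^+ i * \det (row' i U) * U i j = 0.
Proof.
pose A : 'M[C]_k.+1 := \matrix_(i, l) if unlift ord0 l is Some l' then U i l' else U i j.
have A0 i : A i ord0 = U i j by rewrite mxE unlift_none.
have Al i l : A i (lift ord0 l) = U i l by rewrite mxE liftK.
have : \det A = 0.
  rewrite -det_tr; apply: (@determinant_alternate _ _ _ ord0 (lift ord0 j)) => // i.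
  by rewrite mxE [RHS]mxE A0 Al.
rewrite (expand_det_col A ord0); apply: etrans; apply: eq_bigr => i _.
rewrite A0 mulrC /cofactor addn0; congr (_ * (_ * \det _)).
by apply/matrixP => a b; rewrite [LHS]mxE [RHS]mxE [RHS]mxE Al.
Qed.

(** The signed maximal minors of [U] annihilate [U *m w *m U^T], and deleting row [i] of [U] deletes
    row and column [i] of that matrix; so this is [J_cocycle] with [lam] these minors. *)
Theorem gcoch_cocycle k (w : 'M[C]_k) (U : 'M[C]_(k.+1, k)) : w^T = w -> adm (U *m w *m U^T) ->
  \sum_(i < k.+1) (-1) ^+ i * gcoch w (row' i U) = 0.
Proof.
move=> sw aU; pose M := U *m w *m U^T.
have sM : M^T = M by rewrite /M !trmx_mul trmxK sw mulmxA.
have lM l : \sum_(i < k.+1) ((-1) ^+ i * \det (row' i U)) * M i l = 0.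
  rewrite /M -mulmxA; under eq_bigr do rewrite mxE mulr_sumr.
  rewrite exchange_big big1// => j _ /=; under eq_bigr do rewrite mulrA.
  by rewrite -mulr_suml lin_rel_minors mul0r.
rewrite -[RHS](J_cocycle sM aU lM); apply: eq_bigr => i _; rewrite /gcoch -mulrA.
congr (_ * (_ * J _)); apply/matrixP => a b; rewrite !mxE; apply: eq_bigr => l _.
by rewrite !mxE; congr (_ * _); apply: eq_bigr => m _; rewrite !mxE.
Qed.

Lemma gcoch_cdiff k (w0 w1 u : 'M[C]_k) z : adm (u *m (w0 + z *: w1) *m u^T) ->
  cdiff (fun z => gcoch (w0 + z *: w1) u) z.
Proof.
have E v : u *m (w0 + v *: w1) *m u^T = u *m w0 *m u^T + v *: (u *m w1 *m u^T).
  by rewrite mulmxDr mulmxDl -scalemxAr -scalemxAl.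
rewrite E => aM; apply: cdiffM; first exact: cdiff_cst.
have := J_cdiff aM; apply: (@cdiff_near _ _ _ _ 1); first exact: ltr01.
by move=> v _ /=; rewrite E.
Qed.

Lemma det_cdiff k (w0 w1 : 'M[C]_k) z : cdiff (fun z => \det (w0 + z *: w1)) z.
Proof.
apply: cdiff_sum => s; apply: cdiffM; first exact: cdiff_cst.
apply: cdiff_prod => i; have : cdiff (fun z => w0 i (perm.fun_of_perm s i) + z * w1 i (perm.fun_of_perm s i)) z.
  apply: cdiffD; first exact: cdiff_cst.
  by apply: cdiffM; [exact: cdiff_id|exact: cdiff_cst].
by apply: (@cdiff_near _ _ _ _ 1) => // v _; rewrite !mxE.
Qed.

End GaussianCochain.

(** * Volume of a simplex *)

Section LinearChange.
Variable R : realType.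
Local Notation mu := (@lebesgue_measure R).
Local Notation T := (Rpow R).
Local Notation nu := (Rleb R).

(** Uniqueness of Lebesgue measure on half-open intervals; for [a < 0] the preimage is half-open at
    the other end, with the same length. *)
Lemma lebesgue_affine (a c : R) (A : set (measurableTypeR R)) : a != 0 -> measurable A ->
  mu A = (`|a|%:E * mu [set x : R | A (a * x + c)%R])%E.
Proof.
move=> a0 mA.
have mphi : measurable_fun setT (fun x : measurableTypeR R => (a * x + c : measurableTypeR R)%R).
  by apply: measurable_funD; [exact: measurable_funM|exact: measurable_cst].
pose m := mscale (NngNum (normr_ge0 a)) (pushforward mu (fun x : measurableTypeR R => (a * x + c : measurableTypeR R)%R)).
have mE : [the {measure set _ -> \bar R} of m mphi] A = (`|a|%:E * mu [set x : R | A (a * x + c)%R])%E.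
  by [].
rewrite -mE; apply: lebesgue_measure_unique => // X [[x y] _ <-] /=.
rewrite /m /mscale /= /pushforward.
have [xy|yx] := ltP x y; last first.
  rewrite set_itv_ge ?bnd_simp -?leNgt// preimage_set0 !measure0 mule0//.
have [a_gt0|a_lt0] := ltP 0 a.
  rewrite (_ : _ @^-1` _ = `](x - c) / a, (y - c) / a]%classic); last first.
    apply/seteqP; split => t /=; rewrite !in_itv /= ltr_pdivrMr// ler_pdivlMr// ltrBlDr lerBrDr mulrC//.
  rewrite !lebesgue_measure_itv /= !lte_fin xy ltr_pM2r ?invr_gt0// ltrD2r xy gtr0_norm//.
  by rewrite -!EFinD -EFinM; congr EFin; field.
have {}a_lt0 : a < 0 by rewrite lt_neqAle a0.
rewrite (_ : _ @^-1` _ = `[(y - c) / a, (x - c) / a[%classic); last first.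
  apply/seteqP; split => t /=; rewrite !in_itv /= ltr_ndivlMr// ler_ndivrMr// ltrBlDr lerBrDr mulrC andbC//.
rewrite !lebesgue_measure_itv /= !lte_fin xy ltr_nM2r ?invr_lt0// ltrD2r xy ltr0_norm//.
by rewrite -!EFinD -EFinM; congr EFin; field.
Qed.

Lemma integral_affine (a c : R) (f : measurableTypeR R -> \bar R) : a != 0 ->
  measurable_fun setT f -> (forall x, 0 <= f x)%E ->
  (`|a|%:E * \int[mu]_x f (a * x + c)%R = \int[mu]_x f x)%E.
Proof.
move=> a0 mf f0.
have mphi : measurable_fun setT (fun x : measurableTypeR R => (a * x + c : measurableTypeR R)%R).
  by apply: measurable_funD; [exact: measurable_funM|exact: measurable_cst].
pose m := mscale (NngNum (normr_ge0 a)) (pushforward mu (fun x : measurableTypeR R => (a * x + c : measurableTypeR R)%R)).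
transitivity (\int[[the {measure set _ -> \bar R} of m mphi]]_x f x)%E; last first.
  by apply: eq_measure_integral => A mA _; apply/esym; exact: lebesgue_affine.
rewrite ge0_integral_mscale//=.
by rewrite ge0_integral_pushforward.
Qed.

End LinearChange.

(** * Linear change of variables in several dimensions *)

Section LinearChangeN.
Variable R : realType.
Local Notation mu := (@lebesgue_measure R).
Local Notation T := (Rpow R).
Local Notation nu := (Rleb R).

Definition rv k (p : T k) : 'rV[R]_k := \row_i crd p i.

Fixpoint mkT k (s : nat -> R) : T k :=
  match k return T k with 0 => tt | k'.+1 => (s 0%N, mkT k' (fun i => s i.+1)) end.

Definition pt k (v : 'rV[R]_k) : T k :=
  mkT k (fun i => if insub i is Some o then v 0 o else 0).

Lemma crd_mkT k s i : (i < k)%N -> crd (mkT k s) i = s i.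
Proof. by elim: k s i => [|k IH] s [|i] //= ik; rewrite IH. Qed.

Lemma Rpow_ext k (p q : T k) : (forall i, (i < k)%N -> crd p i = crd q i) -> p = q.
Proof.
elim: k p q => [[] []//|k IH] [x p] [y q] h.
congr pair; first exact: (h 0%N).
by apply: IH => i ik; exact: (h i.+1).
Qed.

Lemma crd_pt k (v : 'rV[R]_k) (i : 'I_k) : crd (pt v) i = v 0 i.
Proof. by rewrite crd_mkT// valK. Qed.

Lemma rvK k (v : 'rV[R]_k) : rv (pt v) = v.
Proof. by apply/rowP => i; rewrite mxE crd_pt. Qed.

Lemma ptK k (p : T k) : pt (rv p) = p.
Proof. by apply: Rpow_ext => i ik; rewrite (crd_pt _ (Ordinal ik)) mxE. Qed.

Lemma rvS k (p : T k.+1) : rv p = row_mx (p.1%:M : 'rV_1) (rv p.2) :> 'rV_(1 + k).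
Proof.
apply/rowP => i; rewrite !mxE; case: splitP => j ij; rewrite !mxE ij.
  by rewrite !ord1 /= mulr1n.
by [].
Qed.

Lemma ptS k (x : R) (v : 'rV[R]_k) : pt (row_mx x%:M v : 'rV_(1 + k)) = (x, pt v) :> T k.+1.
Proof.
apply: Rpow_ext => i ik; rewrite (crd_pt _ (Ordinal ik)); case: i ik => [|i] ik.
  transitivity ((row_mx x%:M v : 'rV_(1 + k)) 0 (lshift k (ord0 : 'I_1))).
    by congr fun_of_matrix; exact: val_inj.
  by rewrite row_mxEl mxE mulr1n.
transitivity ((row_mx x%:M v : 'rV_(1 + k)) 0 (rshift 1 (Ordinal (ik : (i < k)%N)))).
  by congr fun_of_matrix; exact: val_inj.
by rewrite row_mxEr -crd_pt.
Qed.

Lemma measurable_to_Rpow d (X : measurableType d) k (g : X -> T k) :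
  (forall i : 'I_k, measurable_fun setT (fun x => crd (g x) i)) -> measurable_fun setT g.
Proof.
elim: k g => [|k IH] g mg.
  rewrite (_ : g = fun=> tt); first exact: measurable_cst.
  by apply/funext => x; case: (g x).
rewrite (_ : g = fun x => ((g x).1, (g x).2)); last by apply/funext => x; case: (g x).
apply: measurable_fun_pair; first exact: (mg ord0).
by apply: IH => i; exact: (mg (lift ord0 i)).
Qed.

Definition lmap k (A : 'M[R]_k) (p : T k) : T k := pt (rv p *m A).

Lemma measurable_lmap k (A : 'M[R]_k) : measurable_fun setT (lmap A).
Proof.
apply: measurable_to_Rpow => i; under eq_fun do rewrite crd_pt mxE.
apply: (@measurable_sum _ _ _ _ _ _ (fun j (p : T k) => rv p 0 j * A j i)) => j.
apply: measurable_funM; last exact: measurable_cst.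
by under eq_fun do rewrite mxE; exact: measurable_crd.
Qed.

Lemma lmapM k (A B : 'M[R]_k) p : lmap (A *m B) p = lmap B (lmap A p).
Proof. by rewrite /lmap rvK mulmxA. Qed.

Definition lcv k (A : 'M[R]_k) := forall f : T k -> \bar R,
  @measurable_fun _ _ (T k) (\bar R) setT f -> (forall p, 0 <= f p)%E ->
  (`|\det A|%:E * \int[nu k]_p f (lmap A p) = \int[nu k]_p f p)%E.

Lemma lcvM k (A B : 'M[R]_k) : lcv A -> lcv B -> lcv (A *m B).
Proof.
move=> hA hB f mf f0.
have mB : @measurable_fun _ _ (T k) (\bar R) setT (fun p => f (lmap B p)).
  exact: (measurableT_comp mf (measurable_lmap B)).
have /= E := hA _ mB (fun p => f0 _).
rewrite -(hB f mf f0) -E det_mulmx normrM EFinM muleA (muleC `|\det A|%:E).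
by under eq_integral do rewrite lmapM.
Qed.

Lemma tonelli1 k (f : T k.+1 -> \bar R) :
  @measurable_fun _ _ (T k.+1) (\bar R) setT f -> (forall p, 0 <= f p)%E ->
  (\int[nu k.+1]_p f p = \int[mu]_x \int[nu k]_y f (x, y))%E.
Proof. by move=> mf f0; rewrite [LHS](@fubini_tonelli1 _ _ _ _ _ mu (nu k)). Qed.

Lemma tonelli2 k (f : T k.+1 -> \bar R) :
  @measurable_fun _ _ (T k.+1) (\bar R) setT f -> (forall p, 0 <= f p)%E ->
  (\int[nu k.+1]_p f p = \int[nu k]_y \int[mu]_x f (x, y))%E.
Proof. by move=> mf f0; rewrite [LHS](@fubini_tonelli2 _ _ _ _ _ mu (nu k)). Qed.

Lemma measurable_sec1 k (f : T k.+1 -> \bar R) x :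
  @measurable_fun _ _ (T k.+1) (\bar R) setT f -> measurable_fun setT (fun y : T k => f (x, y)).
Proof.
move=> mf; apply: (measurableT_comp mf).
by apply: measurable_fun_pair => //; exact: measurable_cst.
Qed.

Lemma measurable_sec2 k (f : T k.+1 -> \bar R) (y : T k) :
  @measurable_fun _ _ (T k.+1) (\bar R) setT f -> measurable_fun setT (fun x : measurableTypeR R => f (x, y)).
Proof.
move=> mf; apply: (measurableT_comp mf).
by apply: measurable_fun_pair => //; exact: measurable_cst.
Qed.

Lemma integral_translate k (v : 'rV[R]_k) (f : T k -> \bar R) :
  @measurable_fun _ _ (T k) (\bar R) setT f -> (forall p, 0 <= f p)%E ->
  (\int[nu k]_p f (pt (rv p + v)) = \int[nu k]_p f p)%E.
Proof.
elim: k v f => [|k IH] v f mf f0.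
  by apply: eq_integral => -[] _; congr f; case: (pt _).
have mt : measurable_fun setT (fun p : T k.+1 => pt (rv p + v)).
  apply: measurable_to_Rpow => i; under eq_fun do rewrite crd_pt !mxE.
  by apply: measurable_funD; [exact: measurable_crd|exact: measurable_cst].
rewrite !tonelli1//; last exact: (measurableT_comp mf mt).
transitivity (\int[mu]_x \int[nu k]_y f ((x + v 0 ord0)%R, y))%E.
  apply: eq_integral => x _; rewrite -(IH (rv (pt v).2) (fun y => f ((x + v 0 ord0)%R, y)))//; last first.
    exact: measurable_sec1.
  apply: eq_integral => y _; congr f.
  apply: Rpow_ext => i ik; rewrite (crd_pt _ (Ordinal ik)) 2!mxE.
  case: i ik => [|i] ik; first by congr (_ + v 0 _); exact: val_inj.
  rewrite -[RHS]/(crd (pt (rv y + rv (pt v).2)) (Ordinal (ik : (i < k)%N))) crd_pt !mxE.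
  by congr (_ + _); rewrite -[LHS]crd_pt.
have := @integral_affine R 1 (v 0 ord0) (fun x => \int[nu k]_y f (x, y))%E (oner_neq0 _).
rewrite normr1 mul1e => h; rewrite -h.
- by apply: eq_integral => x _; rewrite mul1r.
- exact: (@measurable_fun_fubini_tonelli_F _ _ _ _ _ (nu k) f mf f0).
- by move=> x; apply: integral_ge0.
Qed.

(** On each slice of fixed first coordinate the shear is a translation. *)
Lemma lcv_ushear k (r : 'rV[R]_k) : lcv (block_mx 1%:M r 0 1%:M : 'M[R]_(1 + k)).
Proof.
move=> f mf f0; rewrite det_ublock !det1 mulr1 normr1 mul1e.
rewrite !tonelli1//; last exact: (measurableT_comp mf (measurable_lmap _)).
apply: eq_integral => x _.
rewrite -[RHS](integral_translate (x *: r))//; last exact: measurable_sec1.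
apply: eq_integral => y _; congr f; rewrite /lmap rvS mul_row_block !mulmx1 mulmx0 addr0.
by rewrite mul_scalar_mx addrC ptS.
Qed.

Lemma lcv_lshear k (l : 'cV[R]_k) : lcv (block_mx 1%:M 0 l 1%:M : 'M[R]_(1 + k)).
Proof.
move=> f mf f0; rewrite det_lblock !det1 mulr1 normr1 mul1e.
rewrite !tonelli2//; last exact: (measurableT_comp mf (measurable_lmap _)).
apply: eq_integral => y _.
have := @integral_affine R 1 ((rv y *m l) 0 0) (fun x => f (x, y)) (oner_neq0 _).
rewrite normr1 mul1e => <-//; last exact: measurable_sec2.
apply: eq_integral => x _; congr f; rewrite /lmap rvS mul_row_block !mulmx1 mulmx0 add0r mul1r.
rewrite -[in RHS](ptK y) -(ptS (x + (rv (pt (rv y)) *m l) 0 0) (rv y)) ptK; congr (pt (row_mx _ _)).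
by apply/matrixP => i j; rewrite !ord1 !mxE mulr1n.
Qed.

Lemma lcv_diag k (a : R) (A : 'M[R]_k) : a != 0 -> lcv A -> lcv (block_mx a%:M 0 0 A : 'M[R]_(1 + k)).
Proof.
move=> a0 hA f mf f0; rewrite det_ublock det_scalar1 normrM EFinM.
rewrite !tonelli1//; last exact: (measurableT_comp mf (measurable_lmap _)).
have mF : measurable_fun setT (fun x => \int[nu k]_y f (x, y))%E.
  exact: (@measurable_fun_fubini_tonelli_F _ _ _ _ _ (nu k) f mf f0).
rewrite -(@integral_affine R a 0 (fun x => \int[nu k]_y f (x, y))%E a0)//; last first.
  by move=> x; apply: integral_ge0.
rewrite -muleA; congr (_ * _)%E.
rewrite -ge0_integralZl//; last first.
- by move=> x _; apply: integral_ge0.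
- have mL : @measurable_fun _ _ (T k.+1) (\bar R) setT (fun p => f (lmap (block_mx a%:M 0 0 A : 'M[R]_(1 + k)) p)).
    exact: (measurableT_comp mf (measurable_lmap _)).
  exact: (@measurable_fun_fubini_tonelli_F _ _ _ _ _ (nu k) _ mL (fun p => f0 _)).
apply: eq_integral => x _; rewrite -(hA (fun y => f ((a * x + 0)%R, y)))//; last exact: measurable_sec1.
congr (_ * _)%E; apply: eq_integral => y _; congr f.
rewrite /lmap rvS mul_row_block !mulmx0 addr0 add0r addr0.
by rewrite -scalar_mxM mulrC ptS.
Qed.

(** Gaussian elimination by blocks: a matrix with nonzero corner is lower shear times block diagonal
    times upper shear, and the diagonal block, a Schur complement, is handled by induction. *)
Theorem linear_change k (A : 'M[R]_k) : A \in unitmx -> lcv A.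
Proof.
elim: k A => [|k IH] A uA.
  move=> f mf f0; rewrite det_mx00 normr1 mul1e; apply: eq_integral => -[] _.
  by congr f; case: (lmap _ _).
have pivot (B : 'M[R]_(1 + k)) : B \in unitmx -> ulsubmx B 0 0 != 0 -> lcv B.
  move=> uB b0; pose a := ulsubmx B 0 0.
  pose S := drsubmx B - a^-1 *: (dlsubmx B *m ursubmx B).
  have BE : B = (block_mx 1%:M 0 (a^-1 *: dlsubmx B) 1%:M *m block_mx a%:M 0 0 S)
      *m block_mx 1%:M (a^-1 *: ursubmx B) 0 1%:M.
    rewrite !mulmx_block !mul1mx !mulmx1 !mulmx0 !mul0mx !addr0 !add0r.
    rewrite mul_scalar_mx scalerA divff// scale1r mul_mx_scalar scalerA divff// scale1r.
    rewrite -scalemxAr /S addrC subrK -[in LHS](submxK B); congr block_mx.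
    exact: mx11_scalar.
  have : \det B != 0 by move: uB; rewrite unitmxE unitfE.
  rewrite BE !det_mulmx det_lblock !det1 !det_ublock det_scalar1 !det1 !mulr1 mul1r.
  rewrite mulf_eq0 negb_or => /andP[_ dS].
  apply: lcvM; last exact: lcv_ushear.
  apply: lcvM; first exact: lcv_lshear.
  by apply: lcv_diag => //; apply: IH; rewrite unitmxE unitfE.
change ('M[R]_(1 + k)) in A.
have [a0|] := eqVneq (ulsubmx A 0 0) 0; last exact: pivot.
have [i ci] : exists i, dlsubmx A i 0 != 0.
  apply/not_existsP => c0; move: uA; rewrite unitmxE unitfE => /eqP; apply.
  have -> : A = block_mx (0 : 'M[R]_1) (ursubmx A) 0 (drsubmx A).
    rewrite -[LHS]submxK; congr block_mx; apply/matrixP => i j; rewrite !ord1 [RHS]mxE //.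
    by apply/eqP/negPn/negP => h; apply: (c0 i).
  apply: etrans (det_ublock (0 : 'M[R]_1) (ursubmx A) (drsubmx A)) _.
  by rewrite det_mx11 mxE mul0r.
(* If the corner is zero, the shear [U 1] adds a row with nonzero first entry to the first row. *)
pose U (s : R) : 'M[R]_(1 + k) := block_mx 1%:M (s *: delta_mx 0 i) 0 1%:M.
have uU s : U s \in unitmx by rewrite unitmxE det_ublock !det1 mulr1 unitr1.
have AE : A = U (-1) *m (U 1 *m A).
  rewrite mulmxA /U mulmx_block !mul1mx !mulmx1 !mulmx0 !mul0mx !addr0 !add0r.
  by rewrite -scalerDl subrr scale0r -scalar_mx_block mul1mx.
rewrite AE; apply: lcvM; first exact: lcv_ushear.
apply: pivot; first by rewrite unitmx_mul uU uA.
rewrite /U -{1}(submxK A) mulmx_block block_mxKul mul1mx scale1r mxE a0 add0r.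
by rewrite -rowE mxE.
Qed.

End LinearChangeN.

(** * Layer cake formula *)

Section Volume.
Variable R : realType.
Local Notation C := R[i].
Local Notation Re := (@complex.Re R).
Local Notation Im := (@complex.Im R).
Local Notation mu := (@lebesgue_measure R).
Local Notation T := (Rpow R).
Local Notation nu := (Rleb R).

(** The product measure is by definition the integral of the measures of the sections, which matches
    the recursion of [leb_n] one coordinate at a time. *)
Lemma leb_nE k (A : set (nat -> R)) : measurable [set p : T k | A (crd p)] ->
  leb_n k A = nu k [set p : T k | A (crd p)].
Proof.
elim: k A => [|k IH] A mA /=.
  rewrite diracE; case: asboolP => h; [rewrite mem_set//|rewrite memNset//].
rewrite -[RHS]/(\int[mu]_x nu k (xsection [set p : T k.+1 | A (crd p)] x))%E.
apply: eq_integral => x _.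
have E : xsection [set p : T k.+1 | A (crd p)] x = [set y : T k | A (Defs.ncons x (crd y))].
  by apply/seteqP; split => y /=; rewrite /xsection /= inE.
by rewrite E IH// -E; exact: measurable_xsection.
Qed.

Definition rq k (M : 'M[R]_k) (p : T k) : R := \sum_i \sum_j M i j * (crd p i * crd p j).

Definition sublevel k (M : 'M[R]_k) (r : R) : set (T k) := [set p | orthant p /\ rq M p <= r].

Lemma measurable_rq k (M : 'M[R]_k) : measurable_fun setT (rq M).
Proof. exact: measurable_quad. Qed.

Lemma measurable_sublevel k (M : 'M[R]_k) r : measurable (sublevel M r).
Proof.
rewrite (_ : sublevel M r = @orthant R k `&` (rq M @^-1` `]-oo, r]%classic)).
  apply: measurableI; first exact: measurable_orthant.
  by rewrite -[X in measurable X]setTI; apply: measurable_rq => //; exact: measurable_itv.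
by apply/seteqP; split => p; rewrite /sublevel /setI /preimage /= in_itv.
Qed.

Lemma rq_rv k (M : 'M[R]_k) p : rq M p = (rv p *m M *m (rv p)^T) 0 0.
Proof.
rewrite mxE /rq exchange_big; apply: eq_bigr => j _ /=; rewrite !mxE mulr_suml.
by apply: eq_bigr => i _; rewrite !mxE; ring.
Qed.

Lemma integral_set k (A : set (T k)) : measurable A ->
  (\int[nu k]_p (\1_A p)%:E = nu k A)%E.
Proof. by move=> mA; rewrite integral_indic// setIT. Qed.

Lemma measurable_indicE k (A : set (T k)) : measurable A ->
  @measurable_fun _ _ (T k) (\bar R) setT (fun p => (\1_A p)%:E).
Proof. by move=> mA; apply/measurable_EFinP; exact: measurable_indic. Qed.

Lemma measure_lmap k (A : 'M[R]_k) (X : set (T k)) : A \in unitmx -> measurable X ->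
  nu k X = (`|\det A|%:E * nu k [set p | X (lmap A p)])%E.
Proof.
move=> uA mX; have mX' : measurable [set p | X (lmap A p)].
  by rewrite -[X in measurable X]setTI; exact: measurable_lmap.
rewrite -!integral_set// -(linear_change uA (measurable_indicE mX))//. 
Qed.

Lemma int_exp_tail (a : R) : (\int[mu]_(x in `[a, +oo[) (expR (- x))%:E = (expR (- a))%:E)%E.
Proof.
rewrite (@ge0_continuous_FTC2y _ _ (fun x => - expR (- x)) a 0).
- by rewrite sub0e -EFinN opprK.
- by move=> x _; rewrite expR_ge0.
- apply: continuous_subspaceT => x.
  apply: (@continuous_comp _ _ _ (fun x => - x) expR); last exact: continuous_expR.
  exact: opp_continuous.
- by rewrite -[X in _ --> X]oppr0; apply: cvgN; exact: cvgr_expR.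
- by move=> x _; apply: ex_derive.
- apply: cvg_at_right_filter; apply: cvgN.
  apply: (@continuous_comp _ _ _ (fun x => - x) expR); last exact: continuous_expR.
  exact: opp_continuous.
- move=> x _; rewrite derive1E.
  have D : is_derive x (1 : R) (fun x => - expR (- x)) (expR (- x)).
    by apply: trigger_derive; rewrite /GRing.scale /=; ring.
  by have [_ ->] := D.
Qed.

(** [expR (- x)] weighs the level [x], and [Num.sqrt (2 * x) ^+ k] is the factor by which the volume
    of [q <= 2 x] exceeds that of [q <= 1]. *)
Definition layer_const k : \bar R :=
  (\int[mu]_(x in `]0%R, +oo[) (expR (- x) * Num.sqrt (2 * x) ^+ k)%:E)%E.

Lemma layer_const_gt0 k : (0 < layer_const k)%E.
Proof.
have mE : measurable_fun setT (fun x : measurableTypeR R => expR (- x) * Num.sqrt (2 * x) ^+ k).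
  apply: continuous_measurable_fun => x; apply: cvgM.
    apply: (@continuous_comp _ _ _ (fun x => - x) expR); last exact: continuous_expR.
    exact: opp_continuous.
  apply: (@continuous_comp R R R (fun x : R => Num.sqrt (2 * x)) (fun y : R => y ^+ k)); last exact: exprn_continuous.
  apply: (@continuous_comp R R R (fun x : R => 2 * x) Num.sqrt); last exact: sqrt_continuous.
  by apply: cvgM; [exact: cvg_cst|exact: cvg_id].
apply: (@lt_le_trans _ _ (expR (- 1))%:E); first by rewrite lte_fin expR_gt0.
rewrite -int_exp_tail /layer_const.
apply: (@le_trans _ _ (\int[mu]_(x in `[1%R, +oo[) (expR (- x) * Num.sqrt (2 * x) ^+ k)%:E)%E).
  apply: ge0_le_integral => //.
  - apply/measurable_EFinP; apply: (@measurable_funS _ _ _ _ setT) => //.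
    apply: (measurableT_comp (@measurable_expR R)); exact: oppr_measurable.
  - by apply/measurable_EFinP; apply: (@measurable_funS _ _ _ _ setT).
  - move=> x /=; rewrite in_itv /= andbT => x1; rewrite lee_fin ler_peMr ?expR_ge0//.
    rewrite exprn_ege1// -[leLHS]sqrtr1 ler_wsqrtr//; move: x1; clear; lra.
apply: ge0_subset_integral => //.
- by apply/measurable_EFinP; apply: (@measurable_funS _ _ _ _ setT).
- by move=> x /=; rewrite !in_itv /= !andbT; apply: lt_le_trans.
Qed.

(** Write [exp (- q / 2)] as the integral of [expR (- x)] over [x >= q / 2], exchange the integrals,
    and use that [q] is homogeneous of degree two. *)
Lemma layer_cake k (M : 'M[R]_k) : (forall p, orthant p -> 0 <= rq M p) ->
  (\int[nu k]_(p in @orthant R k) (expR (- (rq M p / 2)))%:E =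
   layer_const k * nu k (sublevel M 1))%E.
Proof.
(* Only positive levels are kept, so that the scaling by [Num.sqrt (2 * x)] is invertible; where
   [q = 0] the half-line of levels is then open at [0], which changes no integral. *)
move=> q0; pose X : set (T k.+1) := [set p | [/\ 0 < p.1, orthant p.2 & rq M p.2 <= 2 * p.1]].
pose F (p : T k.+1) : \bar R := ((expR (- p.1))%:E * (\1_X p)%:E)%E.
have mfst : measurable_fun setT (fun p : T k.+1 => p.1) by exact: measurable_fst.
have msnd : measurable_fun setT (fun p : T k.+1 => p.2) by exact: measurable_snd.
have mX : measurable X.
  pose h (p : T k.+1) := rq M p.2 - 2 * p.1.
  have mh : measurable_fun setT h.
    apply: measurable_funB; first exact: (measurableT_comp (measurable_rq M) msnd).
    by apply: measurable_funM => //; exact: measurable_cst.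
  rewrite (_ : X = ((fun p : T k.+1 => p.1) @^-1` `]0, +oo[%classic) `&`
     ((fun p : T k.+1 => p.2) @^-1` @orthant R k) `&` (h @^-1` `]-oo, 0]%classic)).
    apply: measurableI; first apply: measurableI.
    - by rewrite -[X in measurable X]setTI; apply: mfst => //; exact: measurable_itv.
    - by rewrite -[X in measurable X]setTI; apply: msnd => //; exact: measurable_orthant.
    - by rewrite -[X in measurable X]setTI; apply: mh => //; exact: measurable_itv.
  apply/seteqP; split => p; rewrite /X /setI /preimage /= !in_itv /= andbT /h subr_le0.
    by move=> [? ? ?].
  by move=> [[? ?] ?].
have mF : @measurable_fun _ _ (T k.+1) (\bar R) setT F.
  rewrite (_ : F = EFin \o (fun p => expR (- p.1) * \1_X p)) //.
  apply/measurable_EFinP; apply: measurable_funM.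
    by apply: (measurableT_comp (@measurable_expR R)); exact: measurable_funN.
  exact: measurable_indic.
have F0 p : (0 <= F p)%E by rewrite /F mule_ge0// lee_fin ?expR_ge0.
transitivity (\int[nu k]_y \int[mu]_x F (x, y))%E.
  rewrite integral_mkcond; apply: eq_integral => y _; rewrite patchE; case: ifPn => [/set_mem oy|/negP no]; last first.
    rewrite integral0_eq// => x _; rewrite /F indicE memNset ?mule0//=.
    by move=> [_ oy _]; apply: no; apply/mem_set.
  rewrite -int_exp_tail.
  have [q_gt0|] := ltP 0 (rq M y).
    rewrite [LHS]integral_mkcond; apply: eq_integral => x _; rewrite patchE /F indicE /=.
    have -> : ((x, y) \in X) = (x \in `[(rq M y / 2)%R, +oo[%classic).
      apply/idP/idP => /set_mem; [move=> [/= x0 _ qx]|rewrite /= in_itv /= andbT => qx]; apply/mem_set.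
        by rewrite /= in_itv /= andbT; lra.
      by split => //=; lra.
    by case: ifP => _; rewrite ?mule1 ?mule0.
  move=> q_le0; have -> : rq M y = 0 by apply/le_anti; rewrite q_le0 q0.
  rewrite mul0r -integral_itv_obnd_cbnd; last first.
    apply/measurable_EFinP; apply: (@measurable_funS _ _ _ _ setT) => //.
    by apply: (measurableT_comp (@measurable_expR R)); exact: oppr_measurable.
  rewrite [LHS]integral_mkcond; apply: eq_integral => x _; rewrite patchE /F indicE /=.
  have -> : ((x, y) \in X) = (x \in `]0%R, +oo[%classic).
    apply/idP/idP => /set_mem; [move=> [/= x0 _ qx]|rewrite /= in_itv /= andbT => qx]; apply/mem_set.
      by rewrite /= in_itv /= andbT.
    by split => //=; lra.
  by case: ifP => _; rewrite ?mule1 ?mule0.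
rewrite -tonelli2// tonelli1// /layer_const.
rewrite -ge0_integralZr//; last first.
- apply/measurable_EFinP; apply: (@measurable_funS _ _ _ _ setT) => //.
  apply: continuous_measurable_fun => x; apply: cvgM.
    apply: (@continuous_comp _ _ _ (fun x => - x) expR); last exact: continuous_expR.
    exact: opp_continuous.
  apply: (@continuous_comp R R R (fun x : R => Num.sqrt (2 * x)) (fun y : R => y ^+ k)); last exact: exprn_continuous.
  apply: (@continuous_comp R R R (fun x : R => 2 * x) Num.sqrt); last exact: sqrt_continuous.
  by apply: cvgM; [exact: cvg_cst|exact: cvg_id].
rewrite [RHS]integral_mkcond; apply: eq_integral => x _; rewrite patchE; case: ifPn => [/set_mem|/negP nx]; last first.
  rewrite integral0_eq// => y _; rewrite /F indicE memNset ?mule0//=.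
  by move=> [/= x0 _ _]; apply: nx; apply/mem_set; rewrite /= in_itv /= x0.
rewrite /= in_itv /= andbT => x0; rewrite /F /=.
transitivity (\int[nu k]_y ((expR (- x))%:E * (\1_(sublevel M (2 * x)) y)%:E))%E.
  apply: eq_integral => y _; rewrite !indicE.
  rewrite (_ : ((x, y) \in X) = (y \in sublevel M (2 * x)))//.
  by apply/idP/idP => /set_mem h; apply/mem_set; [case: h => _ /= ? ?; split|case: h; split].
rewrite ge0_integralZl//; last exact: (measurable_indicE (measurable_sublevel M (2 * x))).
rewrite integral_set; last exact: measurable_sublevel.
rewrite EFinM -muleA; congr (_ * _)%E.
pose r := Num.sqrt (2 * x); have r0 : 0 < r by rewrite sqrtr_gt0 mulr_gt0.
have r2 : r ^+ 2 = 2 * x by rewrite sqr_sqrtr// mulr_ge0// ltW.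
have uA : (r%:M : 'M[R]_k) \in unitmx by rewrite unitmxE det_scalar unitfE expf_neq0// gt_eqF.
rewrite (measure_lmap uA (measurable_sublevel _ _)) det_scalar ger0_norm ?exprn_ge0 ?(ltW r0)//.
congr (_ * nu k _)%E; apply/seteqP.
have cE (p : T k) (i : 'I_k) : crd (lmap r%:M p) i = r * crd p i.
  by rewrite /lmap crd_pt mul_mx_scalar !mxE.
have oE (p : T k) : orthant (lmap r%:M p) <-> orthant p.
  by split => h i ik; have := h i ik; rewrite (cE p (Ordinal ik)) pmulr_rge0.
have qE (p : T k) : rq M (lmap r%:M p) = 2 * x * rq M p.
  rewrite /rq -r2 mulr_sumr; apply: eq_bigr => i _; rewrite mulr_sumr.
  by apply: eq_bigr => j _; rewrite !cE; ring.
split => p [].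
  move=> /oE op; rewrite qE -[leRHS]mulr1 ler_pM2l ?mulr_gt0// => qp.
move=> op qp; split; first exact/oE.
by rewrite qE -[leRHS]mulr1 ler_pM2l// mulr_gt0.
Qed.

End Volume.

Section SimplexVolume.
Variable R : realType.
Local Notation C := R[i].
Local Notation Re := (@complex.Re R).
Local Notation Im := (@complex.Im R).
Local Notation T := (Rpow R).
Local Notation nu := (Rleb R).

Lemma unit_cone_lmap g n (v : 'M[R]_n.+1) (p : T n.+1) : v \in unitmx ->
  unit_cone g v (crd (lmap v p)) <-> sublevel (gram g v) 1 p.
Proof.
move=> uv; have gE : (rv p *m v) *m model_form R g n *m (rv p *m v)^T =
    rv p *m gram g v *m (rv p)^T by rewrite /gram trmx_mul !mulmxA.
split => [[t [t0 xt qt]]|[op qp]].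
- have tE : t = rv p.
    have : t *m v = rv p *m v.
      apply/rowP => j; rewrite -xt /lmap crd_pt //.
    by move/(congr1 (fun u => u *m invmx v)); rewrite !mulmxK.
  split; last by rewrite rq_rv -gE -tE.
  by move=> i ik; have := t0 (Ordinal ik); rewrite tE mxE.
- exists (rv p); split.
  + by move=> i; rewrite mxE; apply: op.
  + by move=> j; rewrite /lmap crd_pt.
  + by rewrite gE -rq_rv.
Qed.

Lemma Re_J_real k (M : 'M[R]_k) : adm (cplx_mx M) ->
  (Re (J (cplx_mx M)))%:E = (\int[nu k]_(p in @orthant R k) (expR (- (rq M p / 2)))%:E)%E.
Proof.
move=> aM; have [K dK] := gexp_dominated1 aM.
have rE p : Re (gexp (cplx_mx M) p) = expR (- (rq M p / 2)).
  have q1 : Re (qf (cplx_mx M) p) = rq M p.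
    by rewrite Re_qf; apply: eq_bigr => i _; apply: eq_bigr => j _; rewrite mxE.
  have q2 : Im (qf (cplx_mx M) p) = 0.
    rewrite Im_qf big1// => i _; rewrite big1// => j _; by rewrite mxE /= mul0r.
  rewrite /gexp /cexp cReM cImM q1 q2 /= !mulr0 mul0r subr0 addr0 cos0 mulr1.
  by rewrite mulNr mulrC.
have fi := dominated_integrable (cdominated_Re dK).
rewrite /J /oint /= /Rintegral fineK; last exact: (integrable_fin_num (@measurable_orthant R k) fi).
by apply: eq_integral => p _; rewrite -rE.
Qed.

(** The unit cone is the image under [v] of the sublevel set of the Gram form in the orthant, which
    the layer cake formula measures by [J]. The constant [kappa] depends on [n] only, so one value
    serves at all Gram matrices. *)
Theorem simplex_volumeE n : exists kappa : R, forall g (v : 'M[R]_n.+1),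
  v \in unitmx -> adm (cplx_mx (gram g v)) ->
  simplex_volume g v = kappa * (`|\det v| * Re (J (cplx_mx (gram g v)))).
Proof.
pose c0 := layer_const R n.+1; exists (n.+1%:R * (fine c0)^-1) => g v uv aM.
set M := gram g v.
have q0 p : orthant p -> 0 <= rq M p.
  move=> op; have [c c_gt0 ac] := aM; have := qf_ge ac op.
  rewrite Re_qf (_ : \sum_i _ = rq M p); last first.
    by apply: eq_bigr => i _; apply: eq_bigr => j _; rewrite mxE.
  by apply: le_trans; rewrite mulr_ge0 ?sqr_ge0// ltW.
have lc := layer_cake q0; rewrite -Re_J_real// in lc.
pose K := [set p : T n.+1 | unit_cone g v (crd p)].
have KE : K = [set p | sublevel M 1 (lmap (invmx v) p)].
  have pE p : lmap v (lmap (invmx v) p) = p by rewrite -lmapM mulVmx// /lmap mulmx1 ptK.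
  apply/seteqP; split => p h.
    by apply/(unit_cone_lmap g (lmap (invmx v) p) uv); rewrite pE.
  by move/(unit_cone_lmap g (lmap (invmx v) p) uv): h; rewrite pE.
have mK : measurable K.
  rewrite KE -[X in measurable X]setTI; apply: measurable_lmap => //.
  exact: measurable_sublevel.
rewrite /simplex_volume leb_nE// (measure_lmap uv mK).
have -> : [set p | K (lmap v p)] = sublevel M 1.
  by apply/seteqP; split => p /(unit_cone_lmap g p uv).
set S := nu _ _ in lc *.
have c0_gt0 : (0 < c0)%E := layer_const_gt0 R n.+1.
have S0 : (0 <= S)%E by exact: measure_ge0.
(* An infinite layer constant would force [S = 0], since the left side of [lc] is finite; both sides
   are then zero because [fine +oo] is [0]. *)
have [c0y|c0fin] := eqVneq c0 +oo%E.
  have S_eq0 : S = 0%E.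
    apply/eqP/negPn/negP => Sn0; have : (0 < S)%E by rewrite lt_def Sn0.
    by move: lc; rewrite -/c0 c0y => lc Sp; move: lc; rewrite gt0_mulye.
  by rewrite S_eq0 !mule0 c0y /= invr0 mulr0 mul0r.
have c0f : c0 \is a fin_num by rewrite ge0_fin_numE ?ltey// ltW.
have fc0 : 0 < fine c0 by rewrite fine_gt0// c0_gt0 ltey.
have Sf : S \is a fin_num.
  rewrite ge0_fin_numE// ltey; apply/eqP => Sy; move: lc; rewrite -/c0 Sy gt0_muley//.
have -> : Re (J (cplx_mx M)) = fine c0 * fine S.
  by apply: EFin_inj; rewrite lc -/c0 EFinM !fineK.
by rewrite -(fineK Sf) -!EFinM /=; field; rewrite gt_eqF.
Qed.

End SimplexVolume.

(** * Barycentric subdivision of cochains *)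

Section Subdivision.
Variables (R : realType) (n : nat) (A : numDomainType).
Local Notation N := n.+1.
Implicit Types (s : 'S_N) (sg : 'M[R]_N) (g H : 'M[R]_N -> A).

(** Row [i] is the barycentre of the first [i.+1] vertices; composed with [row_perm s] it lists the
    vertices of the small simplex that belongs to the flag [s]. *)
Definition bary : 'M[R]_N := \matrix_(i, j) if (j <= i)%N then (i.+1%:R)^-1 else 0.

Definition flag s sg : 'M[R]_N := bary *m row_perm s sg.

(** Subdivision acts contravariantly on cochains: the value on a simplex is replaced by the signed
    sum of the values on its flags. *)
Definition Sd g sg : A := \sum_(s : 'S_N) (-1) ^+ s * g (flag s sg).

Lemma flagE s sg i c : flag s sg i c = (i.+1%:R)^-1 * \sum_(l < N | (l <= i)%N) sg (s l) c.
Proof.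
rewrite mxE mulr_sumr [RHS]big_mkcond; apply: eq_bigr => l _; rewrite !mxE.
by case: ifP => // _; rewrite mul0r.
Qed.

Definition nxt (i : 'I_N) : 'I_N := inord i.+1.

Lemma nxtE (i : 'I_N) : (i < n)%N -> nxt i = i.+1 :> nat.
Proof. by move=> ilt; rewrite inordK. Qed.

Lemma tperm_leq (i l r : 'I_N) : (i < n)%N -> r != i ->
  (tperm i (nxt i) l <= r)%N = (l <= r)%N.
Proof.
move=> ilt ri; have ni := nxtE ilt; have rin : (r : nat) != i by [].
by case: tpermP => [->|->|//]; rewrite ni; apply/idP/idP; move: rin; rewrite neq_ltn => /orP[]; lia.
Qed.

Lemma sum_tperm (T : Type) (idx : T) (op : Monoid.com_law idx) (F : 'I_N -> T)
    (i r : 'I_N) s : (i < n)%N -> r != i ->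
  \big[op/idx]_(l < N | (l <= r)%N) F ((tperm i (nxt i) * s)%g l) =
  \big[op/idx]_(l < N | (l <= r)%N) F (s l).
Proof.
move=> ilt ri; rewrite (reindex_inj (@perm_inj _ (tperm i (nxt i)))) /=.
apply: eq_big => [l|l _]; first by rewrite tperm_leq.
by rewrite permM tpermK.
Qed.

Lemma flag_tperm (i r : 'I_N) s sg c : (i < n)%N -> r != i ->
  flag (tperm i (nxt i) * s)%g sg r c = flag s sg r c.
Proof. by move=> ilt ri; rewrite !flagE (sum_tperm _ (fun l => sg l c)). Qed.

(** Reindexing by an adjacent transposition reverses the sign, so the sum is its own opposite.
    Geometrically, an interior facet is shared by two flags. *)
Lemma perm_swap0 (Phi : 'S_N -> A) (i : 'I_N) : (i < n)%N ->
  (forall s, Phi (tperm i (nxt i) * s)%g = Phi s) ->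
  \sum_(s : 'S_N) (-1) ^+ s * Phi s = 0.
Proof.
move=> ilt hP; set S := \sum_s _.
have ine : i != nxt i by rewrite -val_eqE /= nxtE// ltn_eqF.
have : S = - S.
  rewrite {1}/S (reindex_inj (mulgI (tperm i (nxt i)))) /= -sumrN.
  apply: eq_bigr => s _; rewrite hP odd_permM odd_tperm ine /=.
  by case: (odd_perm s) => /=; rewrite ?expr0 ?expr1 ?mulN1r ?mul1r ?opprK.
by move/eqP; rewrite -subr_eq0 opprK -mulr2n mulrn_eq0 /= => /eqP.
Qed.

(** A cochain on the facet opposite vertex [r] is encoded as a function of the whole simplex that
    ignores row [r]. *)
Definition indep_row (r : 'I_N) H :=
  forall sg sg', (forall i c, i != r -> sg i c = sg' i c) -> H sg = H sg'.

Lemma Sd_indep_row0 (i : 'I_N) H : (i < n)%N -> indep_row i H -> forall sg, Sd H sg = 0.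
Proof.
move=> ilt hH sg; apply: (perm_swap0 (i := i)) => // s.
by apply: hH => r c ri; exact: flag_tperm.
Qed.

Lemma Sd_sum (I : Type) (r : seq I) (P : pred I) (F : I -> 'M[R]_N -> A) sg :
  Sd (fun x => \sum_(i <- r | P i) F i x) sg = \sum_(i <- r | P i) Sd (F i) sg.
Proof.
rewrite /Sd [RHS]exchange_big; apply: eq_bigr => s _ /=.
by rewrite mulr_sumr.
Qed.

Lemma eq_Sd g H : g =1 H -> Sd g =1 Sd H.
Proof. by move=> gH sg; apply: eq_bigr => s _; rewrite gH. Qed.

Lemma eq_iter_Sd m g H : g =1 H -> iter m Sd g =1 iter m Sd H.
Proof. by move=> gH; elim: m => [|m IH] //=; apply: eq_Sd. Qed.

Lemma iter_Sd_sum m (I : Type) (r : seq I) (P : pred I) (F : I -> 'M[R]_N -> A) sg :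
  iter m Sd (fun x => \sum_(i <- r | P i) F i x) sg = \sum_(i <- r | P i) iter m Sd (F i) sg.
Proof.
elim: m sg => [|m IH] sg //; rewrite !iterS (eq_Sd IH) Sd_sum.
by apply: eq_bigr => i _.
Qed.

Lemma iter_SdZ m (a : A) g sg : iter m Sd (fun x => a * g x) sg = a * iter m Sd g sg.
Proof.
elim: m sg => [|m IH] sg //; rewrite !iterS (eq_Sd IH) /Sd mulr_sumr.
by apply: eq_bigr => s _; rewrite mulrCA.
Qed.

Lemma iter_SdD m g H sg : iter m Sd (fun x => g x + H x) sg = iter m Sd g sg + iter m Sd H sg.
Proof.
have := @iter_Sd_sum m _ [:: g; H] xpredT (fun f => f) sg; rewrite !big_cons big_nil addr0 => <-.
by apply: eq_iter_Sd => x; rewrite !big_cons big_nil addr0.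
Qed.

Lemma iter_SdB m g H sg : iter m Sd (fun x => g x - H x) sg = iter m Sd g sg - iter m Sd H sg.
Proof.
rewrite -mulN1r -iter_SdZ -iter_SdD; apply: eq_iter_Sd => x; by rewrite mulN1r.
Qed.

Lemma iter_Sd0 m sg : iter m Sd (fun=> 0) sg = 0 :> A.
Proof.
rewrite -[RHS](mul0r (iter m Sd (fun=> 0 : A) sg)) -iter_SdZ.
by apply: eq_iter_Sd => x; rewrite mul0r.
Qed.

Lemma iter_Sd_indep_row0 m (i : 'I_N) H sg : (0 < m)%N -> (i < n)%N -> indep_row i H ->
  iter m Sd H sg = 0.
Proof.
case: m => // m _ ilt hH; rewrite iterSr -[RHS](iter_Sd0 m sg).
by apply: eq_iter_Sd => x; exact: (Sd_indep_row0 ilt hH).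
Qed.

Definition face_vanishing H := forall sg j, (forall i : 'I_N, (i < n)%N -> sg i j = 0) -> H sg = 0.

(* The part of the boundary of the subdivided simplex lying in the interior cancels, and
   the rest lies in the faces. *)
Lemma iter_Sd_boundary0 m H : (0 < m)%N -> indep_row ord_max H -> face_vanishing H ->
  iter m Sd H 1%:M = 0.
Proof.
case: m => // m _; elim: m H => [|m IH] H hH fH.
  rewrite iterS /= /Sd big1// => s _; rewrite [H _](fH _ (s ord_max)) ?mulr0// => i ilt.
  rewrite flagE big1 ?mulr0// => l li; rewrite mxE (inj_eq perm_inj).
  by rewrite (_ : l == ord_max = false)//; apply/eqP => E; move: li; rewrite E /= leqNgt ilt.
(* Flags are grouped by their last vertex [k]; their outer facet lies in the face opposite [k]. If
   [k] is not the last index, the next subdivision cancels the group; the group of the last index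
   satisfies the induction hypothesis. *)
pose K k sg := \sum_(s : 'S_N | s ord_max == k) (-1) ^+ s * H (flag s sg).
have SdE sg : Sd H sg = \sum_k K k sg.
  by rewrite /Sd (partition_big (fun s : 'S_N => s ord_max) xpredT).
have Kind k : indep_row k (K k).
  move=> sg sg' E; apply: eq_bigr => s /eqP sk; congr (_ * _); apply: hH => i c ilt.
  rewrite !flagE; congr (_ * _); apply: eq_bigr => l li; apply: E.
  rewrite -sk (inj_eq perm_inj); apply/eqP => lE; move: li; rewrite lE /= => li.
  by case/eqP: ilt; apply/val_inj/anti_leq; rewrite li /= -ltnS ltn_ord.
rewrite iterSr (eq_iter_Sd _ SdE) iter_Sd_sum (bigD1 ord_max)//= big1; last first.
  move=> k kl; rewrite -iterS (@iter_Sd_indep_row0 _ k)//.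
  by move: kl; rewrite -val_eqE /= => kl; rewrite ltn_neqAle kl -ltnS ltn_ord.
rewrite addr0 -iterS; apply: IH; first exact: Kind.
move=> sg j sgj; rewrite /K big1// => s /eqP sm; rewrite [H _](fH _ j) ?mulr0// => i ilt.
rewrite flagE big1 ?mulr0// => l li; apply: sgj.
have : s l != ord_max.
  rewrite -sm (inj_eq perm_inj); apply/eqP => lE; move: li; rewrite lE /= leqNgt.
  by rewrite ilt.
by rewrite -val_eqE /= => h; rewrite ltn_neqAle h -ltnS ltn_ord.
Qed.

Definition in_simplex sg := (forall i j, 0 <= sg i j) /\ (forall i, \sum_j sg i j = 1).

Definition diam_le (d : R) sg := forall i i' j, `|sg i j - sg i' j| <= d.

Lemma bary_sum i : \sum_l bary i l = 1.
Proof.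
under eq_bigr do rewrite mxE; rewrite -big_mkcond /=.
rewrite -(big_ord_widen N (fun=> (i.+1%:R : R)^-1) (ltn_ord i)) sumr_const card_ord.
by rewrite -[LHS]mulr_natr mulVf// pnatr_eq0.
Qed.

Lemma bary_ge0 i l : 0 <= bary i l.
Proof. by rewrite mxE; case: ifP => // _; rewrite invr_ge0. Qed.

Lemma flag_in_simplex s sg : in_simplex sg -> in_simplex (flag s sg).
Proof.
move=> [s0 s1]; split.
  move=> i j; rewrite mxE sumr_ge0// => l _; rewrite mulr_ge0 ?bary_ge0//.
  by rewrite mxE.
move=> i; under eq_bigr do rewrite mxE; rewrite exchange_big /= -[RHS](bary_sum i).
apply: eq_bigr => l _; rewrite -mulr_sumr; under eq_bigr do rewrite mxE.
by rewrite s1 mulr1.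
Qed.

(** Two barycentres of a flag both give the first vertex weight at least [1 / N]. In the double
    convex sum that expresses their difference, the pair of first vertices contributes zero and has
    weight at least [1 / N^2]. *)
Definition mesh_ratio : R := 1 - (N%:R * N%:R)^-1.

Lemma mesh_ratio_bounds : 0 <= mesh_ratio < 1.
Proof.
rewrite subr_ge0 ltrBlDr ltrDl invr_gt0 mulr_gt0 ?ltr0n// andbT invf_le1 ?mulr_gt0 ?ltr0n//.
by rewrite -natrM ler1n muln_gt0.
Qed.

Lemma flag_diam s sg d : 0 <= d -> diam_le d sg -> diam_le (mesh_ratio * d) (flag s sg).
Proof.
move=> d0 hd i i' c; pose x l := sg (s l) c.
have fE r : flag s sg r c = \sum_l bary r l * x l.
  by rewrite mxE; apply: eq_bigr => l _; rewrite !mxE.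
have -> : flag s sg i c - flag s sg i' c = \sum_l \sum_m bary i l * bary i' m * (x l - x m).
  rewrite !fE; under [RHS]eq_bigr => l _.
    under eq_bigr => m _ do rewrite mulrBr.
    rewrite sumrB; over.
  rewrite sumrB; congr (_ - _).
    apply: eq_bigr => l _; under eq_bigr do rewrite -mulrA mulrCA.
    by rewrite -mulr_suml bary_sum mul1r.
  rewrite [RHS]exchange_big /=; apply: eq_bigr => m _.
  by under eq_bigr do rewrite -mulrA; rewrite -mulr_suml bary_sum mul1r.
pose w l m := bary i l * bary i' m.
have w0 l m : 0 <= w l m by rewrite mulr_ge0 ?bary_ge0.
have wsum : \sum_l \sum_m w l m = 1.
  rewrite /w; under eq_bigr do rewrite -mulr_sumr bary_sum mulr1; exact: bary_sum.
apply: (@le_trans _ _ (\sum_l \sum_m w l m * (if (l == ord0) && (m == ord0) then 0 else d))).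
  rewrite (le_trans (ler_norm_sum _ _ _))// ler_sum// => l _.
  rewrite (le_trans (ler_norm_sum _ _ _))// ler_sum// => m _.
  rewrite normrM ger0_norm; last exact: w0.
  rewrite ler_wpM2l ?w0//; case: ifP => [/andP[/eqP-> /eqP->]|_]; first by rewrite subrr normr0.
  exact: hd.
have w00 : (N%:R * N%:R)^-1 <= w ord0 ord0.
  rewrite /w !mxE /= invfM ler_pM ?invr_ge0// lef_pV2 ?posrE ?ltr0n// ler_nat ltn_ord//.
have -> : \sum_l \sum_m w l m * (if (l == ord0) && (m == ord0) then 0 else d) =
    d - w ord0 ord0 * d.
  rewrite (eq_bigr (fun l => (\sum_m w l m) * d - (if l == ord0 then w ord0 ord0 * d else 0))); last first.
    move=> l _; rewrite mulr_suml; case: eqP => [->|_] /=; last by rewrite subr0.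
    rewrite (bigD1 ord0)//= mulr0 add0r [in RHS](bigD1 ord0)//= addrAC subrr add0r.
    by apply: eq_bigr => m /negbTE ->.
  rewrite sumrB -mulr_suml wsum mul1r; congr (_ - _).
  by rewrite -big_mkcond big_pred1_eq.
by rewrite /mesh_ratio mulrBl mul1r lerD2l lerN2 ler_wpM2r.
Qed.

Lemma iter_Sd_local m g H (d : R) sg : 0 <= d -> in_simplex sg -> diam_le d sg ->
  (forall sg, in_simplex sg -> diam_le (mesh_ratio ^+ m * d) sg -> g sg = H sg) ->
  iter m Sd g sg = iter m Sd H sg.
Proof.
elim: m d sg => [|m IH] d sg d0 isg ds gH; first by apply: gH => //; rewrite expr0 mul1r.
rewrite !iterS; apply: eq_bigr => s _; congr (_ * _).
have /andP[r0 _] := mesh_ratio_bounds.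
apply: (IH (mesh_ratio * d)); [by rewrite mulr_ge0|exact: flag_in_simplex|exact: flag_diam|].
by move=> x ix dx; apply: gH => //; rewrite exprSr -mulrA.
Qed.

Lemma in_simplex1 : in_simplex 1%:M.
Proof.
split=> [i j|i]; first by rewrite mxE; case: eqP.
by rewrite (bigD1 i)//= big1 ?addr0 ?mxE ?eqxx// => j ji; rewrite mxE eq_sym (negbTE ji).
Qed.

Lemma diam1 : diam_le 1 1%:M.
Proof.
move=> i i' j; rewrite !mxE; case: eqP => _; case: eqP => _;
  by rewrite ?subrr ?subr0 ?sub0r ?normrN ?normr1 ?normr0.
Qed.

Lemma mesh_small (d : R) : 0 < d -> exists m0, forall m, (m0 <= m)%N -> mesh_ratio ^+ m <= d.
Proof.
move=> d0; have /andP[r0 r1] := mesh_ratio_bounds.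
have cv : (mesh_ratio ^+ m) @[m --> \oo] --> (0 : R) by apply: cvg_expr; rewrite ger0_norm.
have /cvgrPdist_lt/(_ d d0)[m0 _ h] := cv.
exists m0 => m m0m; have := h m m0m; rewrite sub0r normrN ger0_norm ?exprn_ge0//.
exact: ltW.
Qed.

Lemma iter_Sd_small m g H (d : R) : mesh_ratio ^+ m <= d ->
  (forall sg, in_simplex sg -> diam_le d sg -> g sg = H sg) ->
  iter m Sd g 1%:M = iter m Sd H 1%:M.
Proof.
move=> md gH; apply: (iter_Sd_local ler01 in_simplex1 diam1) => sg isg ds; apply: gH => //.
by move=> i i' j; rewrite (le_trans (ds i i' j))// mulr1.
Qed.

End Subdivision.

(** * Prism decomposition of a homotopy *)

Section Mix.
Variables (n : nat) (K : Type) (A : comNzRingType).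
Local Notation N := n.+1.

(** The simplices [mixm j] pass from [Y] to [X] one vertex at a time, and [bigm j], with rows
    [X_0, ..., X_j, Y_j, ..., Y_n], is the simplex of the prism between [mixm j] and [mixm j.+1]. *)
Definition mixm (j : nat) (X Y : 'M[K]_N) : 'M[K]_N :=
  \matrix_(i, c) if (i < j)%N then X i c else Y i c.

Definition bigm (j : nat) (X Y : 'M[K]_N) : 'M[K]_(N.+1, N) :=
  \matrix_(r, c) if (r <= j)%N then X (inord r) c else Y (inord r.-1) c.

(** Facets [j] and [j.+1] of the prism simplex are the two mixed simplices; the remaining facets lie
    over proper faces of the base. *)
Lemma mix_step (G : 'M[K]_N -> A) (j : nat) (X Y : 'M[K]_N) : (j < N)%N ->
  \sum_(i < N.+1) (-1) ^+ i * G (row' i (bigm j X Y)) = 0 ->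
  G (mixm j.+1 X Y) - G (mixm j X Y) =
  \sum_(r < N.+1 | (r < j)%N || (j.+1 < r)%N) (-1) ^+ (r + j) * G (row' r (bigm j X Y)).
Proof.
move=> jN E; have j1N : (j < N.+1)%N by rewrite ltnW.
pose a : 'I_N.+1 := Ordinal j1N; pose b : 'I_N.+1 := Ordinal (jN : (j.+1 < N.+1)%N).
have ab : b != a by rewrite -val_eqE /= neq_ltn ltnSn orbT.
have Ga : row' a (bigm j X Y) = mixm j X Y.
  apply/matrixP => i c; rewrite !mxE /= /bump; case: (ltnP i j) => ij.
    by rewrite add0n (ltnW ij) inord_val.
  by rewrite add1n /= ltnNge ij /= inord_val.
have Gb : row' b (bigm j X Y) = mixm j.+1 X Y.
  apply/matrixP => i c; rewrite !mxE /= /bump; case: (ltnP i j.+1) => ij.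
    by rewrite add0n -ltnS ij inord_val.
  by rewrite add1n /= ltnNge (ltnW ij) /= inord_val.
move: E; rewrite (bigD1 a)//= (bigD1 b)//= Ga Gb exprS mulN1r mulNr => E.
have {}E : (-1) ^+ j * (G (mixm j.+1 X Y) - G (mixm j X Y)) =
    \sum_(i < N.+1 | (i != a) && (i != b)) (-1) ^+ i * G (row' i (bigm j X Y)).
  by apply/eqP; rewrite -subr_eq0 -oppr_eq0; apply/eqP; rewrite -[RHS]E; ring.
have := congr1 (fun x => (-1) ^+ j * x) E; rewrite mulrA -expr2 sqrr_sign mul1r => ->.
rewrite mulr_sumr; apply: eq_big => [r|r _]; last by rewrite mulrA -exprD addnC.
by rewrite -!val_eqE /=; lia.
Qed.

(** The vertex of the base from which no row of facet [r] comes. *)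
Definition omitted (j r : nat) : nat := if (r < j)%N then r else r.-1.

Lemma row'_bigm_indep (j : nat) (r : 'I_N.+1) (X Y X' Y' : 'M[K]_N) : (j < N)%N ->
  (r < j)%N || (j.+1 < r)%N ->
  (forall (i : 'I_N) c, i != omitted j r :> nat -> X i c = X' i c) ->
  (forall (i : 'I_N) c, i != omitted j r :> nat -> Y i c = Y' i c) ->
  row' r (bigm j X Y) = row' r (bigm j X' Y').
Proof.
move=> jN rj hX hY; apply/matrixP => i c; rewrite !mxE.
have hs : (lift r i : nat) != r by rewrite eq_sym neq_bump.
have sN : (lift r i < N.+1)%N := ltn_ord _.
case: ifP => sj.
  apply: hX; rewrite inordK ?(leq_ltn_trans sj)//; move: hs rj sj; rewrite /omitted.
  by case: ifP; move: (nat_of_ord (lift r i)) (nat_of_ord r) => u v; lia.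
apply: hY; rewrite inordK; last by move: sN sj; move: (nat_of_ord (lift r i)) => u; lia.
move: hs rj sj; rewrite /omitted.
by case: ifP; move: (nat_of_ord (lift r i)) (nat_of_ord r) => u v; lia.
Qed.

End Mix.

Section HomotopyCochain.
Variables (R : realType) (n : nat) (K : Type) (A : numDomainType) (G : 'M[K]_n.+1 -> A).
Local Notation N := n.+1.
Implicit Types (sg : 'M[R]_N).

Definition app (phi : 'rV[R]_N -> 'rV[K]_N) sg : 'M[K]_N := \matrix_(i, c) phi (row i sg) 0 c.

Definition cocycle_at (U : 'M[K]_(N.+1, N)) := \sum_(i < N.+1) (-1) ^+ i * G (row' i U) = 0.

(** The change at each step of the prism is a sum of facets that ignore one vertex. If it is not the
    last vertex, subdivision cancels them; if it is, they reduce to the boundary, where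
    [face_vanishing] disposes of them. The sum over [a] stays inside that hypothesis so that glued
    pieces may cancel one another. *)
Theorem homotopy_cochain (I : finType) (c : I -> A) (phi psi : I -> 'rV[R]_N -> 'rV[K]_N)
    (m : nat) (d : R) : (0 < m)%N -> mesh_ratio R n ^+ m <= d ->
  (forall a j sg, (j < N)%N -> in_simplex sg -> diam_le d sg ->
     cocycle_at (bigm j (app (psi a) sg) (app (phi a) sg))) ->
  (forall j, (j < n)%N -> face_vanishing (fun sg =>
     \sum_a c a * G (row' ord_max (bigm j (app (psi a) sg) (app (phi a) sg))))) ->
  iter m (@Sd R n A) (fun sg => \sum_a c a * G (app (psi a) sg)) 1%:M =
  iter m (@Sd R n A) (fun sg => \sum_a c a * G (app (phi a) sg)) 1%:M.
Proof.
move=> m0 md coc fv.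
pose D j sg := \sum_a c a * G (mixm j (app (psi a) sg) (app (phi a) sg)).
have D0 sg : D 0%N sg = \sum_a c a * G (app (phi a) sg).
  apply: eq_bigr => a _; congr (_ * G _); by apply/matrixP => i k; rewrite !mxE.
have DN sg : D N sg = \sum_a c a * G (app (psi a) sg).
  apply: eq_bigr => a _; congr (_ * G _); by apply/matrixP => i k; rewrite !mxE ltn_ord.
rewrite -(eq_iter_Sd _ D0) -(eq_iter_Sd _ DN).
suff H j : (j <= N)%N -> iter m (@Sd R n A) (D j) 1%:M = iter m (@Sd R n A) (D 0%N) 1%:M.
  exact: H.
elim: j => [//|j IH] jN; rewrite -(IH (ltnW jN)); apply/eqP; rewrite -subr_eq0 -iter_SdB; apply/eqP.
pose E (r : 'I_N.+1) sg := \sum_a c a * G (row' r (bigm j (app (psi a) sg) (app (phi a) sg))).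
have appE f (i : 'I_N) sg sg' : (forall k, sg i k = sg' i k) -> forall k, app f sg i k = app f sg' i k.
  move=> h k; rewrite !mxE (_ : row i sg = row i sg')//.
  by apply/rowP => l; rewrite !mxE h.
transitivity (iter m (@Sd R n A) (fun sg =>
    \sum_(r < N.+1 | (r < j)%N || (j.+1 < r)%N) (-1) ^+ (r + j) * E r sg) 1%:M).
  apply: (iter_Sd_small md) => sg isg dsg; rewrite /D /E -sumrB.
  transitivity (\sum_a \sum_(r < N.+1 | (r < j)%N || (j.+1 < r)%N)
      (-1) ^+ (r + j) * (c a * G (row' r (bigm j (app (psi a) sg) (app (phi a) sg))))).
    apply: eq_bigr => a _; rewrite -mulrBr mix_step//; last exact: coc.
    by rewrite mulr_sumr; apply: eq_bigr => r _; rewrite mulrCA.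
  by rewrite exchange_big; apply: eq_bigr => r _; rewrite mulr_sumr.
rewrite iter_Sd_sum big1// => r rj; rewrite iter_SdZ.
have oN : (omitted j r < N)%N.
  by have := ltn_ord r; move: rj; rewrite /omitted; case: ifP; move: (nat_of_ord r) => v; lia.
have ind : indep_row (Ordinal oN) (E r).
  move=> sg sg' h; apply: eq_bigr => a _; congr (_ * G _).
  by apply: row'_bigm_indep => // i k io; apply: appE => l; apply: h; rewrite -val_eqE.
have [olt|oge] := ltnP (omitted j r) n; first by rewrite (iter_Sd_indep_row0 _ m0 _ ind)// mulr0.
have rE : r = ord_max.
  by apply/val_inj; have := ltn_ord r; move: rj oge jN; rewrite /omitted /=; case: ifP; move: (nat_of_ord r) => v; lia.
have jn : (j < n)%N by move: rj; rewrite rE /=; lia.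
have oE : Ordinal oN = ord_max by apply/val_inj/eqP; rewrite eqn_leq /= oge -ltnS oN.
rewrite oE in ind; rewrite iter_Sd_boundary0 ?mulr0//.
by rewrite rE; exact: fv.
Qed.

End HomotopyCochain.

(** * Subdivision leaves linear chains unchanged *)

Section SubdivisionInvariance.
Variables (R : realType) (n : nat) (A : numDomainType).
Local Notation N := n.+1.
Implicit Types (s : 'S_N) (sg : 'M[R]_N).

(** The simplicial approximation of the identity: the barycentre of a face is sent to its vertex of
    largest index. *)
Definition top s (i : 'I_N) : 'I_N := inord (\max_(l < N | (l <= i)%N) s l).

Lemma topE s (i : 'I_N) : top s i = \max_(l < N | (l <= i)%N) s l :> nat.
Proof.
rewrite inordK// ltnS; apply/bigmax_leqP => l _; by rewrite -ltnS ltn_ord.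
Qed.

Lemma top_tperm (i r : 'I_N) s : (i < n)%N -> r != i -> top (tperm i (nxt i) * s)%g r = top s r.
Proof.
move=> ilt ri; apply: ord_inj; rewrite !topE.
exact: (@sum_tperm n nat 0%N maxn (fun l => nat_of_ord l)).
Qed.

Lemma top_mem s (i : 'I_N) : exists2 l : 'I_N, (l <= i)%N & top s i = s l.
Proof.
have [l li E] : {l : 'I_N | l \in [pred l : 'I_N | (l <= i)%N]
    & \max_(l in [pred l : 'I_N | (l <= i)%N]) s l = s l :> nat}.
  by apply: eq_bigmax_cond; apply/card_gt0P; exists i; rewrite inE.
by exists l => //; apply: ord_inj; rewrite topE -E; apply: eq_bigl => x; rewrite inE.
Qed.

Lemma top_ge s (l i : 'I_N) : (l <= i)%N -> (s l <= top s i)%N.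
Proof. by move=> li; rewrite topE; exact: (@leq_bigmax_cond _ (fun l : 'I_N => (l <= i)%N) (fun l : 'I_N => nat_of_ord (s l)) l li). Qed.

Lemma top_mono s (i i' : 'I_N) : (i <= i')%N -> (top s i <= top s i')%N.
Proof. by move=> ii; have [l li ->] := top_mem s i; apply: top_ge; apply: leq_trans ii. Qed.

(** An injective [top s] is strictly increasing, so [s i <= top s i <= i], and a permutation with
    this property is the identity. *)
Lemma top_inj_id s : injective (top s) -> s = 1%g.
Proof.
move=> tinj.
have tle d (i : 'I_N) : (n - i = d)%N -> (top s i <= i)%N.
  elim: d i => [|d IH] i id.
    by rewrite (leq_trans (_ : (top s i <= n)%N))//; [rewrite -ltnS|lia].
  have ilt : (i < n)%N by lia.
  have ni := nxtE ilt; have := IH (nxt i); rewrite ni => /(_ _)h.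
  have : (top s (nxt i) <= i.+1)%N by apply: h; lia.
  have : (top s i <= top s (nxt i))%N by apply: top_mono; rewrite ni.
  have : (top s i : nat) != top s (nxt i).
    by rewrite val_eqE (inj_eq tinj) -val_eqE /= ni neq_ltn ltnSn.
  by lia.
have sle (i : 'I_N) : (s i <= i)%N by rewrite (leq_trans (top_ge s (leqnn i)))// (tle (n - i)%N).
apply/permP => i; rewrite perm1.
have [m im] := ubnP (i : nat); elim: m i im => // m IH i im.
apply/eqP; rewrite -val_eqE eqn_leq sle leqNgt; apply/negP => lt.
have := IH (s i) (leq_trans lt (im : (i <= m)%N)) => /perm_inj E.
by move: lt; rewrite E ltnn.
Qed.

Lemma top1 (i : 'I_N) : top 1%g i = i.
Proof.
apply: ord_inj; apply/eqP; rewrite eqn_leq; apply/andP; split.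
  by have [l li ->] := top_mem 1%g i; rewrite perm1.
by rewrite -{1}(perm1 i); exact: top_ge.
Qed.

Lemma det_col0 (B : 'M[R]_N) (j : 'I_N) : (forall i, B i j = 0) -> \det B = 0.
Proof. by move=> h; rewrite (expand_det_col B j) big1// => i _; rewrite h mul0r. Qed.

Variable g : 'M[R]_N -> A.
Hypothesis g_det0 : forall sg, \det sg = 0 -> g sg = 0.
Hypothesis g_cocycle : forall P : 'M[R]_(N.+1, N), (forall i j, 0 <= P i j) ->
  (forall i, \sum_j P i j = 1) -> cocycle_at g P.

(** The prism between each flag and its image under [top]. At the far end only the identity
    permutation gives a nondegenerate simplex, namely [sg]; the side facets cancel in pairs or are
    degenerate. *)
Theorem Sd_id sg : in_simplex sg -> Sd g sg = g sg.
Proof.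
move=> isg; have [s0 s1] := isg.
pose W s := flag s sg; pose W' s : 'M[R]_N := \matrix_(i, c) sg (top s i) c.
have isW' s : in_simplex (W' s).
  split=> [i j|i]; first by rewrite mxE.
  by under eq_bigr do rewrite mxE; exact: s1.
have isW s : in_simplex (W s) by exact: flag_in_simplex.
pose D (j : nat) := \sum_(s : 'S_N) (-1) ^+ s * g (mixm j (W' s) (W s)).
have D0 : D 0%N = Sd g sg.
  by apply: eq_bigr => s _; congr (_ * g _); apply/matrixP => i c; rewrite !mxE.
have DN : D N = g sg.
  have E s : mixm N (W' s) (W s) = W' s by apply/matrixP => i c; rewrite !mxE ltn_ord.
  rewrite /D (bigD1 1%g)//= odd_perm1 expr0 mul1r E big1 ?addr0.
    by congr g; apply/matrixP => i c; rewrite mxE top1.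
  move=> s sn1; rewrite E g_det0 ?mulr0//.
  have : ~ injective (top s) by move=> /top_inj_id E1; rewrite E1 eqxx in sn1.
  move=> ninj; have [i [i' [ii ti]]] : exists i i', i <> i' /\ top s i = top s i'.
    apply/not_existsP => h; apply: ninj => i i' ti; apply/not_notP => ii.
    by apply: (h i); exists i'.
  by apply: (@determinant_alternate _ _ _ i i'); [exact/eqP|move=> c; rewrite !mxE ti].
suff step j : (j < N)%N -> D j.+1 = D j.
  rewrite -DN -D0; suff: forall j, (j <= N)%N -> D j = D 0%N by move=> ->.
  by elim=> // j IH jN; rewrite step// IH// ltnW.
move=> jN; apply/eqP; rewrite -subr_eq0 /D -sumrB; apply/eqP.
pose E (r : 'I_N.+1) s := g (row' r (bigm j (W' s) (W s))).
transitivity (\sum_(s : 'S_N) \sum_(r < N.+1 | (r < j)%N || (j.+1 < r)%N)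
    (-1) ^+ (r + j) * ((-1) ^+ s * E r s)).
  apply: eq_bigr => s _; rewrite -mulrBr mix_step//.
    by rewrite mulr_sumr; apply: eq_bigr => r _; rewrite mulrCA.
  have [w0 w1] := isW s; have [w0' w1'] := isW' s.
  apply: g_cocycle => [i c|i]; first by rewrite [bigm _ _ _ _ _]mxE; case: ifP.
  transitivity (\sum_c (if (i <= j)%N then W' s (inord i) c else W s (inord i.-1) c)).
    by apply: eq_bigr => c _; rewrite mxE.
  by case: (i <= j)%N; [exact: w1'|exact: w1].
rewrite exchange_big big1// => r rj; rewrite -mulr_sumr.
have oN : (omitted j r < N)%N.
  by have := ltn_ord r; move: rj; rewrite /omitted; case: ifP; move: (nat_of_ord r) => v; lia.
have [olt|oge] := ltnP (omitted j r) n.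
  rewrite (@perm_swap0 _ _ _ (Ordinal oN))// ?mulr0// => s; congr g.
  apply: row'_bigm_indep => // i c io.
    by rewrite [LHS]mxE [RHS]mxE top_tperm.
  by rewrite /W flag_tperm.
(* With the last vertex of the flag omitted, all rows are combinations of the other vertices: the
   coefficient matrix [Cf] below has a zero last column. *)
rewrite big1 ?mulr0// => s _; rewrite [E r s]g_det0 ?mulr0//.
have /choice[tp htp] : forall i : 'I_N, exists l : 'I_N, (l <= i)%N /\ top s i = s l.
  by move=> i; have [l li tl] := top_mem s i; exists l.
pose Cf : 'M[R]_N := \matrix_(i, l)
  if (lift r i <= j)%N then (l == tp (inord (lift r i)))%:R else bary R n (inord (lift r i).-1) l.
have -> : row' r (bigm j (W' s) (W s)) = Cf *m row_perm s sg.
  apply/matrixP => i c; rewrite !mxE; case: ifP => hj.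
    rewrite (bigD1 (tp (inord (lift r i))))//= !mxE hj eqxx mul1r big1 ?addr0.
      by have [_ ->] := htp (inord (lift r i)).
    by move=> l lt; rewrite !mxE hj (negbTE lt) mul0r.
  by apply: eq_bigr => l _; rewrite !mxE hj ?mxE.
rewrite det_mulmx (@det_col0 _ ord_max) ?mul0r// => i; rewrite mxE.
have rE : r = N :> nat.
  by have := ltn_ord r; move: rj oge jN; rewrite /omitted; case: ifP; move: (nat_of_ord r) => v; lia.
have jn : (j < n)%N by move: rj; rewrite rE; lia.
have li : lift r i = i :> nat by rewrite /= /bump rE leqNgt ltn_ord.
rewrite li; case: ifP => ij.
  have [le _] := htp (inord i); case: eqP => // E1; move: le; rewrite -E1 /= inord_val.
  by move=> h; move: (leq_trans h ij); lia.
rewrite mxE inordK ?(leq_ltn_trans (leq_pred _))//; case: ifP => // /=.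
by have := ltn_ord i; move: ij; move: (nat_of_ord i) => v; lia.
Qed.

Lemma iter_Sd_id m sg : in_simplex sg -> iter m (@Sd R n A) g sg = g sg.
Proof.
move=> isg; have H k x : in_simplex x -> iter k (@Sd R n A) g x = g x.
  elim: k x => // k IH x ix; rewrite iterS -(Sd_id ix); apply: eq_bigr => s _.
  by rewrite IH//; exact: flag_in_simplex.
exact: H.
Qed.

End SubdivisionInvariance.

(** * Chains and homotopies *)

Section BilinearForm.
Variables (K : comNzRingType) (N : nat).
Implicit Types (w : 'M[K]_N) (x y : 'rV[K]_N).

Definition bil w x y : K := (x *m w *m y^T) 0 0.

Lemma bilE w x y : bil w x y = \sum_i \sum_j x 0 i * w i j * y 0 j.
Proof.
rewrite /bil mxE exchange_big; apply: eq_bigr => j _; rewrite !mxE mulr_suml.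
by apply: eq_bigr => i _.
Qed.

Lemma bilDl w x x' y : bil w (x + x') y = bil w x y + bil w x' y.
Proof. by rewrite /bil !mulmxDl mxE. Qed.

Lemma bilDr w x y y' : bil w x (y + y') = bil w x y + bil w x y'.
Proof. by rewrite /bil linearD mulmxDr mxE. Qed.

Lemma bilZl w a x y : bil w (a *: x) y = a * bil w x y.
Proof. by rewrite /bil -!scalemxAl mxE. Qed.

Lemma bilZr w a x y : bil w x (a *: y) = a * bil w x y.
Proof. by rewrite /bil linearZ -scalemxAr mxE. Qed.

Lemma bilDw w w' x y : bil (w + w') x y = bil w x y + bil w' x y.
Proof. by rewrite /bil mulmxDr mulmxDl mxE. Qed.

Lemma bilC w x y : w^T = w -> bil w x y = bil w y x.
Proof.
move=> sw; rewrite /bil (_ : x *m w *m y^T = (y *m w *m x^T)^T) 1?[LHS]mxE//.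
by rewrite !trmx_mul trmxK sw mulmxA.
Qed.

Lemma bil_rows m (U : 'M[K]_(m, N)) w i j : (U *m w *m U^T) i j = bil w (row i U) (row j U).
Proof. by rewrite /bil -row_mul [LHS]mxE [RHS]mxE; apply: eq_bigr => l _; rewrite !mxE. Qed.

End BilinearForm.

Section Bilinear.
Variable R : realType.
Local Notation C := R[i].
Local Notation Re := (@complex.Re R).
Local Notation Im := (@complex.Im R).

Lemma mx1_row N (x : 'rV[C]_N) : mx1 x = \sum_j cn (x 0 j).
Proof. by rewrite /mx1 big_ord1. Qed.

Lemma bil_bound N (w : 'M[C]_N) x y : cn (bil w x y) <= mx1 w * mx1 x * mx1 y.
Proof.
rewrite bilE (le_trans (cn_sum _ _ _))// /mx1 -mulrA mulr_suml ler_sum// => i _.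
rewrite (le_trans (cn_sum _ _ _))// mulr_suml ler_sum// => j _; rewrite !cnM.
rewrite [leLHS](_ : _ = cn (w i j) * (cn (x 0 i) * cn (y 0 j))); last by ring.
by rewrite ler_wpM2l ?cn_ge0// ler_pM ?cn_ge0//; [exact: (entry_le_mx1 x)|exact: (entry_le_mx1 y)].
Qed.

Lemma adm_rows m N (w : 'M[C]_N) (U : 'M[C]_(m, N)) (c : R) : 0 < c ->
  (forall i j, c <= Re (bil w (row i U) (row j U))) -> adm (U *m w *m U^T).
Proof.
move=> c0 hc; exists c => // s s0.
have -> : c * (\sum_i s i) ^+ 2 = \sum_i \sum_j c * (s i * s j).
  by rewrite expr2 mulr_suml mulr_sumr; apply: eq_bigr => i _; rewrite !mulr_sumr.
apply: ler_sum => i _; apply: ler_sum => j _; rewrite bil_rows ler_wpM2r ?mulr_ge0//.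
Qed.

End Bilinear.

(** * Chains of maps and straight-line homotopies *)

Section Homotopy.
Variables (R : realType) (n : nat).
Local Notation C := R[i].
Local Notation N := n.+1.
Local Notation Re := (@complex.Re R).
Local Notation Im := (@complex.Im R).
Local Notation vmap := ('rV[R]_N -> 'rV[C]_N).

Definition simp (p : 'rV[R]_N) := (forall j, 0 <= p 0 j) /\ \sum_j p 0 j = 1.

(** Uniform continuity and boundedness on the simplex are carried along as closure properties, in
    place of compactness. *)
Definition ucont (f : 'rV[R]_N -> C) := forall e : R, 0 < e -> exists2 d : R, 0 < d &
  forall p q, simp p -> simp q -> (forall j, `|p 0 j - q 0 j| <= d) -> cn (f p - f q) <= e.

Definition ubounded (f : 'rV[R]_N -> C) := exists B, forall p, simp p -> cn (f p) <= B.

Definition ucb f := ucont f /\ ubounded f.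

Definition ucbv (phi : vmap) := forall i, ucb (fun p => phi p 0 i).

(* A chain is given by the maps [phi true] and [phi false], the second one with coefficient
   [-1] if [k] is some [j] and [0] otherwise: the two maps are glued along the face [p_j = 0],
   and all other faces are sent to coordinate hyperplanes. *)
Definition sides (k : option 'I_N) (phi : bool -> vmap) :=
  (forall b (p : 'rV[R]_N) j, Some j != k -> p 0 j = 0 -> phi b p 0 j = 0) /\
  (forall (p : 'rV[R]_N) j, Some j = k -> p 0 j = 0 -> phi true p = phi false p).

Definition cf (k : option 'I_N) (b : bool) : C := if b then 1 else if k is Some _ then -1 else 0.

(** After [m] subdivisions each small simplex is replaced by the straight one on the images of its
    vertices, so the value represents the integral over the chain once [m] is large. *)
Definition chain_int (k : option 'I_N) (phi : bool -> vmap) (m : nat) (w : 'M[C]_N) : C :=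
  iter m (@Sd R n C) (fun sg => \sum_b cf k b * gcoch w (app (phi b) sg)) 1%:M.

Lemma gcoch_det0 (w u : 'M[C]_N) : \det u = 0 -> gcoch w u = 0.
Proof. by move=> u0; rewrite /gcoch u0 mul0r. Qed.

(** On the glued facet the two maps agree and their coefficients [1] and [-1] cancel; on any other
    facet the matrix has a zero column. *)
Lemma sides_face_vanishing k phi psi (w : 'M[C]_N) j : (j < n)%N -> sides k phi -> sides k psi ->
  face_vanishing (fun sg : 'M[R]_N => \sum_b cf k b *
    gcoch w (row' ord_max (bigm j (app (psi b) sg) (app (phi b) sg)))).
Proof.
move=> jn [f1 f2] [g1 g2] sg c sgc.
have rowc (i : 'I_N) : (i < n)%N -> row i sg 0 c = 0 by move=> ilt; rewrite mxE sgc.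
have [ck|ck] := eqVneq (Some c) k.
  rewrite big_bool /cf -ck mul1r mulN1r.
  apply/eqP; rewrite subr_eq0; apply/eqP; congr gcoch; apply/matrixP => i l; rewrite !mxE.
  have li : lift ord_max i = i :> nat by rewrite /= /bump leqNgt ltn_ord.
  rewrite li; case: ifP => ij.
    by rewrite (g2 (row (inord i) sg) c)// rowc// inordK// (leq_ltn_trans ij).
  rewrite (f2 (row (inord i.-1) sg) c)// rowc// inordK; last by rewrite (leq_ltn_trans (leq_pred _)).
  by move: ij (ltn_ord i); move: (nat_of_ord i) => v; lia.
rewrite big1// => b _; rewrite gcoch_det0 ?mulr0//.
rewrite (expand_det_col _ c) big1// => i _.
suff -> : row' ord_max (bigm j (app (psi b) sg) (app (phi b) sg)) i c = 0 by rewrite mul0r.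
rewrite !mxE.
have li : lift ord_max i = i :> nat by rewrite /= /bump leqNgt ltn_ord.
rewrite li; case: ifP => ij.
  by apply: g1 => //; rewrite rowc// inordK// (leq_ltn_trans ij).
apply: f1 => //; rewrite rowc// inordK; last by rewrite (leq_ltn_trans (leq_pred _))// ltn_ord.
by move: ij (ltn_ord i); move: (nat_of_ord i) => v; lia.
Qed.

Definition lerp (phi psi : bool -> vmap) (s : R) b p := phi b p + s%:C *: (psi b p - phi b p).

Lemma sides_lerp k phi psi s : sides k phi -> sides k psi -> sides k (lerp phi psi s).
Proof.
move=> [f1 f2] [g1 g2]; split => [b p j jk pj|p j jk pj]; rewrite /lerp.
  by rewrite !mxE (f1 _ _ _ jk pj) (g1 _ _ _ jk pj) subrr mulr0 addr0.
by rewrite (f2 _ _ jk pj) (g2 _ _ jk pj).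
Qed.

Lemma ucbv_bound (phi : bool -> vmap) : (forall b, ucbv (phi b)) ->
  exists2 B : R, 0 < B & forall b p, simp p -> mx1 (phi b p) <= B.
Proof.
move=> h; have /choice[B hB] : forall bi : bool * 'I_N, exists B, forall p, simp p -> cn (phi bi.1 p 0 bi.2) <= B.
  by move=> [b i]; have [_ [B hB]] := h b i; exists B.
exists (1 + \sum_b \sum_i `|B (b, i)|).
  by rewrite ltr_wpDr// sumr_ge0// => b _; rewrite sumr_ge0.
move=> b p sp; rewrite mx1_row (le_trans (_ : _ <= \sum_i `|B (b, i)|))//.
  by apply: ler_sum => i _; rewrite (le_trans (hB (b, i) p sp))// ler_norm.
rewrite (bigD1 b)//= addrCA lerDl addr_ge0// sumr_ge0// => b' _; by rewrite sumr_ge0.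
Qed.

Lemma ucbv_modulus (phi : bool -> vmap) : (forall b, ucbv (phi b)) -> forall e : R, 0 < e ->
  exists2 d : R, 0 < d & forall b p q, simp p -> simp q -> (forall j, `|p 0 j - q 0 j| <= d) ->
    mx1 (phi b p - phi b q) <= e.
Proof.
move=> h e e0; have eN : 0 < e / N%:R by rewrite divr_gt0.
have /choice[d hd] : forall bi : bool * 'I_N, exists d : R, 0 < d /\ forall p q, simp p -> simp q ->
    (forall j, `|p 0 j - q 0 j| <= d) -> cn (phi bi.1 p 0 bi.2 - phi bi.1 q 0 bi.2) <= e / N%:R.
  by move=> [b i]; have [hu _] := h b i; have [d d0 hd] := hu _ eN; exists d.
exists (\big[Num.min/1]_(bi : bool * 'I_N) d bi).
  by elim/big_ind: _ => // [x y x0 y0|bi _]; [rewrite lt_min x0|have [] := hd bi].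
move=> b p q sp sq pq; rewrite mx1_row (le_trans (_ : _ <= \sum_(i < N) (e / N%:R)))//.
  apply: ler_sum => i _; rewrite !mxE; have [_] := hd (b, i); apply => // j.
  by rewrite (le_trans (pq j))// bigmin_le_cond.
by rewrite sumr_const card_ord -[_ *+ _]mulr_natr mulfVK// pnatr_eq0.
Qed.

Lemma bil_near (K B dl : R) : 0 <= K -> 0 <= B -> 0 < dl -> exists2 et : R, 0 < et &
  forall (D w : 'M[C]_N) (x y z : 'rV[C]_N), mx1 D <= K -> mx1 z <= B -> mx1 (w - D) <= et ->
    mx1 (x - z) <= et -> mx1 (y - z) <= et -> dl <= Re (bil D z z) -> dl / 2 <= Re (bil w x y).
Proof.
(* [Q] collects the errors, per unit of [et], of changing the matrix, the left argument and the
   right argument. *)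
move=> K0 B0 dl0; pose Q := (B + 1) ^+ 2 + 2 * K * (B + 1).
have Q0 : 0 < Q by rewrite /Q; have := mulr_ge0 K0 B0; nra.
exists (Num.min 1 (dl / (2 * Q))).
  by rewrite lt_min ltr01 divr_gt0// mulr_gt0.
move=> D w x y z hD hz; set et := Num.min _ _ => hw hx hy hdl.
have et1 : et <= 1 by rewrite /et ge_min lexx.
have et0 : 0 <= et by rewrite (le_trans (mx1_ge0 _) hw).
have etQ : et * Q <= dl / 2.
  rewrite -ler_pdivlMr// (le_trans (_ : _ <= dl / (2 * Q)))//; first by rewrite /et ge_min lexx orbT.
  by rewrite invfM mulrA.
have by1 : mx1 y <= B + 1.
  by rewrite -(subrK z y) (le_trans (mx1D _ _))// addrC lerD// (le_trans hy).
have bx1 : mx1 x <= B + 1.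
  by rewrite -(subrK z x) (le_trans (mx1D _ _))// addrC lerD// (le_trans hx).
have E : bil w x y - bil D z z = bil (w - D) x y + bil D (x - z) y + bil D z (y - z).
  have E1 : bil w x y = bil (w - D) x y + bil D x y by rewrite -bilDw subrK.
  have E2 : bil D x y = bil D (x - z) y + bil D z y by rewrite -bilDl subrK.
  have E3 : bil D z y = bil D z (y - z) + bil D z z by rewrite -bilDr subrK.
  by rewrite E1 E2 E3; ring.
have : cn (bil w x y - bil D z z) <= dl / 2.
  rewrite E (le_trans (cnD _ _))//.
  have e1 : cn (bil (w - D) x y) <= et * (B + 1) ^+ 2.
    rewrite (le_trans (bil_bound _ _ _))// expr2 mulrA !ler_pM ?mulr_ge0 ?mx1_ge0//.
  have e2 : cn (bil D (x - z) y) <= K * et * (B + 1).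
    by rewrite (le_trans (bil_bound _ _ _))// !ler_pM ?mulr_ge0 ?mx1_ge0.
  have e3 : cn (bil D z (y - z)) <= K * B * et.
    by rewrite (le_trans (bil_bound _ _ _))// !ler_pM ?mulr_ge0 ?mx1_ge0.
  rewrite (le_trans (lerD (le_trans (cnD _ _) (lerD e1 e2)) e3))// (le_trans _ etQ)// /Q.
  by have := mulr_ge0 K0 et0; clear -et0 B0; nra.
move=> /(le_trans (Re_le_cn _)); rewrite ler_norml => /andP[+ _]; rewrite ReD ReN.
by move: hdl; clear; lra.
Qed.

Lemma in_simplex_row sg i : in_simplex sg -> simp (row i sg).
Proof.
move=> [s0 s1]; split=> [j|]; first by rewrite mxE.
by rewrite -(s1 i); apply: eq_bigr => j _; rewrite mxE.
Qed.

(** All vertices of a prism over a small simplex lie within [et] of one point [z], so the form has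
    real part at least [dl / 2] on every pair of them; this makes the prism admissible for the
    cocycle relation. *)
Lemma homotopy_step k phi psi (D w : 'M[C]_N) (B dl et d : R) (m : nat) :
  sides k phi -> sides k psi -> w^T = w -> 0 < dl ->
  (forall (x y z : 'rV[C]_N), mx1 z <= B ->
    mx1 (x - z) <= et -> mx1 (y - z) <= et -> dl <= Re (bil D z z) -> dl / 2 <= Re (bil w x y)) ->
  (forall b p, simp p -> mx1 (phi b p) <= B /\ dl <= Re (bil D (phi b p) (phi b p))) ->
  (forall b p q, simp p -> simp q -> (forall j, `|p 0 j - q 0 j| <= d) ->
    mx1 (phi b p - phi b q) <= et / 2) ->
  (forall b p, simp p -> mx1 (psi b p - phi b p) <= et / 2) ->
  (0 < m)%N -> mesh_ratio R n ^+ m <= d ->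
  chain_int k psi m w = chain_int k phi m w.
Proof.
move=> sphi spsi sw dl0 near hphi mod1 dist m0 md.
apply: (homotopy_cochain (d := d)) => //; last by move=> j jn; exact: sides_face_vanishing.
move=> b j sg jN isg dsg; apply: gcoch_cocycle => //.
apply: (@adm_rows _ _ _ _ _ (dl / 2)); first by rewrite divr_gt0.
pose z := phi b (row ord0 sg); have sr i := in_simplex_row i isg.
have [zB zd] := hphi b _ (sr ord0).
have et0 : 0 <= et / 2 by rewrite (le_trans _ (dist b _ (sr ord0)))// mx1_ge0.
have cl r : mx1 (row r (bigm j (app (psi b) sg) (app (phi b) sg)) - z) <= et.
  have mo i : mx1 (phi b (row i sg) - z) <= et / 2.
    by apply: mod1 => // l; rewrite !mxE.
  have [rj|rj] := leqP r j.
    have -> : row r (bigm j (app (psi b) sg) (app (phi b) sg)) = psi b (row (inord r) sg).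
      by apply/rowP => c; rewrite !mxE rj.
    rewrite (le_trans (mx1_tri (phi b (row (inord r) sg)) _ _))// [leRHS](splitr et).
    by rewrite lerD// dist.
  have -> : row r (bigm j (app (psi b) sg) (app (phi b) sg)) = phi b (row (inord r.-1) sg).
    by apply/rowP => c; rewrite !mxE leqNgt rj.
  by rewrite (le_trans (mo _))// [leRHS](splitr et) lerDl.
by move=> i i'; exact: (near _ _ z).
Qed.

Lemma lerp_bound phi psi (B s : R) b p : 0 <= s <= 1 ->
  mx1 (phi b p) <= B -> mx1 (psi b p) <= B -> mx1 (lerp phi psi s b p) <= 3 * B.
Proof.
move=> /andP[s0 s1] h1 h2; rewrite (le_trans (mx1D _ _))// mx1Z cnR ger0_norm//.
have h3 : mx1 (psi b p - phi b p) <= B + B.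
  by rewrite (le_trans (mx1D _ _))// mx1N lerD.
have := mx1_ge0 (psi b p - phi b p); move: h1 h3 s0 s1; clear.
move: (mx1 _) (mx1 (psi b p - phi b p)) => u v; nra.
Qed.

Lemma lerp_modulus phi psi (e s : R) b p q : 0 <= s <= 1 ->
  mx1 (phi b p - phi b q) <= e -> mx1 (psi b p - psi b q) <= e ->
  mx1 (lerp phi psi s b p - lerp phi psi s b q) <= 3 * e.
Proof.
move=> s01 h1 h2.
have -> : lerp phi psi s b p - lerp phi psi s b q =
    lerp (fun b _ => phi b p - phi b q) (fun b _ => psi b p - psi b q) s b p.
  by apply/rowP => j; rewrite !mxE; ring.
exact: lerp_bound.
Qed.

(** The line is cut into steps short enough for [homotopy_step]. The bounds [et] and [m0] are
    uniform in the matrix [w], as the identity theorem later requires one [m] for a whole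
    neighbourhood. *)
Theorem homotopy_line k phi psi (D : 'M[C]_N) (dl : R) :
  sides k phi -> sides k psi -> (forall b, ucbv (phi b)) -> (forall b, ucbv (psi b)) -> 0 < dl ->
  (forall s b p, 0 <= s <= 1 -> simp p ->
     dl <= Re (bil D (lerp phi psi s b p) (lerp phi psi s b p))) ->
  exists2 et : R, 0 < et & exists m0, forall m, (m0 <= m)%N -> forall w, w^T = w ->
    mx1 (w - D) <= et -> chain_int k phi m w = chain_int k psi m w.
Proof.
move=> sphi spsi uphi upsi dl0 pos.
have [B1 B10 hB1] := ucbv_bound uphi; have [B2 B20 hB2] := ucbv_bound upsi.
pose B := B1 + B2; have B0 : 0 < B by rewrite addr_gt0.
have b1 b p : simp p -> mx1 (phi b p) <= B.
  by move=> sp; rewrite (le_trans (hB1 b p sp))// lerDl ltW.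
have b2 b p : simp p -> mx1 (psi b p) <= B.
  by move=> sp; rewrite (le_trans (hB2 b p sp))// lerDr ltW.
have [et et0 near] := bil_near (mx1_ge0 D) (ltW (mulr_gt0 (ltr0Sn R 2) B0)) dl0.
have e60 : 0 < et / 6 by rewrite divr_gt0.
have [d1 d10 hd1] := ucbv_modulus uphi e60; have [d2 d20 hd2] := ucbv_modulus upsi e60.
have d0 : 0 < Num.min d1 d2 by rewrite lt_min d10.
have [m0 hm0] := @mesh_small R n _ d0.
exists et => //; exists m0.+1 => m m0m w sw wD.
(* The two ends are at most [2 * B] apart, so [L] equal steps move each point by at most
   [et / 2]. *)
have [L L0 hL] : exists2 L : nat, 0 < L%:R :> R & 2 * B / L%:R <= et / 2.
  exists (Num.truncn (4 * B / et)).+1; first by rewrite ltr0n.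
  have : 4 * B / et < (Num.truncn (4 * B / et)).+1%:R by exact: truncnS_gt.
  by rewrite ltr_pdivrMr// ler_pdivrMr ?ltr0n//; clear; lra.
have s01 (l : nat) : (l <= L)%N -> 0 <= (l%:R / L%:R : R) <= 1.
  move=> lL; apply/andP; split; first by rewrite divr_ge0 ?ler0n ?(ltW L0).
  by rewrite ler_pdivrMr// mul1r ler_nat.
suff H l : (l <= L)%N -> chain_int k (lerp phi psi (l%:R / L%:R)) m w = chain_int k phi m w.
  have e0 : chain_int k (lerp phi psi 1) m w = chain_int k psi m w.
    congr (chain_int k _ m w); apply/funext => b; apply/funext => p.
    by rewrite /lerp scale1r addrC subrK.
  have := H L (leqnn L); rewrite divff; last exact: lt0r_neq0.
  by move=> HL; exact (etrans (esym HL) e0).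
elim: l => [_|l IH lL].
  congr (chain_int k _ m w); apply/funext => b; apply/funext => p.
  by rewrite /lerp mul0r scale0r addr0.
rewrite -(IH (ltnW lL)); have {IH}s01l := s01 l (ltnW lL).
apply: (@homotopy_step k _ _ D w (3 * B) dl et (Num.min d1 d2)) => //.
- exact: sides_lerp.
- exact: sides_lerp.
- by move=> x y z *; apply: (near D w x y z).
- by move=> b p sp; split; [apply: lerp_bound; auto|exact: pos].
- move=> b p q sp sq pq; rewrite (_ : et / 2 = 3 * (et / 6)); last by field.
  apply: lerp_modulus => //; [apply: hd1|apply: hd2] => // j; apply: (le_trans (pq j));
    by rewrite ge_min lexx ?orbT.
- move=> b p sp; have -> : lerp phi psi (l.+1%:R / L%:R) b p - lerp phi psi (l%:R / L%:R) b p =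
      (L%:R^-1)%:C *: (psi b p - phi b p).
    rewrite /lerp opprD addrACA subrr add0r -scalerBl -rmorphB -mulrBl -natrB ?leqnSn//.
    by rewrite subSnn mul1r.
  rewrite mx1Z cnR ger0_norm ?invr_ge0 ?(ltW L0)// (le_trans _ hL)// [leRHS]mulrC ler_wpM2l ?invr_ge0 ?(ltW L0)//.
  by rewrite (le_trans (mx1D _ _))// mx1N -[2]/(1 + 1) mulrDl mul1r lerD; auto.
- exact: leq_ltn_trans m0m.
- by apply: hm0; exact: ltnW.
Qed.

End Homotopy.

Section Terms.
Variables (R : realType) (n : nat).
Local Notation C := R[i].
Local Notation N := n.+1.
Local Notation Re := (@complex.Re R).

(** The list of signed small simplices is independent of the cochain, so differentiability and
    reality can be checked term by term. *)
Lemma iter_Sd_terms (A : numDomainType) m (d : R) (sg : 'M[R]_N) : 0 <= d -> in_simplex sg -> diam_le d sg ->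
  exists2 r : seq (bool * 'M[R]_N), forall g, iter m (@Sd R n A) g sg = \sum_(x <- r) (-1) ^+ x.1 * g x.2 &
    forall x, x \in r -> in_simplex x.2 /\ diam_le (mesh_ratio R n ^+ m * d) x.2.
Proof.
elim: m d sg => [|m IH] d sg d0 isg dsg.
  exists [:: (false, sg)] => [g|x]; first by rewrite big_seq1 expr0 mul1r.
  by rewrite inE => /eqP ->; rewrite expr0 mul1r.
have /andP[r0 _] := mesh_ratio_bounds R n.
have rd0 : 0 <= mesh_ratio R n * d by rewrite mulr_ge0.
have /choice[r hr] : forall s : 'S_N, exists r : seq (bool * 'M[R]_N),
    (forall g, iter m (@Sd R n A) g (flag s sg) = \sum_(x <- r) (-1) ^+ x.1 * g x.2) /\
    (forall x, x \in r -> in_simplex x.2 /\ diam_le (mesh_ratio R n ^+ m * (mesh_ratio R n * d)) x.2).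
  move=> s; have [r h1 h2] := IH _ _ rd0 (flag_in_simplex s isg) (flag_diam s d0 dsg).
  by exists r.
exists (flatten [seq [seq (perm.odd_perm s (+) x.1, x.2) | x <- r s] | s <- index_enum 'S_N]).
  move=> g; rewrite iterS /Sd big_flatten big_map; apply: eq_bigr => s _.
  have [-> _] := hr s; rewrite big_map mulr_sumr; apply: eq_bigr => x _ /=.
  by rewrite mulrA signr_addb.
move=> x /flatten_mapP[s _ /mapP[y yr ->]] /=; have [_ /(_ y yr)] := hr s.
by rewrite exprSr mulrA.
Qed.

Lemma chain_int_terms m (d : R) : mesh_ratio R n ^+ m <= d ->
  exists2 r : seq (bool * 'M[R]_N), forall k phi w,
      chain_int k phi m w = \sum_(x <- r) (-1) ^+ x.1 * \sum_b cf R k b * gcoch w (app (phi b) x.2) &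
    forall x, x \in r -> in_simplex x.2 /\ diam_le d x.2.
Proof.
move=> md; have [r h1 h2] := iter_Sd_terms R[i] m ler01 (in_simplex1 R n) (@diam1 R n).
exists r => [k phi w|x /h2[ix dx]]; first exact: h1.
by split=> // i i' j; rewrite (le_trans (dx i i' j))// mulr1.
Qed.

Lemma cdiff_sum_mem (I : eqType) (r : seq I) (F : I -> C -> C) z :
  (forall i, i \in r -> cdiff (F i) z) -> cdiff (fun w => \sum_(i <- r) F i w) z.
Proof.
elim: r => [|i r IH] h.
  have [s cs hs] := cdiff_cst 0 z; exists s => // w; rewrite !big_nil; exact: hs.
have [s cs hs] : cdiff (fun w => F i w + \sum_(i <- r) F i w) z.
  by apply: cdiffD; [apply: h; rewrite mem_head|apply: IH => j jr; apply: h; rewrite inE jr orbT].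
by exists s => // w; rewrite !big_cons; exact: hs.
Qed.

(** The number [m0] depends on the maps and on the bounds [K] and [dl] only, so a single [m] serves
    all points of a complex line. *)
Lemma chain_int_cdiff k (phi : bool -> 'rV[R]_N -> 'rV[C]_N) (K dl : R) : 0 <= K -> 0 < dl ->
  (forall b, ucbv (phi b)) -> exists m0, forall m, (m0 <= m)%N -> forall w0 w1 z,
    mx1 (w0 + z *: w1) <= K ->
    (forall b p, simp p -> dl <= Re (bil (w0 + z *: w1) (phi b p) (phi b p))) ->
    cdiff (fun z => chain_int k phi m (w0 + z *: w1)) z.
Proof.
move=> K0 dl0 uphi; have [B B0 hB] := ucbv_bound uphi.
have [et et0 near] := @bil_near R n K B dl K0 (ltW B0) dl0.
have [d d0 hd] := ucbv_modulus uphi et0; have [m0 hm0] := @mesh_small R n d d0.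
exists m0 => m mm w0 w1 z wK pos; have [r hr1 hr2] := chain_int_terms (hm0 m mm).
suff : cdiff (fun z => \sum_(x <- r) (-1) ^+ x.1 * \sum_b cf R k b * gcoch (w0 + z *: w1) (app (phi b) x.2)) z.
  by apply: (@cdiff_near _ _ _ _ 1); [exact: ltr01|move=> v _; rewrite hr1].
apply: cdiff_sum_mem => x /hr2[ix dx]; apply: cdiffM; first exact: cdiff_cst.
apply: cdiff_sum => b; apply: cdiffM; first exact: cdiff_cst.
apply: gcoch_cdiff; apply: (@adm_rows _ _ _ _ _ (dl / 2)); first by rewrite divr_gt0.
have rE i : row i (app (phi b) x.2) = phi b (row i x.2) by apply/rowP => c; rewrite !mxE.
have sr i := in_simplex_row i ix.
move=> i j; rewrite !rE; apply: (near (w0 + z *: w1) _ _ _ (phi b (row ord0 x.2))) => //.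
- exact: hB.
- by rewrite subrr /mx1 big1 ?ltW// => a _; rewrite big1// => c _; rewrite mxE cn0.
- by apply: hd => // c; rewrite !mxE.
- by apply: hd => // c; rewrite !mxE.
- exact: pos.
Qed.

End Terms.

Section Ucb.
Variables (R : realType) (n : nat).
Local Notation C := R[i].
Local Notation N := n.+1.
Implicit Types (f g : 'rV[R]_N -> C).

Lemma ucb_cst (a : C) : ucb (fun _ : 'rV[R]_N => a).
Proof.
split; first by move=> e e0; exists 1 => // *; rewrite subrr cn0 ltW.
by exists (cn a).
Qed.

Lemma ucb_coord (i : 'I_N) : ucb (fun p : 'rV[R]_N => (p 0 i)%:C).
Proof.
split; first by move=> e e0; exists e => // p q _ _ pq; rewrite -rmorphB cnR.
exists 1 => p [p0 <-]; rewrite cnR ger0_norm// (bigD1 i)//= lerDl sumr_ge0// => j _.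
Qed.

Lemma ucbD f g : ucb f -> ucb g -> ucb (fun p => f p + g p).
Proof.
move=> [uf [Bf bf]] [ug [Bg bg]]; split.
  move=> e e0; have e20 : 0 < e / 2 by rewrite divr_gt0.
  have [d1 d10 h1] := uf _ e20; have [d2 d20 h2] := ug _ e20.
  exists (Num.min d1 d2) => [|p q sp sq pq]; first by rewrite lt_min d10.
  rewrite opprD addrACA (le_trans (cnD _ _))// [leRHS]splitr lerD//.
    by apply: h1 => // j; rewrite (le_trans (pq j))// ge_min lexx.
  by apply: h2 => // j; rewrite (le_trans (pq j))// ge_min lexx orbT.
by exists (Bf + Bg) => p sp; rewrite (le_trans (cnD _ _))// lerD; auto.
Qed.

Lemma ucbM f g : ucb f -> ucb g -> ucb (fun p => f p * g p).
Proof.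
move=> [uf [Bf bf]] [ug [Bg bg]]; split; last first.
  by exists (Bf * Bg) => p sp; rewrite cnM ler_pM ?cn_ge0; auto.
move=> e e0; pose B := `|Bf| + `|Bg| + 1.
have B0 : 0 < B by rewrite ltr_wpDl// addr_ge0.
have eB0 : 0 < e / (2 * B) by rewrite divr_gt0// mulr_gt0.
have [d1 d10 h1] := uf _ eB0; have [d2 d20 h2] := ug _ eB0.
exists (Num.min d1 d2) => [|p q sp sq pq]; first by rewrite lt_min d10.
have -> : f p * g p - f q * g q = (f p - f q) * g p + f q * (g p - g q) by ring.
have fB x : simp x -> cn (f x) <= B.
  move=> /bf h; rewrite (le_trans h)// (le_trans (ler_norm _))// /B -addrA lerDl addr_ge0//.
have gB x : simp x -> cn (g x) <= B.
  move=> /bg h; rewrite (le_trans h)// (le_trans (ler_norm _))// /B addrAC ler_wpDl// addr_ge0.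
have hp : cn (f p - f q) <= e / (2 * B).
  by apply: h1 => // j; rewrite (le_trans (pq j))// ge_min lexx.
have hq : cn (g p - g q) <= e / (2 * B).
  by apply: h2 => // j; rewrite (le_trans (pq j))// ge_min lexx orbT.
rewrite (le_trans (cnD _ _))// !cnM (@le_trans _ _ (e / (2 * B) * B + B * (e / (2 * B))))//.
  by rewrite lerD// ler_pM ?cn_ge0; auto.
rewrite le_eqVlt; apply/orP; left; apply/eqP; field; exact: lt0r_neq0.
Qed.

Lemma ucb_sum (I : Type) (r : seq I) (F : I -> 'rV[R]_N -> C) :
  (forall i, ucb (F i)) -> ucb (fun p => \sum_(i <- r) F i p).
Proof.
move=> uF; elim: r => [|i r IH].
  by under eq_fun do rewrite big_nil; exact: ucb_cst.
by under eq_fun do rewrite big_cons; exact: ucbD.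
Qed.

Lemma ucb_conj f : ucb f -> ucb (fun p => (f p)^*).
Proof.
move=> [uf [B hB]]; split; last by exists B => p sp; rewrite cn_conj hB.
move=> e e0; have [d d0 hd] := uf e e0; exists d => // p q sp sq pq.
by rewrite -rmorphB cn_conj hd.
Qed.

Lemma ucbV f (c : R) : 0 < c -> (forall p, simp p -> c <= cn (f p)) -> ucb f -> ucb (fun p => (f p)^-1).
Proof.
move=> c0 hc [uf _]; split; last first.
  exists c^-1 => p sp; rewrite cnV lef_pV2 ?hc// posrE ?(lt_le_trans c0)// ?hc//.
move=> e e0; have ec0 : 0 < e * c ^+ 2 by rewrite mulr_gt0// exprn_gt0.
have [d d0 hd] := uf _ ec0; exists d => // p q sp sq pq.
have fp0 : f p != 0 by rewrite -cn_gt0 (lt_le_trans c0)// hc.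
have fq0 : f q != 0 by rewrite -cn_gt0 (lt_le_trans c0)// hc.
have -> : (f p)^-1 - (f q)^-1 = (f q - f p) / (f p * f q).
  by field; rewrite fp0 fq0.
rewrite cnM cnV cnM ler_pdivrMr ?mulr_gt0 ?cn_gt0// cn_sub (le_trans (hd p q sp sq pq))//.
by rewrite (ler_wpM2l (ltW e0))// expr2 ler_pM ?(ltW c0) ?hc.
Qed.

Lemma ucb_ext f g : f =1 g -> ucb f -> ucb g.
Proof. by move=> /funext ->. Qed.

End Ucb.

(** * Transport of chains *)

Section Compress.
Variables (R : realType) (n : nat).
Local Notation C := R[i].
Local Notation N := n.+1.
Local Notation Re := (@complex.Re R).

Lemma mx1_mul a b c (X : 'M[C]_(a, b)) (Y : 'M[C]_(b, c)) : mx1 (X *m Y) <= mx1 X * mx1 Y.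
Proof.
rewrite /mx1 mulr_suml ler_sum// => i _.
rewrite (@le_trans _ _ (\sum_j \sum_l cn (X i l) * cn (Y l j)))//.
  apply: ler_sum => j _; rewrite mxE (le_trans (cn_sum _ _ _))// ler_sum// => l _.
  by rewrite cnM.
rewrite exchange_big mulr_suml ler_sum// => l _ /=; rewrite -mulr_sumr ler_wpM2l ?cn_ge0//.
rewrite [leRHS](bigD1 l)//= lerDl sumr_ge0// => l' _; rewrite sumr_ge0// => j _.
exact: cn_ge0.
Qed.

Lemma mx1_max (x : 'rV[C]_N) : exists j, mx1 x <= N%:R * cn (x 0 j).
Proof.
exists [arg max_(j > ord0) cn (x 0 j)]%O; case: arg_maxP => // j _ hj.
rewrite mx1_row (@le_trans _ _ (\sum_(i < N) cn (x 0 j)))//; first by rewrite ler_sum// => i _; exact: hj.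
by rewrite sumr_const card_ord mulr_natl.
Qed.

Lemma mulCconj (z : C) : z * z^* = (cn z ^+ 2)%:C.
Proof. by rewrite cn2E; case: z => a b; apply: C_eq; rewrite /=; ring. Qed.

(** [W] bounds the inverses of all the finitely many principal blocks at once. *)
Lemma principal_bound (D : 'M[C]_N) :
  (forall S : {set 'I_N}, (0 < #|S|)%N -> principal_minor D S != 0) ->
  exists2 mu : R, 0 < mu & forall (S : {set 'I_N}) (x : 'I_N -> C), (0 < #|S|)%N ->
    mu * \sum_(i in S) cn (x i) <= \sum_(i in S) cn (\sum_(j in S) x j * D j i).
Proof.
move=> hD; pose A (S : {set 'I_N}) : 'M[C]_#|S| := \matrix_(i, j) D (enum_val i) (enum_val j).
pose W := 1 + \sum_S mx1 (invmx (A S)).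
have W0 : 0 < W by rewrite ltr_wpDr// sumr_ge0// => S _; exact: mx1_ge0.
exists W^-1; first by rewrite invr_gt0.
move=> S x S0; rewrite ler_pdivrMl//.
have uA : A S \in unitmx by rewrite unitmxE unitfE; exact: hD.
pose y : 'rV[C]_#|S| := \row_i x (enum_val i).
have -> : \sum_(i in S) cn (x i) = mx1 y.
  by rewrite big_enum_val /mx1 big_ord1; apply: eq_bigr => i _; rewrite mxE.
have -> : \sum_(i in S) cn (\sum_(j in S) x j * D j i) = mx1 (y *m A S).
  rewrite big_enum_val /mx1 big_ord1; apply: eq_bigr => i _; congr cn.
  by rewrite big_enum_val mxE; apply: eq_bigr => j _; rewrite !mxE.
rewrite -{1}(mulmxK uA y) (le_trans (mx1_mul _ _))// mulrC ler_wpM2r ?mx1_ge0//.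
rewrite /W (bigD1 S)//= addrCA lerDl addr_ge0// sumr_ge0// => T _; exact: mx1_ge0.
Qed.

(** The weight [|x_i|^2 / |x|^2] vanishes with [x_i], so the push keeps the coordinate hyperplanes;
    the normalisation keeps it at most one. The glued index [k] has weight one, its facet being free
    to move. *)
Definition omega (k : option 'I_N) (x : 'rV[C]_N) i : R :=
  if Some i == k then 1 else cn (x 0 i) ^+ 2 / \sum_j cn (x 0 j) ^+ 2.

Lemma sq_sum_ge0 (x : 'rV[C]_N) : 0 <= \sum_j cn (x 0 j) ^+ 2.
Proof. by rewrite sumr_ge0// => j _; rewrite sqr_ge0. Qed.

Lemma sq_sum_le (x : 'rV[C]_N) : \sum_j cn (x 0 j) ^+ 2 <= mx1 x ^+ 2.
Proof.
rewrite mx1_row expr2 mulr_suml ler_sum// => i _; rewrite expr2 ler_wpM2l ?cn_ge0//.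
rewrite (bigD1 i)//= lerDl sumr_ge0// => j _; exact: cn_ge0.
Qed.

Lemma omega_ge0 k x i : 0 <= omega k x i.
Proof. by rewrite /omega; case: ifP => // _; rewrite divr_ge0 ?sqr_ge0 ?sq_sum_ge0. Qed.

Lemma omega_le1 k x i : omega k x i <= 1.
Proof.
rewrite /omega; case: ifP => // _; have := sq_sum_ge0 x; rewrite le_eqVlt => /orP[/eqP <-|s0].
  by rewrite invr0 mulr0.
rewrite ler_pdivrMr// mul1r (bigD1 i)//= lerDl sumr_ge0// => j _; exact: sqr_ge0.
Qed.

(* Pigeonhole over the scales [et ^+ j * mx1 x] for [j <= N.+1]. *)
Lemma gap k (x : 'rV[C]_N) (et : R) : 0 < et -> et * N%:R <= 1 -> 0 < mx1 x ->
  exists2 S : {set 'I_N}, (0 < #|S|)%N & exists2 th : R, et ^+ N <= th <= 1 &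
    (forall i, i \in S -> Some i != k -> th * mx1 x <= cn (x 0 i)) /\
    (forall i, i \notin S -> cn (x 0 i) <= et * th * mx1 x).
Proof.
move=> et0 etN m0; have N0 : 0 < N%:R :> R by rewrite ltr0n.
have et1 : et <= 1.
  by rewrite (le_trans _ etN)// ler_peMr ?(ltW et0)// ler1n.
pose S j : {set 'I_N} := finset (fun i : 'I_N => (Some i == k) || (et ^+ j.+1 * mx1 x <= cn (x 0 i))).
have sub j : S j \subset S j.+1.
  apply/fintype.subsetP => i; rewrite !inE => /orP[->//|h]; apply/orP; right.
  by rewrite (le_trans _ h)// ler_wpM2r ?(ltW m0)// [leLHS]exprS ler_piMl ?exprn_ge0 ?(ltW et0).
have S0 : (0 < #|S 0%N|)%N.
  have [j hj] := mx1_max x; apply/card_gt0P; exists j; rewrite inE expr1; apply/orP; right.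
  rewrite -(ler_pM2l N0) (le_trans _ hj)// mulrA [N%:R * _]mulrC ler_piMl ?(ltW m0)//.
have [j Sj] : exists j : 'I_N, S j = S j.+1.
  apply: contrapT => h; have Slt j : (j <= N)%N -> (j < #|S j|)%N.
    elim: j => [//|j IH] jN; rewrite (leq_ltn_trans (IH (ltnW jN)))// proper_card// finset.properEneq sub andbT.
    by apply/eqP => E; apply: h; exists (Ordinal jN).
  have := leq_trans (Slt N (leqnn N)) (max_card _); by rewrite card_ord ltnn.
have Spos : (0 < #|S j|)%N.
  rewrite (leq_trans S0)// subset_leq_card//.
  elim: (nat_of_ord j) => [|l IH]; first exact: fintype.subxx.
  exact: fintype.subset_trans IH (sub l).
exists (S j) => //; exists (et ^+ j.+1).
  by rewrite exprn_ile1 ?(ltW et0)// andbT ler_wiXn2l ?(ltW et0).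
split=> i; first by rewrite inE => /orP[->//|].
by rewrite Sj inE negb_or -ltNge exprS => /andP[_ /ltW].
Qed.

(** This is where the principal minors enter. On the set [S] given by [gap] the coordinates outside
    are negligible, so [x *m D] restricted to [S] is nearly [x_S D_S]; the block is invertible,
    hence some entry in [S] is large, and its weight is bounded below by the gap. *)
Lemma omega_lower (D : 'M[C]_N) :
  (forall S : {set 'I_N}, (0 < #|S|)%N -> principal_minor D S != 0) ->
  exists2 c : R, 0 < c & forall k (x : 'rV[C]_N),
    c * mx1 x ^+ 2 <= \sum_i omega k x i * cn ((x *m D) 0 i) ^+ 2.
Proof.
move=> /principal_bound[mu mu0 hmu]; pose K := mx1 D + 1.
have N0 : 0 < N%:R :> R by rewrite ltr0n.
have K0 : 0 < K by rewrite ltr_wpDl// mx1_ge0.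
(* The first bound leaves at least half of [mx1 x] on [S]; the second keeps the influence of the
   other coordinates on [x *m D] below half of what the block on [S] guarantees. *)
pose et := Num.min (2 * N%:R)^-1 (mu / (4 * K)).
have et0 : 0 < et by rewrite lt_min invr_gt0 divr_gt0 ?mulr_gt0.
have et1 : et * N%:R <= 1 / 2.
  rewrite -ler_pdivlMr// (@le_trans _ _ (2 * N%:R)^-1) ?ge_min ?lexx//.
  by rewrite invfM mul1r.
have et2 : et * K <= mu / 4.
  rewrite -ler_pdivlMr// (@le_trans _ _ (mu / (4 * K))) ?ge_min ?lexx ?orbT//.
  by rewrite invfM mulrA.
pose c := et ^+ N * (mu / (4 * N%:R)).
have c0 : 0 < c by rewrite mulr_gt0 ?exprn_gt0// divr_gt0// mulr_gt0.
exists (c ^+ 2); first by rewrite exprn_gt0.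
move=> k x; have := mx1_ge0 x; rewrite le_eqVlt => /orP[/eqP <-|m0].
  rewrite expr0n mulr0 sumr_ge0// => i _; by rewrite mulr_ge0 ?omega_ge0 ?sqr_ge0.
have etN : et * N%:R <= 1 by rewrite (le_trans et1)// ler_pdivrMr// mul1r ler1n.
have [S S0 [th /andP[th0 th1] [hin hout]]] := gap k et0 etN m0.
have thp : 0 < th by rewrite (lt_le_trans _ th0)// exprn_gt0.
have out_le : \sum_(i in ~: S) cn (x 0 i) <= mx1 x / 2.
  rewrite (@le_trans _ _ (\sum_(i < N) (et * mx1 x)))//.
    rewrite big_mkcond ler_sum// => i _; rewrite inE; case: ifP => iS; last by rewrite mulr_ge0// ltW.
    by rewrite (le_trans (hout _ iS))// ler_wpM2r ?(ltW m0)// ler_piMr// ltW.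
  rewrite sumr_const card_ord -[_ *+ _]mulr_natr mulrAC [mx1 x / 2]mulrC ler_wpM2r ?(ltW m0)//.
  by rewrite -[2^-1]mul1r.
have split1 (F : 'I_N -> R) : \sum_i F i = \sum_(i in S) F i + \sum_(i in ~: S) F i.
  rewrite (bigID (mem S)) /=; congr (_ + _); apply: eq_bigl => i; by rewrite inE.
have in_ge : mx1 x / 2 <= \sum_(i in S) cn (x 0 i).
  have : mx1 x = \sum_(i in S) cn (x 0 i) + \sum_(i in ~: S) cn (x 0 i) by rewrite mx1_row split1.
  by move: out_le; clear; lra.
have big : mu * mx1 x / 4 <= \sum_(i in S) cn ((x *m D) 0 i).
  have h1 := hmu S (fun i => x 0 i) S0.
  have h2 : \sum_(i in S) cn (\sum_(j in S) x 0 j * D j i) <=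
      \sum_(i in S) cn ((x *m D) 0 i) + \sum_(i in S) cn (\sum_(j in ~: S) x 0 j * D j i).
    rewrite -big_split ler_sum// => i _ /=.
    have E : (x *m D) 0 i = \sum_(j in S) x 0 j * D j i + \sum_(j in ~: S) x 0 j * D j i.
      by rewrite mxE (bigID (mem S)) /=; congr (_ + _); apply: eq_bigl => j; rewrite inE.
    by rewrite E -[X in cn X <= _](addrK (\sum_(j in ~: S) x 0 j * D j i)) cnB.
  have h3 : \sum_(i in S) cn (\sum_(j in ~: S) x 0 j * D j i) <= et * mx1 x * K.
    rewrite (@le_trans _ _ (\sum_i \sum_j et * mx1 x * cn (D j i)))//.
      rewrite big_mkcond ler_sum// => i _; case: ifP => _; last first.
        by rewrite sumr_ge0// => j _; rewrite !mulr_ge0 ?cn_ge0// ltW.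
      rewrite (le_trans (cn_sum _ _ _))// big_mkcond ler_sum// => j _.
      rewrite inE; case: ifP => jS; last by rewrite !mulr_ge0 ?cn_ge0// ltW.
      rewrite cnM ler_wpM2r ?cn_ge0// (le_trans (hout _ jS))// ler_wpM2r ?(ltW m0)//.
      by rewrite ler_piMr// ltW.
    rewrite exchange_big /=; under eq_bigr do rewrite -mulr_sumr.
    by rewrite -mulr_sumr ler_wpM2l ?mulr_ge0 ?(ltW m0) ?(ltW et0)// lerDl.
  have h4 : et * mx1 x * K <= mu * mx1 x / 4.
    by rewrite mulrAC [mu * _ / 4]mulrAC ler_wpM2r// ltW.
  have h5 : mu * mx1 x / 2 <= mu * \sum_(i in S) cn (x 0 i).
    by rewrite -mulrA ler_wpM2l// ltW.
  move: h1 h2 h3 h4 h5; clear; lra.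
have [i iS hi] : exists2 i, i \in S & mu / (4 * N%:R) * mx1 x <= cn ((x *m D) 0 i).
  apply: contrapT => h; have : \sum_(i in S) cn ((x *m D) 0 i) < mu * mx1 x / 4.
    have [i0 i0S] := card_gt0P S0.
    have lt i : i \in S -> cn ((x *m D) 0 i) < mu / (4 * N%:R) * mx1 x.
      by move=> iS; rewrite ltNge; apply/negP => hi; apply: h; exists i.
    rewrite (@lt_le_trans _ _ (\sum_(i in S) mu / (4 * N%:R) * mx1 x))//.
      rewrite (bigD1 i0)//= [ltRHS](bigD1 i0)//= ltr_leD ?lt// ler_sum// => i /andP[iS _]; exact: ltW (lt i iS).
    rewrite sumr_const -[leLHS]mulr_natr (@le_trans _ _ (mu / (4 * N%:R) * mx1 x * N%:R))//.
      rewrite ler_wpM2l ?mulr_ge0 ?invr_ge0 ?(ltW m0) ?(ltW mu0)// ler_nat.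
      by rewrite -[leqRHS]card_ord max_card.
    by rewrite le_eqVlt; apply/orP; left; apply/eqP; field; rewrite lt0r_neq0.
  by rewrite ltNge big.
rewrite (bigD1 i)//= (@le_trans _ _ (omega k x i * cn ((x *m D) 0 i) ^+ 2))//; last first.
  by rewrite lerDl sumr_ge0// => j _; rewrite mulr_ge0 ?omega_ge0 ?sqr_ge0.
have -> : c ^+ 2 * mx1 x ^+ 2 = (et ^+ N) ^+ 2 * (mu / (4 * N%:R) * mx1 x) ^+ 2.
  by rewrite /c !exprMn; ring.
apply: ler_pM; rewrite ?sqr_ge0//; last first.
  by rewrite ler_pXn2r ?nnegrE ?cn_ge0// mulr_ge0 ?(ltW m0)// divr_ge0 ?(ltW mu0)// mulr_ge0// ltW.
rewrite /omega; case: eqVneq => [_|ik].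
  by rewrite exprn_ile1 ?exprn_ge0 ?(ltW et0)// exprn_ile1 ?(ltW et0)// (le_trans _ etN)// ler_peMr ?(ltW et0)// ler1n.
have sp : 0 < \sum_j cn (x 0 j) ^+ 2.
  have [j hj] := mx1_max x; rewrite (bigD1 j)//= ltr_wpDr ?sumr_ge0//.
    by move=> l _; exact: sqr_ge0.
  rewrite exprn_gt0//; have := lt_le_trans m0 hj; by rewrite pmulr_rgt0.
rewrite ler_pdivlMr// (@le_trans _ _ (th ^+ 2 * mx1 x ^+ 2))//.
  by rewrite ler_pM ?sqr_ge0 ?sq_sum_ge0 ?sq_sum_le// ler_pXn2r ?nnegrE ?exprn_ge0 ?(ltW et0) ?(ltW thp).
by rewrite -exprMn ler_pXn2r ?nnegrE ?mulr_ge0 ?cn_ge0 ?(ltW thp) ?(ltW m0)// hin.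
Qed.

Definition push (D : 'M[C]_N) k (x : 'rV[C]_N) : 'rV[C]_N :=
  \row_i ((omega k x i)%:C * ((x *m D) 0 i)^*).

Lemma bil_row (D : 'M[C]_N) x y : bil D x y = \sum_i (x *m D) 0 i * y 0 i.
Proof. by rewrite /bil mxE; apply: eq_bigr => i _; rewrite [y^T _ _]mxE. Qed.

Lemma push_bound D k x : mx1 (push D k x) <= mx1 x * mx1 D.
Proof.
rewrite (le_trans _ (mx1_mul _ _))// !mx1_row ler_sum// => i _.
by rewrite mxE cnM cn_conj cnR ger0_norm ?omega_ge0// ler_piMl ?cn_ge0 ?omega_le1.
Qed.

Lemma Re_bil_push D k x : Re (bil D x (push D k x)) = \sum_i omega k x i * cn ((x *m D) 0 i) ^+ 2.
Proof.
rewrite bil_row Re_sum; apply: eq_bigr => i _; rewrite [push _ _ _ _ _]mxE mulrCA mulCconj.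
by rewrite -rmorphM.
Qed.

Lemma bil_line (D : 'M[C]_N) x y (s : R) : D^T = D ->
  Re (bil D (x + s%:C *: y) (x + s%:C *: y)) =
  Re (bil D x x) + 2 * s * Re (bil D x y) + s ^+ 2 * Re (bil D y y).
Proof.
move=> sD; rewrite bilDl !bilDr !bilZl !bilZr (bilC y x sD) !ReD.
rewrite !(mulrC s%:C) !ReMR; ring.
Qed.

(** The quadratic term uses up at most half of the guaranteed linear gain. In the second conclusion
    the form is merely nonnegative at [D'] before the push, and half of the gain pays for replacing
    [D'] by any [D''] of the ball. *)
Lemma push_increases (D : 'M[C]_N) :
  (forall S : {set 'I_N}, (0 < #|S|)%N -> principal_minor D S != 0) ->
  exists tau : R, exists2 c : R, 0 < tau /\ 0 < c & exists2 rho : R, 0 < rho &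
    forall k (x : 'rV[C]_N) (D' : 'M[C]_N), D'^T = D' -> mx1 (D' - D) <= rho ->
    (forall s, 0 <= s <= 1 -> Re (bil D' x x) + s * (c * mx1 x ^+ 2) <=
       Re (bil D' (x + s%:C *: (tau%:C *: push D k x)) (x + s%:C *: (tau%:C *: push D k x)))) /\
    (forall D'' : 'M[C]_N, mx1 (D'' - D) <= rho -> 0 <= Re (bil D' x x) ->
       c / 2 * mx1 x ^+ 2 <= Re (bil D'' (x + tau%:C *: push D k x) (x + tau%:C *: push D k x))).
Proof.
move=> /omega_lower[c0 c00 hc0]; pose K := mx1 D + 1.
have K0 : 0 < K by rewrite ltr_wpDl// mx1_ge0.
pose tau := c0 / (2 * K ^+ 3).
have tau0 : 0 < tau by rewrite divr_gt0// mulr_gt0// exprn_gt0.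
have tauE : tau * K ^+ 3 = c0 / 2 by rewrite /tau; field; rewrite lt0r_neq0.
pose c := tau * c0 / 2.
have cp : 0 < c by rewrite divr_gt0// mulr_gt0.
pose Q := (1 + tau * K) ^+ 2.
have Q0 : 0 < Q by rewrite exprn_gt0// addr_gt0// mulr_gt0.
(* The three bounds keep [mx1 D' <= K], cost at most half of [c0] on passing from [D] to [D'], and
   at most half of [c] on passing from [D'] to [D'']. *)
pose rho := Num.min 1 (Num.min (c0 / (2 * K)) (c / (4 * Q))).
exists tau, c => //; exists rho.
  by rewrite !lt_min ltr01 (divr_gt0 c00) ?(divr_gt0 cp)// mulr_gt0.
have rho1 : rho <= 1 by rewrite ge_min lexx.
have rho2 : rho * K <= c0 / 2.
  rewrite -ler_pdivlMr// (@le_trans _ _ (c0 / (2 * K))) ?ge_min ?lexx ?orbT//.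
  by rewrite invfM mulrA.
have rho3 : 2 * rho * Q <= c / 2.
  rewrite -ler_pdivlMr// -ler_pdivlMl// (@le_trans _ _ (c / (4 * Q))) ?ge_min ?lexx ?orbT//.
  rewrite le_eqVlt; apply/orP; left; apply/eqP; field; exact: lt0r_neq0.
move=> k x D' sD' hD'; set m := mx1 x; set y := push D k x.
have m0 : 0 <= m by exact: mx1_ge0.
have D'K : mx1 D' <= K.
  by rewrite -(subrK D D') (le_trans (mx1D _ _))// addrC lerD// (le_trans hD').
have yb : mx1 y <= K * m.
  by rewrite (le_trans (push_bound D k x))// mulrC ler_wpM2r// /K lerDl.
have h1 : c0 / 2 * m ^+ 2 <= Re (bil D' x y).
  have -> : bil D' x y = bil D x y + bil (D' - D) x y by rewrite -bilDw addrC subrK.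
  rewrite ReD Re_bil_push; have e1 := hc0 k x; rewrite -/m in e1.
  have e2 : cn (bil (D' - D) x y) <= rho * m * (K * m).
    by rewrite (le_trans (bil_bound _ _ _))// !ler_pM ?mulr_ge0 ?mx1_ge0.
  have e3 : rho * m * (K * m) <= c0 / 2 * m ^+ 2.
    by rewrite (_ : _ * (K * m) = rho * K * m ^+ 2) ?ler_wpM2r ?sqr_ge0//; ring.
  have := le_trans (Re_le_cn _) (le_trans e2 e3); rewrite ler_norml => /andP[+ _].
  by move: e1; clear; move: (\sum_i _) (complex.Re _) (m ^+ 2) => u v q; lra.
have h2 : - (K ^+ 3 * m ^+ 2) <= Re (bil D' y y).
  have e2 : cn (bil D' y y) <= K * (K * m) * (K * m).
    by rewrite (le_trans (bil_bound _ _ _))// !ler_pM ?mulr_ge0 ?mx1_ge0.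
  have := le_trans (Re_le_cn _) e2; rewrite ler_norml => /andP[+ _].
  by rewrite (_ : K * (K * m) * (K * m) = K ^+ 3 * m ^+ 2)//; ring.
have main s : 0 <= s <= 1 -> Re (bil D' x x) + s * (c * m ^+ 2) <=
    Re (bil D' (x + s%:C *: (tau%:C *: y)) (x + s%:C *: (tau%:C *: y))).
  move=> /andP[s0 s1]; rewrite scalerA -rmorphM bil_line//.
  have e1 : 2 * (s * tau) * (c0 / 2 * m ^+ 2) <= 2 * (s * tau) * Re (bil D' x y).
    by rewrite ler_wpM2l// mulr_ge0// mulr_ge0 ?(ltW tau0).
  have e2 : (s * tau) ^+ 2 * - (K ^+ 3 * m ^+ 2) <= (s * tau) ^+ 2 * Re (bil D' y y).
    by rewrite ler_wpM2l// sqr_ge0.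
  have e3 : (s * tau) ^+ 2 * (K ^+ 3 * m ^+ 2) <= s * tau * (c0 / 2 * m ^+ 2).
    have -> : (s * tau) ^+ 2 * (K ^+ 3 * m ^+ 2) = s * (s * tau * (tau * K ^+ 3 * m ^+ 2)) by ring.
    have c20 : 0 <= c0 / 2 by rewrite divr_ge0// ltW.
    rewrite tauE; apply: ler_piMl => //; apply: mulr_ge0; apply: mulr_ge0; rewrite ?sqr_ge0//; exact: ltW.
  have -> : s * (c * m ^+ 2) = s * tau * (c0 / 2 * m ^+ 2) by rewrite /c; ring.
  move: e1 e2 e3; clear; rewrite mulrN.
  move: (complex.Re (bil D' x x)) => r0; move: (2 * (s * tau) * complex.Re _) => r1.
  move: ((s * tau) ^+ 2 * complex.Re _) => r2; move: ((s * tau) ^+ 2 * _) => r3.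
  rewrite -[2 * (s * tau) * _]mulrA.
  move: (s * tau * _) => r4; lra.
split; first exact: main.
move=> D'' hD'' pos.
have x'b : mx1 (x + tau%:C *: y) <= (1 + tau * K) * m.
  rewrite (le_trans (mx1D _ _))// mx1Z cnR gtr0_norm// mulrDl mul1r lerD2l -mulrA ler_wpM2l// ltW//.
have e1 : c * m ^+ 2 <= Re (bil D' (x + tau%:C *: y) (x + tau%:C *: y)).
  have := main 1; rewrite ler01 lexx => /(_ isT); rewrite scale1r mul1r.
  by apply: le_trans; rewrite lerDr.
have E : bil D'' (x + tau%:C *: y) (x + tau%:C *: y) = bil D' (x + tau%:C *: y) (x + tau%:C *: y)
    + bil (D'' - D') (x + tau%:C *: y) (x + tau%:C *: y) by rewrite -{1}(subrK D' D'') (bilDw (D'' - D') D') [LHS]addrC.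
have e2 : cn (bil (D'' - D') (x + tau%:C *: y) (x + tau%:C *: y)) <= c / 2 * m ^+ 2.
  have d2 : mx1 (D'' - D') <= 2 * rho.
    by rewrite (le_trans (mx1_tri D _ _))// mulr2n mulrDl mul1r lerD// mx1B.
  rewrite (le_trans (bil_bound _ _ _))// (@le_trans _ _ (2 * rho * ((1 + tau * K) * m) * ((1 + tau * K) * m)))//.
    by rewrite !ler_pM ?mulr_ge0 ?mx1_ge0.
  rewrite (_ : _ * _ = 2 * rho * Q * m ^+ 2); last by rewrite /Q; ring.
  by rewrite ler_wpM2r ?sqr_ge0.
rewrite E ReD; have := le_trans (Re_le_cn _) e2; rewrite ler_norml => /andP[+ _].
by move: e1; clear; move: (complex.Re _) (complex.Re (bil (D'' - D') _ _)) (m ^+ 2) => u v q; lra.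
Qed.

Lemma sum_conjE (x : 'rV[C]_N) : \sum_j x 0 j * (x 0 j)^* = (\sum_j cn (x 0 j) ^+ 2)%:C.
Proof. by rewrite rmorph_sum; apply: eq_bigr => j _; rewrite mulCconj. Qed.

Lemma ucbv_push (D : 'M[C]_N) k (phi : 'rV[R]_N -> 'rV[C]_N) (c : R) : 0 < c -> ucbv phi ->
  (forall p, simp p -> c <= \sum_j cn (phi p 0 j) ^+ 2) -> ucbv (fun p => push D k (phi p)).
Proof.
move=> c0 uphi hc i.
pose om p : C := if Some i == k then 1 else
  phi p 0 i * (phi p 0 i)^* * (\sum_j phi p 0 j * (phi p 0 j)^*)^-1.
have uom : ucb om.
  rewrite /om; case: (Some i == k); first exact: ucb_cst.
  apply: ucbM; first by apply: ucbM; [|apply: ucb_conj]; exact: uphi.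
  apply: (ucbV c0).
    move=> p sp; rewrite sum_conjE cnR ger0_norm ?sq_sum_ge0//; exact: hc.
  by apply: ucb_sum => j; apply: ucbM; [|apply: ucb_conj]; exact: uphi.
apply: (@ucb_ext _ _ (fun p => om p * (\sum_l phi p 0 l * D l i)^*)).
  move=> p; rewrite mxE [(phi p *m D) 0 i]mxE; congr (_ * _); rewrite /om /omega.
  by case: (Some i == k) => //; rewrite mulCconj sum_conjE -fmorphV -rmorphM.
apply: ucbM => //; apply: ucb_conj; apply: ucb_sum => l; apply: ucbM; first exact: uphi.
exact: ucb_cst.
Qed.

(** The order of quantifiers is the point: [rho] comes before the chain and its margin [dl]. The two
    halves of [push_increases] give positivity along the straight line at [D'] and positivity of the
    new chain on the whole ball. *)
Theorem transport (D : 'M[C]_N) :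
  (forall S : {set 'I_N}, (0 < #|S|)%N -> principal_minor D S != 0) ->
  exists2 rho : R, 0 < rho & forall k (phi : bool -> 'rV[R]_N -> 'rV[C]_N) (D' : 'M[C]_N) (dl : R),
    sides k phi -> (forall b, ucbv (phi b)) -> D'^T = D' -> mx1 (D' - D) <= rho -> 0 < dl ->
    (forall b p, simp p -> dl <= Re (bil D' (phi b p) (phi b p))) ->
    exists phi', [/\ sides k phi', (forall b, ucbv (phi' b)),
      (forall s b p, 0 <= s <= 1 -> simp p ->
         dl <= Re (bil D' (lerp phi phi' s b p) (lerp phi phi' s b p))) &
      exists2 dl' : R, 0 < dl' & forall D'' : 'M[C]_N, mx1 (D'' - D) <= rho ->
        forall b p, simp p -> dl' <= Re (bil D'' (phi' b p) (phi' b p))].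
Proof.
move=> /push_increases[tau [c [tau0 c0] [rho rho0 H]]]; exists rho => //.
move=> k phi D' dl sphi uphi sD' hD' dl0 pos.
pose K := mx1 D' + 1; have K0 : 0 < K by rewrite ltr_wpDl// mx1_ge0.
(* The form is at most [K * mx1 x ^+ 2], so positivity keeps the chain away from the origin, where
   the weights [omega] are discontinuous. *)
have low b p : simp p -> dl / K <= mx1 (phi b p) ^+ 2.
  move=> sp; rewrite ler_pdivrMr// (le_trans (pos b p sp))// (le_trans (ler_norm _))//.
  rewrite (le_trans (Re_le_cn _))// (le_trans (bil_bound _ _ _))// -mulrA -expr2 mulrC.
  by rewrite ler_wpM2l ?sqr_ge0// /K lerDl.
exists (fun b p => phi b p + tau%:C *: push D k (phi b p)); split.
- split=> [b p j jk pj|p j jk pj]; last by rewrite (sphi.2 p j jk pj).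
  by rewrite !mxE /omega (negbTE jk) (sphi.1 b p j jk pj) cn0 expr0n mul0r mul0r mulr0 addr0.
- move=> b i; apply: (@ucb_ext _ _ (fun p => phi b p 0 i + tau%:C * push D k (phi b p) 0 i)).
    by move=> p; rewrite !mxE.
  apply: ucbD; first exact: uphi; apply: ucbM; first exact: ucb_cst.
  have NK0 : 0 < dl / K / N%:R ^+ 2 by rewrite !divr_gt0// exprn_gt0// ltr0n.
  apply: (@ucbv_push D k (phi b) _ NK0 (uphi b)) => p sp; rewrite ler_pdivrMr ?exprn_gt0 ?ltr0n// (le_trans (low b p sp))//.
  have [j hj] := mx1_max (phi b p).
  rewrite (@le_trans _ _ ((N%:R * cn (phi b p 0 j)) ^+ 2))//.
    by rewrite ler_pXn2r ?nnegrE ?mulr_ge0 ?mx1_ge0 ?cn_ge0 ?ler0n.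
  rewrite exprMn mulrC ler_wpM2r ?sqr_ge0// (bigD1 j)//= lerDl sumr_ge0// => l _; exact: sqr_ge0.
- move=> s b p s01 sp; have [h _] := H k (phi b p) D' sD' hD'.
  rewrite /lerp addrAC subrr add0r (le_trans (pos b p sp))// (le_trans _ (h s s01))// lerDl.
  by have /andP[s0 _] := s01; rewrite mulr_ge0// mulr_ge0 ?sqr_ge0 ?(ltW c0).
exists (c / 2 * (dl / K)); first by rewrite mulr_gt0// divr_gt0.
move=> D'' hD'' b p sp; have [_ h] := H k (phi b p) D' sD' hD'.
rewrite (le_trans _ (h D'' hD'' _))//; last by rewrite (le_trans (ltW dl0))// pos.
by rewrite ler_wpM2l ?low// divr_ge0// ltW.
Qed.

End Compress.

(** Connectedness of [[0, 1]]: the supremum of the times at which [P] holds would be passed unless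
    it were [1]. *)
Lemma interval_propagation (R : realType) (P : R -> Prop) :
  (forall t, 0 <= t <= 1 -> exists2 d : R, 0 < d & forall s s', 0 <= s <= 1 -> 0 <= s' <= 1 ->
     `|s - t| < d -> `|s' - t| < d -> P s -> P s') -> P 0 -> P 1.
Proof.
move=> loc P0; pose S := [set t | 0 <= t <= 1 /\ P t].
have S0 : S 0 by split=> //; rewrite lexx ler01.
have hS : has_sup S by split; [exists 0|exists 1 => t [/andP[]]].
have u0 : 0 <= sup S by apply: (ub_le_sup hS.2).
have u1 : sup S <= 1 by apply: ge_sup; [exists 0|move=> t [/andP[]]].
have [d d0 hd] : exists2 d : R, 0 < d & forall s s', 0 <= s <= 1 -> 0 <= s' <= 1 ->
     `|s - sup S| < d -> `|s' - sup S| < d -> P s -> P s' by apply: loc; rewrite u0 u1.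
have [s [s01 Ps] us] := sup_adherent d0 hS.
have su : s <= sup S by apply: (ub_le_sup hS.2).
pose s' := Num.min 1 (sup S + d / 2).
have s'u : sup S <= s' by rewrite /s' le_min u1 lerDl divr_ge0// ltW.
have s'd : s' <= sup S + d / 2 by rewrite /s' ge_min lexx orbT.
have s'01 : 0 <= s' <= 1 by rewrite (le_trans u0)//= /s' ge_min lexx.
have Ps' : P s'.
  apply: (hd s) => //; first by rewrite ler0_norm ?subr_le0//; move: us; clear; lra.
  by rewrite ger0_norm ?subr_ge0//; move: s'd d0; clear; lra.
have : s' <= sup S by apply: (ub_le_sup hS.2).
rewrite {1}/s' ge_min => /orP[le1|].
  suff <- : s' = 1 by []; apply/eqP; rewrite eq_le; have /andP[_ ->] := s'01.
  by rewrite (le_trans le1).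
by move=> h; exfalso; move: h d0; clear; lra.
Qed.

(** * Propagation of a chain representation along a path *)

Section Path.
Variables (R : realType) (n : nat).
Local Notation C := R[i].
Local Notation N := n.+1.
Local Notation Re := (@complex.Re R).

(** Holomorphy along complex lines through points of [Gmat], the form in which the identity theorem
    is applied. *)
Definition hol_near (h : 'M[C]_N -> C) (D : 'M[C]_N) (r : R) :=
  forall A B z, Gmat A -> Gmat B -> mx1 (A + z *: (B - A) - D) < r ->
    cdiff (fun z => h (A + z *: (B - A))) z.

(** Positivity is asked at [D] only, while the formula holds on a neighbourhood with [m0] chosen
    before [w], so that for fixed [m] both sides can be compared as functions of [w]. *)
Definition represents (I : finType) (k : I -> option 'I_N) (c : I -> C) (a : C)
    (h : 'M[C]_N -> C) (D : 'M[C]_N) :=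
  exists phi : I -> bool -> 'rV[R]_N -> 'rV[C]_N,
    [/\ forall i, sides (k i) (phi i), forall i b, ucbv (phi i b),
        exists2 dl : R, 0 < dl & forall i b p, simp p -> dl <= Re (bil D (phi i b p) (phi i b p)) &
        exists2 r : R, 0 < r & exists m0, forall m, (m0 <= m)%N -> forall w, Gmat w ->
          mx1 (w - D) < r -> h w = a * \det w * (\sum_i c i * chain_int (k i) (phi i) m w) ^+ 2].

Definition continues (gam : R -> 'M[C]_N) (h : R -> 'M[C]_N -> C) :=
  forall t, 0 <= t <= 1 -> exists2 r : R, 0 < r & hol_near (h t) (gam t) r /\
    forall s, 0 <= s <= 1 -> `|s - t| < r -> exists2 r' : R, 0 < r' &
      forall w, Gmat w -> mx1 (w - gam s) < r' -> h s w = h t w.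

Lemma Gmat_line (A B : 'M[C]_N) z : Gmat A -> Gmat B -> Gmat (A + z *: (B - A)).
Proof.
move=> [sA dA] [sB dB]; split; first by rewrite linearD linearZ linearB /= sA sB.
by move=> i; rewrite !mxE dA dB subrr mulr0 addr0.
Qed.

Lemma represents_ext (I : finType) (k : I -> option 'I_N) c a h h' D r : 0 < r ->
  (forall w, Gmat w -> mx1 (w - D) < r -> h w = h' w) ->
  represents k c a h D -> represents k c a h' D.
Proof.
move=> r0 hh [phi [h1 h2 h3 [r' r'0 [m0 h4]]]]; exists phi; split=> //.
exists (Num.min r r'); first by rewrite lt_min r0.
exists m0 => m mm w Gw; rewrite lt_min => /andP[w1 w2].
by rewrite -hh// (h4 m).
Qed.

Lemma fin_min (I : finType) (P : I -> R -> Prop) :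
  (forall i (x y : R), 0 < x -> x <= y -> P i y -> P i x) ->
  (forall i, exists2 x : R, 0 < x & P i x) -> exists2 x : R, 0 < x & forall i, P i x.
Proof.
move=> mono h; have /choice[x hx] : forall i, exists x : R, 0 < x /\ P i x.
  by move=> i; have [x x0 Px] := h i; exists x.
have m0 : 0 < \big[Num.min/1]_i x i.
  by elim/big_ind: _ => // [u v u0 v0|i _]; [rewrite lt_min u0|have [] := hx i].
exists (\big[Num.min/1]_i x i) => // i; have [_] := hx i; apply: mono => //.
exact: bigmin_le_cond.
Qed.

Lemma fin_max (I : finType) (P : I -> nat -> Prop) :
  (forall i, exists m0, forall m, (m0 <= m)%N -> P i m) ->
  exists m0, forall m, (m0 <= m)%N -> forall i, P i m.
Proof.
move=> /choice[m0 h]; exists (\max_i m0 i) => m hm i; apply: h.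
by apply: leq_trans hm; exact: leq_bigmax.
Qed.

(** The radius comes from [transport] and [hol_near], before any chain is given. Old and new chain
    have equal integrals only near [D1]; both sides being holomorphic on the line from [D1] to [w],
    the formula with the new chain reaches [w]. *)
Theorem represents_local (I : finType) (k : I -> option 'I_N) c a (h : 'M[C]_N -> C) (D : 'M[C]_N) (r0 : R) :
  (forall S : {set 'I_N}, (0 < #|S|)%N -> principal_minor D S != 0) -> 0 < r0 -> hol_near h D r0 ->
  exists2 r : R, 0 < r & forall D1 D2, Gmat D1 -> Gmat D2 -> mx1 (D1 - D) < r -> mx1 (D2 - D) < r ->
    represents k c a h D1 -> represents k c a h D2.
Proof.
move=> /transport[rT rT0 hT] r00 hol; pose r1 := Num.min r0 rT.
have r10 : 0 < r1 by rewrite lt_min r00.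
(* A matrix [w] near [D2] is within [3 r] of [D1], so the points of the line with [cn z < 4] are
   within [r + 12 r = 13 r] of [D]. *)
pose r := r1 / 14%:R; have rp : 0 < r by rewrite divr_gt0.
have rE : r1 = 14%:R * r by rewrite /r mulrC divfK.
have r1T : r1 <= rT by rewrite ge_min lexx orbT.
have r1r0 : r1 <= r0 by rewrite ge_min lexx.
have rT1 : r <= rT by move: rE r1T rp; clear; lra.
exists r => // D1 D2 G1 G2 d1 d2 [phi [sphi uphi [dl dl0 pos] [r2 r20 [m1 hm1]]]].
have /choice[psi hpsi] : forall i, exists psi, [/\ sides (k i) psi, (forall b, ucbv (psi b)),
      (forall s b p, 0 <= s <= 1 -> simp p ->
         dl <= Re (bil D1 (lerp (phi i) psi s b p) (lerp (phi i) psi s b p))) &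
      exists2 dl' : R, 0 < dl' & forall D'' : 'M[C]_N, mx1 (D'' - D) <= rT ->
        forall b p, simp p -> dl' <= Re (bil D'' (psi b p) (psi b p))].
  move=> i; apply: (hT (k i) (phi i) D1 dl) => //; first by case: G1.
  - by rewrite (le_trans (ltW d1)).
  - by move=> b p; exact: pos.
have [dl' dl'0 pos'] : exists2 x : R, 0 < x & forall i, forall D'' : 'M[C]_N, mx1 (D'' - D) <= rT ->
        forall b p, simp p -> x <= Re (bil D'' (psi i b p) (psi i b p)).
  apply: fin_min => [i x y _ xy H D'' hD b p sp|i]; first by rewrite (le_trans xy)// H.
  by have [_ _ _] := hpsi i.
have [et et0 homo] : exists2 x : R, 0 < x & forall i, exists m0, forall m, (m0 <= m)%N -> forall w, w^T = w ->
    mx1 (w - D1) <= x -> chain_int (k i) (phi i) m w = chain_int (k i) (psi i) m w.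
  apply: fin_min => [i x y _ xy [m0 H]|i].
    by exists m0 => m mm w sw wD; apply: H => //; exact: le_trans wD xy.
  have [s1 u1 l1 _] := hpsi i; exact: (homotopy_line (sphi i) s1 (uphi i) u1 dl0 (l1)).
have [m2 homo2] := fin_max homo.
pose K := mx1 D + rT; have K0 : 0 <= K by rewrite addr_ge0 ?mx1_ge0 ?(ltW rT0).
have /fin_max[m3 hdiff] : forall i, exists m0, forall m, (m0 <= m)%N -> forall w0 w1 z,
    mx1 (w0 + z *: w1) <= K ->
    (forall b p, simp p -> dl' <= Re (bil (w0 + z *: w1) (psi i b p) (psi i b p))) ->
    cdiff (fun z => chain_int (k i) (psi i) m (w0 + z *: w1)) z.
  by move=> i; have [_ u1 _ _] := hpsi i; exact: (chain_int_cdiff (k i) K0 dl'0 u1).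
exists psi; split.
- by move=> i; have [] := hpsi i.
- by move=> i; have [] := hpsi i.
- by exists dl' => // i b p sp; apply: pos' => //; rewrite (le_trans (ltW d2)).
exists r => //; exists (maxn m1 (maxn m2 m3)) => m; rewrite !geq_max => /and3P[mm1 mm2 mm3] w Gw wD2.
have wD1 : mx1 (w - D1) < 3 * r.
  have := mx1_tri D2 w D1; have := mx1_tri D D2 D1; have := mx1B D1 D; move: wD2 d1 d2; clear.
  move: (mx1 _) (mx1 (D1 - D)) (mx1 (D2 - D)) (mx1 (D - D1)) (mx1 (D2 - D1)) (mx1 (w - D1)) => x1 x2 x3 x4 x5 x6; lra.
pose L z := D1 + z *: (w - D1).
pose F z := h (L z) - a * \det (L z) * (\sum_i c i * chain_int (k i) (psi i) m (L z)) ^+ 2.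
have L1 : L 1 = w by rewrite /L scale1r addrC subrK.
suff : F 1 = 0 by rewrite /F L1 => /eqP; rewrite subr_eq0 => /eqP.
have inball z : cn z < 4 -> mx1 (L z - D) < r1.
  move=> z4; rewrite rE /L addrAC (le_lt_trans (mx1D _ _))// mx1Z.
  have : cn z * mx1 (w - D1) <= 4 * (3 * r).
    by rewrite ler_pM ?cn_ge0 ?mx1_ge0 ?ltW.
  move: d1 rp; clear; move: (mx1 _) (cn z * _) => x1 x2; lra.
apply: (@real_identity R F (Num.min et r2 / (3 * r)) _ _ _ 1).
- move=> z z4; have Lb := inball z z4.
  have LT : mx1 (L z - D) <= rT by rewrite (le_trans (ltW Lb)).
  apply: cdiffB; first by apply: hol => //; exact: lt_le_trans Lb r1r0.
  apply: cdiffM; first by apply: cdiffM; [exact: cdiff_cst|exact: det_cdiff].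
  apply: cdiffX; apply: cdiff_sum => i; apply: cdiffM; first exact: cdiff_cst.
  apply: (hdiff m mm3 i); last by move=> b p sp; exact: pos'.
  by rewrite -/(L z) -(subrK D (L z)) (le_trans (mx1D _ _))// addrC lerD.
- by rewrite divr_gt0 ?mulr_gt0// lt_min et0.
(* For small real [x] the point is close enough to [D1] for both the given formula and the
   homotopy. *)
- move=> x xlt; have GL : Gmat (L x%:C) by exact: Gmat_line.
  have LD1 : mx1 (L x%:C - D1) < Num.min et r2.
    rewrite /L addrAC subrr add0r mx1Z cnR.
    move: xlt; rewrite ltr_pdivlMr ?mulr_gt0//; apply: le_lt_trans.
    by rewrite ler_wpM2l// ltW.
  move: LD1; rewrite lt_min => /andP[L2 L3].
  have E : \sum_i c i * chain_int (k i) (phi i) m (L x%:C) = \sum_i c i * chain_int (k i) (psi i) m (L x%:C).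
    have sL : (L x%:C)^T = L x%:C by case: GL.
    exact (eq_bigr _ (fun i _ => congr1 (fun y => c i * y) (homo2 m mm2 i _ sL (ltW L2)))).
  have := hm1 m mm1 _ GL L3; rewrite E => e.
  by rewrite /F e; exact: subrr.
- by rewrite cn1.
Qed.

Theorem represents_path (I : finType) (k : I -> option 'I_N) c a (gam : R -> 'M[C]_N) h :
  (forall t, 0 <= t <= 1 -> Gmat (gam t)) ->
  (forall t, 0 <= t <= 1 -> forall S : {set 'I_N}, (0 < #|S|)%N -> principal_minor (gam t) S != 0) ->
  (forall t, 0 <= t <= 1 -> forall e : R, 0 < e -> exists2 d : R, 0 < d &
     forall s, 0 <= s <= 1 -> `|s - t| < d -> mx1 (gam s - gam t) < e) ->
  continues gam h -> represents k c a (h 0) (gam 0) -> represents k c a (h 1) (gam 1).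
Proof.
move=> Gg mg cg ch; apply: (@interval_propagation R (fun t => represents k c a (h t) (gam t))) => t t01.
have [r r0 [hol glue]] := ch t t01.
have [r1 r10 loc] := represents_local k c a (mg t t01) r0 hol.
have [d d0 hd] := cg t t01 _ r10.
exists (Num.min d r); first by rewrite lt_min d0.
move=> s s' s01 s'01; rewrite !lt_min => /andP[sd sr] /andP[s'd s'r] rep.
have [r2 r20 e2] := glue s s01 sr; have [r3 r30 e3] := glue s' s'01 s'r.
apply: (represents_ext r30 (h := h t)); first by move=> w Gw wr; rewrite e3.
apply: (loc (gam s)) => //; [exact: Gg|exact: Gg|exact: hd|exact: hd|].
exact: (represents_ext r20 e2).
Qed.

End Path.

(** * Real forms *)

Section RealForms.
Variables (R : realType) (n : nat).
Local Notation C := R[i].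
Local Notation N := n.+1.
Local Notation Re := (@complex.Re R).
Local Notation Im := (@complex.Im R).
Implicit Types (S : 'M[R]_N) (x y : 'rV[C]_N).

Definition ReV x : 'rV[R]_N := map_mx Re x.
Definition ImV x : 'rV[R]_N := map_mx Im x.

Lemma Re_bil_real S x y :
  Re (bil (cplx_mx S) x y) = bil S (ReV x) (ReV y) - bil S (ImV x) (ImV y).
Proof.
rewrite !bilE Re_sum -sumrB; apply: eq_bigr => i _; rewrite Re_sum -sumrB; apply: eq_bigr => j _.
by rewrite !mxE !cReM cImM /=; ring.
Qed.

Lemma Im_bil_real S x y :
  Im (bil (cplx_mx S) x y) = bil S (ReV x) (ImV y) + bil S (ImV x) (ReV y).
Proof.
rewrite !bilE Im_sum -big_split; apply: eq_bigr => i _; rewrite Im_sum -big_split; apply: eq_bigr => j _ /=.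
by rewrite !mxE !cImM cReM /=; ring.
Qed.

Lemma gcoch_real (w u : 'M[C]_N) : Im (\det u) = 0 ->
  (forall i j, Im (bil w (row i u) (row j u)) = 0) -> Im (gcoch w u) = 0.
Proof.
move=> du bu; rewrite /gcoch cImM du mul0r addr0 J_real ?mulr0// => i j.
by rewrite bil_rows.
Qed.

Lemma chain_int_real k (phi : bool -> 'rV[R]_N -> 'rV[C]_N) m w :
  (forall b sg, in_simplex sg -> Im (gcoch w (app (phi b) sg)) = 0) -> Im (chain_int k phi m w) = 0.
Proof.
move=> h; have [r hr1 hr2] := chain_int_terms (lexx (mesh_ratio R n ^+ m)).
rewrite hr1 big_seq Im_sum big1// => x /hr2[ix _].
have signr (b : bool) : Im ((-1) ^+ b) = 0 by case: b; rewrite ?expr1 ?expr0 ?ImN /= ?oppr0.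
rewrite cImM signr mul0r addr0 Im_sum big1 ?mulr0// => b _.
rewrite cImM h// mulr0 add0r /cf; case: b; rewrite ?mul0r//.
by case: k => [?|]; rewrite ?ImN /= ?oppr0 ?mul0r.
Qed.

(** Isolates what the end point must supply, so that both geometries share the argument of
    [represents_real]. *)
Definition real_retract k (D : 'M[C]_N) :=
  forall (phi : bool -> 'rV[R]_N -> 'rV[C]_N) dl, sides k phi -> (forall b, ucbv (phi b)) -> 0 < dl ->
    (forall b p, simp p -> dl <= Re (bil D (phi b p) (phi b p))) ->
    exists psi, [/\ sides k psi, forall b, ucbv (psi b),
      forall s b p, 0 <= s <= 1 -> simp p ->
         dl <= Re (bil D (lerp phi psi s b p) (lerp phi psi s b p)) &
      forall b sg, in_simplex sg -> Im (gcoch D (app (psi b) sg)) = 0].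

Theorem represents_real (I : finType) (k : I -> option 'I_N) (c : I -> R) (a d : R) h D :
  0 <= a -> 0 <= d -> \det D = d%:C -> Gmat D -> (forall i, real_retract (k i) D) ->
  represents k (fun i => (c i)%:C) a%:C h D -> exists2 y : R, 0 <= y & h D = y%:C.
Proof.
move=> a0 d0 dD GD ret [phi [sphi uphi [dl dl0 pos] [r r0 [m1 hm1]]]].
have /fin_max[m2 hm2] : forall i, exists m0, forall m, (m0 <= m)%N -> Im (chain_int (k i) (phi i) m D) = 0.
  move=> i; have [psi [s1 u1 l1 re]] := ret i (phi i) dl (sphi i) (uphi i) dl0 (pos i).
  have [et et0 [m0 H]] := homotopy_line (sphi i) s1 (uphi i) u1 dl0 l1.
  exists m0 => m mm; rewrite (H m mm D); [exact: chain_int_real|by case: GD|].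
  by rewrite subrr /mx1 big1 ?ltW// => a' _; rewrite big1// => b' _; rewrite mxE cn0.
have DD : mx1 (D - D) < r.
  by rewrite subrr /mx1 big1// => a' _; rewrite big1// => b' _; rewrite mxE cn0.
have := hm1 _ (leq_maxl m1 m2) D GD DD.
have := hm2 _ (leq_maxr m1 m2); move: (maxn m1 m2) => m im.
set s := \sum_i _; have sE : s = (Re s)%:C.
  apply: C_eq => //=; rewrite Im_sum big1// => i _; by rewrite cImM im mulr0 /= mul0r addr0.
move=> ->; rewrite dD sE -rmorphM -rmorphXn -rmorphM.
by exists (a * d * Re s ^+ 2) => //; rewrite mulr_ge0 ?sqr_ge0// mulr_ge0.
Qed.

Lemma ucb_Re (f : 'rV[R]_N -> C) : ucb f -> ucb (fun p => (Re (f p))%:C).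
Proof.
move=> [uf [B hB]]; split; last by exists B => p sp; rewrite cnR (le_trans (Re_le_cn _))// hB.
move=> e e0; have [d d0 hd] := uf e e0; exists d => // p q sp sq pq.
by rewrite -rmorphB cnR -ReN -ReD (le_trans (Re_le_cn _))// hd.
Qed.

Lemma ucb_Im (f : 'rV[R]_N -> C) : ucb f -> ucb (fun p => (Im (f p))%:C).
Proof.
move=> [uf [B hB]]; split; last by exists B => p sp; rewrite cnR (le_trans (Im_le_cn _))// hB.
move=> e e0; have [d d0 hd] := uf e e0; exists d => // p q sp sq pq.
by rewrite -rmorphB cnR -ImN -ImD (le_trans (Im_le_cn _))// hd.
Qed.

Lemma det_cplx m (W : 'M[R]_m) : \det (cplx_mx W) = (\det W)%:C.
Proof. exact: (det_map_mx (real_complex R) W). Qed.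

Lemma ReV_lerp (phi psi : bool -> 'rV[R]_N -> 'rV[C]_N) s b p :
  ReV (lerp phi psi s b p) = ReV (phi b p) + s *: (ReV (psi b p) - ReV (phi b p)).
Proof. by apply/rowP => j; rewrite !mxE ReD mulrC ReMR ReD ReN mulrC. Qed.

Lemma ImV_lerp (phi psi : bool -> 'rV[R]_N -> 'rV[C]_N) s b p :
  ImV (lerp phi psi s b p) = ImV (phi b p) + s *: (ImV (psi b p) - ImV (phi b p)).
Proof. by apply/rowP => j; rewrite !mxE ImD mulrC ImMR ImD ImN mulrC. Qed.

Lemma row_app (f : 'rV[R]_N -> 'rV[C]_N) sg i : row i (app f sg) = f (row i sg).
Proof. by apply/rowP => c; rewrite !mxE. Qed.

Lemma bil0l S (y : 'rV[R]_N) : bil S 0 y = 0. Proof. by rewrite /bil !mul0mx mxE. Qed.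
Lemma bil0r S (y : 'rV[R]_N) : bil S y 0 = 0. Proof. by rewrite /bil trmx0 mulmx0 mxE. Qed.

(** The real part of the form is [S (Re x) - S (Im x)]: shrinking the imaginary part cannot lower
    it, and taking real parts keeps every coordinate hyperplane. *)
Lemma real_retract_definite S : S^T = S -> (forall X, 0 <= bil S X X) -> real_retract None (cplx_mx S).
Proof.
move=> sS pS phi dl sphi uphi dl0 pos; pose psi b p : 'rV[C]_N := map_mx (@cplx R) (ReV (phi b p)).
have RV b p : ReV (psi b p) = ReV (phi b p) by apply/rowP => j; rewrite !mxE.
have IV b p : ImV (psi b p) = 0 by apply/rowP => j; rewrite !mxE.
exists psi; split=> //.
- split=> // b p j jk pj; by rewrite !mxE (sphi.1 b p j jk pj).
- move=> b i; apply: (@ucb_ext _ _ (fun p => (Re (phi b p 0 i))%:C)); last exact/ucb_Re/uphi.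
  by move=> p; rewrite !mxE.
- move=> s b p /andP[s0 s1] sp; have := pos b p sp; rewrite !Re_bil_real ReV_lerp ImV_lerp RV IV.
  rewrite subrr scaler0 addr0 sub0r scalerN -{3 5}[ImV _]scale1r -scalerBl bilZl bilZr.
  have := pS (ImV (phi b p)); move: s0 s1; clear.
  move: (bil S (ReV _) _) (bil S (ImV _) _) => A B s0 s1 B0 h; rewrite (le_trans h)// lerD2l lerN2.
  have : (1 - s) * (1 - s) <= 1 by nra.
  by move=> /(ler_wpM2r B0); rewrite mul1r mulrA.
move=> b sg _; apply: gcoch_real.
  have -> : app (psi b) sg = cplx_mx (\matrix_(i, j) Re (phi b (row i sg) 0 j)).
    by apply/matrixP => i j; rewrite !mxE.
  by rewrite det_cplx.
by move=> i j; rewrite Im_bil_real !row_app !IV bil0l bil0r addr0.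
Qed.

(* The chain is pushed into the real form [R e_k + i e_k^perp], on which [S] is positive
   definite. *)
Lemma real_retract_lorentzian S (k : 'I_N) : ~~ odd n -> S^T = S -> S k k = 1 ->
  (forall X, bil S X (delta_mx 0 k) = 0 -> bil S X X <= 0) -> real_retract (Some k) (cplx_mx S).
Proof.
move=> en sS Skk nS phi dl sphi uphi dl0 pos; pose e : 'rV[R]_N := delta_mx 0 k.
have bil_e X : bil S X e = \sum_l X 0 l * S l k.
  rewrite bilE; apply: eq_bigr => l _; rewrite (bigD1 k)//= big1 ?addr0.
    by rewrite mxE !eqxx mulr1.
  by move=> j jk; rewrite mxE (negbTE jk) andbF mulr0.
have ee : bil S e e = 1.
  rewrite bil_e (bigD1 k)//= big1 ?addr0; first by rewrite mxE !eqxx mul1r.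
  by move=> j jk; rewrite mxE (negbTE jk) andbF mul0r.
pose al b p := bil S (ReV (phi b p)) e; pose be b p := bil S (ImV (phi b p)) e.
pose X' b p := ReV (phi b p) - al b p *: e; pose Y' b p := ImV (phi b p) - be b p *: e.
have X'e b p : bil S (X' b p) e = 0 by rewrite bilDl -scaleNr bilZl ee mulr1 subrr.
have Y'e b p : bil S (Y' b p) e = 0 by rewrite bilDl -scaleNr bilZl ee mulr1 subrr.
have sq a b X : bil S X e = 0 -> bil S (a *: e + b *: X) (a *: e + b *: X) = a ^+ 2 + b ^+ 2 * bil S X X.
  move=> Xe; rewrite bilDl !bilDr !bilZl !bilZr ee Xe (bilC _ _ sS) Xe; ring.
pose psi b p : 'rV[C]_N := \row_j ((al b p * e 0 j) +i* Y' b p 0 j).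
have RV b p : ReV (psi b p) = al b p *: e by apply/rowP => j; rewrite !mxE.
have IV b p : ImV (psi b p) = Y' b p by apply/rowP => j; rewrite !mxE.
exists psi; split.
(* For [j] other than [k], coordinate [j] of [psi] is [i] times the imaginary part of that of [phi]
   and vanishes with it. Coordinate [k] involves all the others through [al] and [be], so facet [k]
   can only be glued. *)
- split=> [b p j jk pj|p j jk pj].
    have jk' : (j == k) = false by apply/negbTE/eqP => E; rewrite E eqxx in jk.
    by rewrite !mxE jk' andbF !mulr0 subr0 (sphi.1 b p j jk pj).
  by rewrite /psi /Y' /al /be (sphi.2 p j jk pj).
- move=> b i; apply: (@ucb_ext _ _ (fun p =>
      (Re (\sum_l phi b p 0 l * (S l k)%:C))%:C * (e 0 i)%:C
      + (0 +i* 1) * ((Im (phi b p 0 i))%:C - (Im (\sum_l phi b p 0 l * (S l k)%:C))%:C * (e 0 i)%:C))).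
    move=> p; rewrite [psi b p 0 i]mxE.
    have aE : Re (\sum_l phi b p 0 l * (S l k)%:C) = al b p.
      by rewrite /al bil_e Re_sum; apply: eq_bigr => l _; rewrite ReMR mxE.
    have bE : Im (\sum_l phi b p 0 l * (S l k)%:C) = be b p.
      by rewrite /be bil_e Im_sum; apply: eq_bigr => l _; rewrite ImMR mxE.
    have yE : Y' b p 0 i = Im (phi b p 0 i) - be b p * e 0 i by rewrite !mxE.
    rewrite aE bE yE.
    by apply: C_eq; rewrite /=; ring.
  have uS : ucb (fun p => \sum_l phi b p 0 l * (S l k)%:C).
    by apply: ucb_sum => l; apply: ucbM; [exact: uphi|exact: ucb_cst].
  apply: ucbD; first by apply: ucbM; [exact: ucb_Re|exact: ucb_cst].
  apply: ucbM; first exact: ucb_cst.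
  apply: ucbD; first exact/ucb_Im/uphi.
  apply: (@ucb_ext _ _ (fun p => (-1) * ((Im (\sum_l phi b p 0 l * (S l k)%:C))%:C * (e 0 i)%:C))).
    by move=> p; rewrite mulN1r.
  by apply: ucbM; [exact: ucb_cst|apply: ucbM; [exact: ucb_Im|exact: ucb_cst]].
(* On the line the real part of the form is [A^2 + (1 - s)^2 Q - (1 - s)^2 B^2 - P] with [Q <= 0],
   so both terms that shrink are losses. *)
- move=> s b p /andP[s0 s1] sp; have := pos b p sp; rewrite !Re_bil_real ReV_lerp ImV_lerp RV IV.
  have E1 : ReV (phi b p) = al b p *: e + 1 *: X' b p by rewrite scale1r /X' addrC subrK.
  have E2 : ImV (phi b p) = be b p *: e + 1 *: Y' b p by rewrite scale1r /Y' addrC subrK.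
  have E3 : ReV (phi b p) + s *: (al b p *: e - ReV (phi b p)) = al b p *: e + (1 - s) *: X' b p.
    by rewrite /X'; apply/rowP => j; rewrite !mxE; ring.
  have E4 : ImV (phi b p) + s *: (Y' b p - ImV (phi b p)) = ((1 - s) * be b p) *: e + 1 *: Y' b p.
    by rewrite /Y'; apply/rowP => j; rewrite !mxE; ring.
  rewrite E3 E4 [in X in X -> _]E1 [in X in X -> _]E2 !sq//.
  have := nS (X' b p) (X'e b p); move: s0 s1; clear.
  move: (al b p) (be b p) (bil S (X' b p) _) (bil S (Y' b p) _) => A B Q P s0 s1 Q0.
  rewrite expr1n !mul1r => h; apply: (le_trans h); rewrite exprMn.
  have t1 : (1 - s) ^+ 2 <= 1 by nra.
  have := sqr_ge0 B; move: (B ^+ 2) (A ^+ 2) ((1 - s) ^+ 2) t1 => b2 a2 t t1 b20.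
  by nra.
move=> b sg _; apply: gcoch_real; last first.
  move=> i j; rewrite Im_bil_real !row_app !RV !IV !bilZl !bilZr.
  by rewrite (bilC _ _ sS) !Y'e !mulr0 addr0.
pose ii : C := 0 +i* 1.
pose W : 'M[R]_N := \matrix_(i, j) (al b (row i sg) *: e + Y' b (row i sg)) 0 j.
(* [T] fixes [e] and multiplies its [S]-orthogonal complement by [ii]. As [psi] is the real matrix
   [W] followed by [T], only [\det T] could spoil reality of the determinant. *)
pose T : 'M[C]_N := \matrix_(l, j) (ii *+ (l == j) + (1 - ii) * (S l k)%:C *+ (j == k)).
have uE : app (psi b) sg = cplx_mx W *m T.
  apply/matrixP => i j; set p := row i sg.
  have We : \sum_l W i l * S l k = al b p.
    have -> : \sum_l W i l * S l k = bil S (al b p *: e + Y' b p) e.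
      by rewrite bil_e; apply: eq_bigr => l _; rewrite [W i l]mxE.
    by rewrite bilDl bilZl ee mulr1 Y'e addr0.
  have -> : (cplx_mx W *m T) i j = ii * (W i j)%:C + (1 - ii) * (al b p)%:C *+ (j == k).
    rewrite [LHS]mxE -We rmorph_sum mulr_sumr -sumrMnl.
    rewrite [X in X + _](_ : _ = \sum_l (W i l)%:C * ii *+ (l == j)).
      rewrite -big_split; apply: eq_bigr => l _ /=; rewrite [cplx_mx W i l]mxE [T l j]mxE.
      by rewrite rmorphM -[cplx _]/((W i l)%:C); case: (l == j); case: (j == k); rewrite ?mulr1n ?mulr0n; ring.
    rewrite (bigD1 j)//= big1 ?addr0; first by rewrite eqxx mulr1n mulrC.
    by move=> l lj; rewrite (negbTE lj) mulr0n.
  have WE : W i j = al b p * (j == k)%:R + Y' b p 0 j.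
    by rewrite [W i j]mxE [LHS]mxE [X in X + _]mxE [e 0 j]mxE eqxx.
  have -> : app (psi b) sg i j = (al b p * (j == k)%:R) +i* Y' b p 0 j.
    by rewrite [LHS]mxE -/p [LHS]mxE [e 0 j]mxE eqxx.
  rewrite WE; case: (j == k); rewrite ?mulr1n ?mulr0n ?mulr1 ?mulr0; by apply: C_eq; rewrite /ii /=; ring.
(* Row [k] of [T] is a basis vector, since [ii + (1 - ii) * S k k = 1]; the complementary block is
   [ii] times the identity. *)
have dT : \det T = ii ^+ n.
  rewrite (expand_det_row T k) (bigD1 k)//= big1 ?addr0; last first.
    by move=> j jk; rewrite mxE eq_sym (negbTE jk) !mulr0n addr0 mul0r.
  rewrite mxE !eqxx !mulr1n Skk mulr1 addrC subrK mul1r /cofactor addnn -signr_odd odd_double expr0 mul1r.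
  rewrite -det_scalar; congr (\det _); apply/matrixP => i j.
  by rewrite !mxE (inj_eq lift_inj) [lift k j == k]eq_sym (negbTE (neq_lift k j)) mulr0n addr0.
rewrite uE det_mulmx det_cplx dT cImM /=.
have -> : ii ^+ n = ((-1) ^+ n./2)%:C.
  rewrite -{1}(odd_double_half n) (negbTE en) add0n -mul2n exprM rmorphXn rmorphN rmorph1.
  by congr (_ ^+ _); apply: C_eq; rewrite /ii /=; ring.
by rewrite /= mul0r mulr0 addr0.
Qed.

End RealForms.

(** * Gram matrices *)

Section Gram.
Variable R : realType.

Lemma cauchy_schwarz (I : finType) (a b : I -> R) :
  (\sum_i a i * b i) ^+ 2 <= (\sum_i a i ^+ 2) * (\sum_i b i ^+ 2).
Proof.
set A := \sum_i a i ^+ 2; set B := \sum_i a i * b i; set D := \sum_i b i ^+ 2.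
have A0 : 0 <= A by rewrite sumr_ge0// => i _; exact: sqr_ge0.
have [A_eq0|A_neq0] := eqVneq A 0.
  have a0 i : a i = 0.
    by apply/eqP; rewrite -sqrf_eq0; move/eqP: A_eq0; rewrite psumr_eq0 => [/allP/(_ i (mem_index_enum i))|j _]; last exact: sqr_ge0.
  by rewrite A_eq0 mul0r /B big1 ?expr0n// => i _; rewrite a0 mul0r.
have Ap : 0 < A by rewrite lt_def A_neq0.
have : 0 <= \sum_i (A * b i - B * a i) ^+ 2 by rewrite sumr_ge0// => i _; exact: sqr_ge0.
have -> : \sum_i (A * b i - B * a i) ^+ 2 = A ^+ 2 * D - 2 * (A * B) * B + B ^+ 2 * A.
  have E1 : A ^+ 2 * D = \sum_i A ^+ 2 * b i ^+ 2 by rewrite /D mulr_sumr.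
  have E2 : 2 * (A * B) * B = \sum_i 2 * (A * B) * (a i * b i) by rewrite {2}/B mulr_sumr.
  have E3 : B ^+ 2 * A = \sum_i B ^+ 2 * a i ^+ 2 by rewrite /A mulr_sumr.
  by rewrite E1 E2 E3 -sumrB -big_split /=; apply: eq_bigr => i _; generalize A B => A1 B1; ring.
rewrite (_ : _ + _ = A * (A * D - B ^+ 2)); last by ring.
by rewrite pmulr_rge0// subr_ge0.
Qed.

Definition sq m (x : 'rV[R]_m) := \sum_j x 0 j ^+ 2.

Lemma sq_ge0 m (x : 'rV[R]_m) : 0 <= sq x.
Proof. by rewrite sumr_ge0// => j _; exact: sqr_ge0. Qed.

Lemma sq_gt0 m (x : 'rV[R]_m) : x != 0 -> 0 < sq x.
Proof.
move=> x0; rewrite lt_def sq_ge0 andbT; apply: contra x0 => /eqP h; apply/eqP/rowP => j; rewrite mxE.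
apply/eqP; rewrite -sqrf_eq0; move/eqP: h; rewrite psumr_eq0 => [/allP/(_ j (mem_index_enum j))//|l _].
exact: sqr_ge0.
Qed.

Lemma sq_mul m l (x : 'rV[R]_m) (A : 'M[R]_(m, l)) : sq (x *m A) <= sq x * \sum_j \sum_i A i j ^+ 2.
Proof.
by rewrite /sq mulr_sumr ler_sum// => j _; rewrite mxE; exact: (cauchy_schwarz (fun i => x 0 i) (fun i => A i j)).
Qed.

Lemma bil_sq m (A : 'M[R]_m) (x : 'rV[R]_m) (e : R) : 0 <= e -> (forall i j, `|A i j| <= e) ->
  `|bil A x x| <= e * m%:R ^+ 2 * sq x.
Proof.
move=> e0 hA; rewrite bilE (le_trans (ler_norm_sum _ _ _))//.
rewrite (@le_trans _ _ (\sum_(i < m) \sum_(j < m) e * sq x))//; last first.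
  by rewrite !sumr_const !card_ord -mulrnA -[leLHS]mulr_natr natrM le_eqVlt; apply/orP; left; apply/eqP; ring.
apply: ler_sum => i _; rewrite (le_trans (ler_norm_sum _ _ _))// ler_sum// => j _.
rewrite !normrM mulrAC mulrC ler_pM ?mulr_ge0//.
have xle l : x 0 l ^+ 2 <= sq x.
  by rewrite /sq (bigD1 l)//= lerDl sumr_ge0// => l' _; exact: sqr_ge0.
rewrite -normrM ler_norml.
have := xle i; have := xle j; move: (sq x) (x 0 i) (x 0 j) => s u v h1 h2.
by apply/andP; split; nra.
Qed.

(** Induction on the Schur complement, which is positive because it is the value of [P] at the
    extension of [y] that minimises the form. *)
Lemma cholesky m (P : 'M[R]_m) : P^T = P -> (forall x, x != 0 -> 0 < bil P x x) ->
  exists2 L : 'M[R]_m, L \in unitmx & P = L *m L^T.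
Proof.
elim: m P => [|m IH] P sP pP; first by exists 1%:M; rewrite ?unitmx1//; apply/matrixP => -[].
move: P sP pP; rewrite -[m.+1]/(1 + m)%N => P sP pP.
pose p := P 0 0; pose b := ursubmx P; pose Q := drsubmx P.
have PE : P = block_mx p%:M b b^T Q.
  rewrite -[LHS]submxK; congr block_mx; first by rewrite [LHS]mx11_scalar !mxE; congr (P _ _)%:M; exact: val_inj.
  by rewrite -[in LHS]sP -trmx_ursub.
have sQ : Q^T = Q by rewrite /Q trmx_drsub sP.
have aD (A B : 'M[R]_1) : (A + B) 0 0 = A 0 0 + B 0 0 by rewrite mxE.
have aZ c (A : 'M[R]_1) : (c *: A) 0 0 = c * A 0 0 by rewrite mxE.
have bilP a y : bil P (row_mx a%:M y) (row_mx a%:M y) = p * a ^+ 2 + 2 * a * (b *m y^T) 0 0 + bil Q y y.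
  have E : (y *m b^T) 0 0 = (b *m y^T) 0 0.
    by rewrite !mxE; apply: eq_bigr => j _; rewrite !mxE mulrC.
  rewrite /bil PE mul_row_block tr_row_mx mul_row_col !mulmxDl tr_scalar_mx.
  rewrite !mul_mx_scalar !mul_scalar_mx -scalemxAl !aD !aZ E [a%:M _ _]mxE mulr1n.
  move: ((b *m y^T) 0 0) ((y *m Q *m y^T) 0 0) => u v; ring.
have p0 : 0 < p.
  have : 0 < bil P (row_mx 1%:M 0) (row_mx 1%:M 0).
    apply: pP; apply/eqP => /(congr1 lsubmx); rewrite row_mxKl linear0 => /matrixP/(_ 0 0)/eqP.
    by rewrite !mxE oner_eq0.
  by rewrite bilP /bil trmx0 !mulmx0 !mxE mulr0 !addr0 expr1n mulr1.
pose P' := Q - p^-1 *: (b^T *m b).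
have [L' uL' P'E] : exists2 L' : 'M[R]_m, L' \in unitmx & P' = L' *m L'^T.
  apply: IH; first by rewrite /P' linearB /= sQ linearZ /= trmx_mul trmxK.
  move=> y y0; pose a := - p^-1 * (b *m y^T) 0 0.
  have : 0 < bil P (row_mx a%:M y) (row_mx a%:M y).
    apply: pP; apply: contra y0 => /eqP E; apply/eqP.
    by rewrite -[y](row_mxKr a%:M) E linear0.
  rewrite bilP.
  have -> : bil P' y y = bil Q y y - p^-1 * (b *m y^T) 0 0 ^+ 2.
    rewrite /P' -scaleNr bilDw; congr (_ + _); rewrite /bil -scalemxAr -scalemxAl aZ mulNr; congr (- (_ * _)).
    have -> : y *m (b^T *m b) *m y^T = (y *m b^T) *m (b *m y^T) by rewrite !mulmxA.
    rewrite [y *m b^T]mx11_scalar mul_scalar_mx aZ expr2; congr (_ * _).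
    by rewrite !mxE; apply: eq_bigr => j _; rewrite !mxE mulrC.
  rewrite /a; move: ((b *m y^T) 0 0) (bil Q y y) => u q; rewrite (_ : p * _ + _ = - (p^-1 * u ^+ 2)).
    by rewrite addrC.
  by field; rewrite gt_eqF.
exists (block_mx (Num.sqrt p)%:M 0 ((Num.sqrt p)^-1 *: b^T) L').
  rewrite unitmxE (det_lblock (Num.sqrt p)%:M) unitrM -!unitmxE uL' andbT unitmxE det_scalar1 unitfE.
  by rewrite gt_eqF// sqrtr_gt0.
rewrite (tr_block_mx (Num.sqrt p)%:M) (mulmx_block (Num.sqrt p)%:M) PE.
have s0 : Num.sqrt p != 0 by rewrite gt_eqF// sqrtr_gt0.
have sp : Num.sqrt p * Num.sqrt p = p by rewrite -expr2 sqr_sqrtr// ltW.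
rewrite !tr_scalar_mx trmx0 !mul0mx !mulmx0 !addr0 !linearZ /= trmxK !mul_mx_scalar !mul_scalar_mx.
rewrite !scalerA ?(divff s0) ?(mulVf s0) !scale1r scale_scalar_mx sp; congr block_mx.
rewrite -P'E /P' -scalemxAl scalerA -invfM sp addrC subrK//.
Qed.

End Gram.

(** * Openness of the domain of Gram matrices *)

Section GramOpen.
Variables (R : realType) (n : nat).
Local Notation N := n.+1.
Implicit Types (g : geometry) (v S : 'M[R]_N) (x y z u : 'rV[R]_N).

Definition curv g : R := if g is Sphere then 1 else -1.

Lemma curv2 g : curv g * curv g = 1.
Proof. by case: g; rewrite /= ?mulrNN mulr1. Qed.

Lemma model_formE g (i j : 'I_N) : model_form R g n i j = (if i == ord0 then 1 else curv g) *+ (i == j).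
Proof. by case: g; rewrite !mxE//=; case: (i == ord0). Qed.

Lemma bil_model g x y : bil (model_form R g n) x y =
  x 0 ord0 * y 0 ord0 + curv g * \sum_(j < n) x 0 (lift ord0 j) * y 0 (lift ord0 j).
Proof.
have E i : \sum_j x 0 i * model_form R g n i j * y 0 j =
    (if i == ord0 then 1 else curv g) * (x 0 i * y 0 i).
  rewrite (bigD1 i)//= big1 ?addr0 => [|j ji]; first by rewrite model_formE eqxx mulr1n [x 0 i * _]mulrC mulrA.
  by rewrite model_formE [i == j]eq_sym (negbTE ji) mulr0n mulr0 mul0r.
rewrite bilE (eq_bigr _ (fun i _ => E i)) big_ord_recl eqxx mul1r; congr (_ + _).
by rewrite mulr_sumr; apply: eq_bigr => j _.
Qed.

Lemma bil_gram g v x y : bil (gram g v) x y = bil (model_form R g n) (x *m v) (y *m v).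
Proof. by rewrite /bil /gram trmx_mul !mulmxA. Qed.

Lemma gram_rows g v i j : gram g v i j = bil (model_form R g n) (row i v) (row j v).
Proof. exact: bil_rows. Qed.

Lemma sq_recl x : sq x = x 0 ord0 ^+ 2 + \sum_(j < n) x 0 (lift ord0 j) ^+ 2.
Proof. by rewrite /sq big_ord_recl. Qed.

Local Notation lor := (bil (model_form R Lobachevsky n)).

(** Orthogonality and Cauchy-Schwarz on the spatial parts give [z0^2 (1 + U) <= Z U], where [U], [Z]
    are the spatial squares; so the form at [z] is at most [- Z / (1 + U)], while [sq z <= 2 Z]. *)
Lemma lorentz_orth u z : lor u u = 1 -> lor z u = 0 -> sq z <= 2 * u 0 ord0 ^+ 2 * - lor z z.
Proof.
rewrite !bil_model sq_recl /= !mulN1r.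
have := cauchy_schwarz (fun j => z 0 (lift ord0 j)) (fun j => u 0 (lift ord0 j)).
have U0 : 0 <= \sum_(j < n) u 0 (lift ord0 j) ^+ 2 by rewrite sumr_ge0// => j _; exact: sqr_ge0.
have Z0 : 0 <= \sum_(j < n) z 0 (lift ord0 j) ^+ 2 by rewrite sumr_ge0// => j _; exact: sqr_ge0.
have -> : \sum_(j < n) u 0 (lift ord0 j) * u 0 (lift ord0 j) = \sum_(j < n) u 0 (lift ord0 j) ^+ 2.
  by apply: eq_bigr => j _; rewrite expr2.
have -> : \sum_(j < n) z 0 (lift ord0 j) * z 0 (lift ord0 j) = \sum_(j < n) z 0 (lift ord0 j) ^+ 2.
  by apply: eq_bigr => j _; rewrite expr2.
move: (\sum_(j < n) _ * _) (\sum_(j < n) u 0 _ ^+ 2) (\sum_(j < n) z 0 _ ^+ 2) U0 Z0 (u 0 ord0) (z 0 ord0).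
move=> s U Z U0 Z0 u0 z0 cs hu hz; have {}hz : s = z0 * u0 by lra.
have uE : u0 ^+ 2 = 1 + U by rewrite expr2; lra.
move: cs; rewrite hz exprMn uE => cs.
have zz : 0 <= z0 ^+ 2 by exact: sqr_ge0.
rewrite -[z0 * z0]expr2; move: (z0 ^+ 2) cs zz => q cs qq.
have qU : 0 <= q * U by rewrite mulr_ge0.
have ZU : 0 <= Z * U by rewrite mulr_ge0.
have qZ : q <= Z.
  have [//|Zq] := leP q Z; have : Z * U <= q * U by rewrite ler_wpM2r// ltW.
  by move: cs Zq Z0; clear; lra.
by move: cs qZ; clear; nra.
Qed.

(** After squaring, the claim is [(1 + s)^2 <= (1 + U)(1 + Z)], which is Cauchy-Schwarz together
    with [2 s <= U + Z]. It makes the entries of the Gram matrix positive, so that [J] converges. *)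
Lemma lorentz_ge1 u z : lor u u = 1 -> lor z z = 1 -> 0 < u 0 ord0 -> 0 < z 0 ord0 -> 1 <= lor u z.
Proof.
rewrite !bil_model /= !mulN1r.
have := cauchy_schwarz (fun j => u 0 (lift ord0 j)) (fun j => z 0 (lift ord0 j)).
have : 0 <= \sum_(j < n) (u 0 (lift ord0 j) - z 0 (lift ord0 j)) ^+ 2.
  by rewrite sumr_ge0// => j _; exact: sqr_ge0.
have -> : \sum_(j < n) (u 0 (lift ord0 j) - z 0 (lift ord0 j)) ^+ 2 = \sum_(j < n) u 0 (lift ord0 j) ^+ 2
    - 2 * \sum_(j < n) u 0 (lift ord0 j) * z 0 (lift ord0 j) + \sum_(j < n) z 0 (lift ord0 j) ^+ 2.
  by rewrite mulr_sumr -sumrB -big_split; apply: eq_bigr => j _ /=; ring.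
have -> : \sum_(j < n) u 0 (lift ord0 j) * u 0 (lift ord0 j) = \sum_(j < n) u 0 (lift ord0 j) ^+ 2.
  by apply: eq_bigr => j _; rewrite expr2.
have -> : \sum_(j < n) z 0 (lift ord0 j) * z 0 (lift ord0 j) = \sum_(j < n) z 0 (lift ord0 j) ^+ 2.
  by apply: eq_bigr => j _; rewrite expr2.
move: (\sum_(j < n) _ * _) (\sum_(j < n) u 0 _ ^+ 2) (\sum_(j < n) z 0 _ ^+ 2) (u 0 ord0) (z 0 ord0).
move=> s U Z u0 z0 h cs hu hz up zp; have p0 : 0 < u0 * z0 by rewrite mulr_gt0.
rewrite lerBrDr; have [s0|s0] := lerP (1 + s) 0; first by rewrite (le_trans s0)// ltW.
rewrite -(ler_pXn2r (n := 2))// ?nnegrE ?(ltW s0) ?(ltW p0)// exprMn.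
have -> : u0 ^+ 2 = 1 + U by rewrite expr2; lra.
have -> : z0 ^+ 2 = 1 + Z by rewrite expr2; lra.
by move: h cs; clear; nra.
Qed.

Lemma model_form_sym g : (model_form R g n)^T = model_form R g n.
Proof. by case: g; rewrite /= ?tr_diag_mx ?tr_scalar_mx. Qed.

Lemma gram_sym g v : (gram g v)^T = gram g v.
Proof. by rewrite /gram !trmx_mul trmxK model_form_sym mulmxA. Qed.

(** The Lorentz form has determinant [(-1)^n], which is [1] for even [n]; this supplies the
    nonnegative determinant at the end point. *)
Lemma det_gram g v : (g = Lobachevsky /\ ~~ odd n) \/ g = Sphere -> \det (gram g v) = \det v ^+ 2.
Proof.
move=> hg; rewrite /gram !det_mulmx det_tr; suff -> : \det (model_form R g n) = 1 by rewrite mulr1 expr2.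
case: hg => [[-> en]|->]; last by rewrite /= det1.
rewrite /= det_diag big_ord_recl mxE eqxx mul1r (eq_bigr (fun=> -1)) => [|j _]; last by rewrite mxE.
by rewrite prodr_const card_ord -signr_odd (negbTE en).
Qed.

Lemma gram_nonpos v k X : simplex_vertices Lobachevsky v ->
  bil (gram Lobachevsky v) X (delta_mx 0 k) = 0 -> bil (gram Lobachevsky v) X X <= 0.
Proof.
move=> [_ dv _]; rewrite !bil_gram -rowE => h.
have uu : lor (row k v) (row k v) = 1 by rewrite -gram_rows dv.
have := lorentz_orth uu h; have := sq_ge0 (X *m v); have : 0 < 2 * row k v 0 ord0 ^+ 2.
  move: uu; rewrite bil_model /= mulN1r; have : 0 <= \sum_(j < n) row k v 0 (lift ord0 j) * row k v 0 (lift ord0 j).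
    by rewrite sumr_ge0// => j _; rewrite -expr2 sqr_ge0.
  by move: (\sum_(j < n) _) (row k v 0 ord0) => s t; rewrite expr2; lra.
move=> p0 s0 /(le_trans s0); rewrite pmulr_rge0// oppr_ge0; exact.
Qed.

Lemma gram_ge1 v i j : simplex_vertices Lobachevsky v -> 1 <= gram Lobachevsky v i j.
Proof.
move=> [_ dv pv]; rewrite gram_rows; apply: lorentz_ge1; rewrite -?gram_rows ?dv// mxE; exact: pv.
Qed.

Lemma gram_sphere_ge0 v X : 0 <= bil (gram Sphere v) X X.
Proof.
rewrite bil_gram bil_model /= mul1r addr_ge0 -?expr2 ?sqr_ge0// sumr_ge0// => j _.
by rewrite -expr2 sqr_ge0.
Qed.

(** For a Gram matrix and up to [curv g], the Gram matrix of the projections of the other vertices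
    to the orthogonal complement of the first; the factor makes it positive definite in both
    geometries. *)
Definition schur g S : 'M[R]_n := \matrix_(i, j)
  (curv g * (S (lift ord0 i) (lift ord0 j) - S (lift ord0 i) ord0 * S (lift ord0 j) ord0)).

Lemma schur_bil g S (x : 'rV[R]_n) : S^T = S -> S ord0 ord0 = 1 ->
  exists2 x' : 'rV[R]_N, bil S x' (delta_mx 0 ord0) = 0 /\ sq x <= sq x' &
    bil (schur g S) x x = curv g * bil S x' x'.
Proof.
move=> sS S00; have Ssym i j : S i j = S j i by rewrite -[in LHS]sS mxE.
pose r := \sum_(l < n) x 0 l * S (lift ord0 l) ord0.
pose x' : 'rV[R]_N := \row_j if unlift ord0 j is Some j' then x 0 j' else - r.
have x0 : x' 0 ord0 = - r by rewrite mxE unlift_none.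
have xl l : x' 0 (lift ord0 l) = x 0 l by rewrite mxE liftK.
exists x'.
  split; last first.
    rewrite sq_recl; under [X in _ + X]eq_bigr do rewrite xl.
    by rewrite lerDr sqr_ge0.
  rewrite /bil trmx_delta -colE [col _ _ _ _]mxE mxE big_ord_recl x0 S00 mulr1 addrC.
  by under eq_bigr do rewrite xl; rewrite -/r subrr.
have E : bil S x' x' = (\sum_i \sum_j x 0 i * S (lift ord0 i) (lift ord0 j) * x 0 j) - r * r.
  rewrite bilE big_ord_recl big_ord_recl x0 S00.
  under [X in _ + X]eq_bigr do rewrite big_ord_recl x0 xl.
  rewrite big_split /=.
  have -> : \sum_(i < n) - r * S ord0 (lift ord0 i) * x' 0 (lift ord0 i) = - r * r.
    rewrite {3}/r mulr_sumr; apply: eq_bigr => i _; rewrite xl Ssym; ring.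
  have -> : \sum_(i < n) x 0 i * S (lift ord0 i) ord0 * - r = - r * r.
    rewrite {3}/r mulr_sumr; apply: eq_bigr => i _; ring.
  have -> : \sum_(i < n) \sum_(j < n) x 0 i * S (lift ord0 i) (lift ord0 j) * x' 0 (lift ord0 j) =
      \sum_(i < n) \sum_(j < n) x 0 i * S (lift ord0 i) (lift ord0 j) * x 0 j.
    by apply: eq_bigr => i _; apply: eq_bigr => j _; rewrite xl.
  by move: (\sum_(i < n) \sum_(j < n) _) => q; ring.
rewrite E bilE mulrBr mulr_sumr {1}/r mulr_suml mulr_sumr -sumrB; apply: eq_bigr => i _.
rewrite {1}/r !mulr_sumr -sumrB; apply: eq_bigr => j _; rewrite mxE; ring.
Qed.

Lemma schur_lower g v : simplex_vertices g v ->
  exists2 c : R, 0 < c & forall x : 'rV[R]_n, c * sq x <= bil (schur g (gram g v)) x x.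
Proof.
move=> sv; have [uv dv pv] := sv; pose B := \sum_j \sum_i (invmx v) i j ^+ 2 + 1.
have B0 : 0 < B.
  by rewrite ltr_wpDl// sumr_ge0// => j _; rewrite sumr_ge0// => i _; exact: sqr_ge0.
suff [c c0 hc] : exists2 c : R, 0 < c & forall z, bil (model_form R g n) z (row ord0 v) = 0 ->
    c * sq z <= curv g * bil (model_form R g n) z z.
  exists (c / B); first by rewrite divr_gt0.
  move=> x; have [x' [xe xx] ->] := schur_bil g x (gram_sym g v) (dv ord0).
  move: xe; rewrite !bil_gram -rowE => /hc; apply: le_trans.
  rewrite mulrAC -mulrA ler_pM2l// ler_pdivrMr// (le_trans xx)//.
  rewrite -{1}(mulmxK uv x') (le_trans (sq_mul _ _))// ler_wpM2l ?sq_ge0// lerDl//.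
case: g sv dv pv => sv dv pv.
  have uu : lor (row ord0 v) (row ord0 v) = 1 by rewrite -gram_rows dv.
  have u0 : 0 < 2 * row ord0 v 0 ord0 ^+ 2.
    by rewrite mulr_gt0// exprn_gt0// mxE; exact: pv.
  exists (2 * row ord0 v 0 ord0 ^+ 2)^-1; first by rewrite invr_gt0.
  by move=> z /(lorentz_orth uu) h; rewrite ler_pdivrMl// mulN1r.
exists 1 => // z _; rewrite mul1r bil_model sq_recl /= !mul1r -expr2 lerD2l.
by apply: ler_sum => j _; rewrite expr2.
Qed.

(** With the first vertex at the first basis vector, the first coordinates of the others must be
    [S i ord0], and a Cholesky factor of the Schur complement supplies the rest. *)
Lemma schur_pos_gram g S : S^T = S -> (forall i, S i i = 1) ->
  (g = Lobachevsky -> forall i, 0 < S i ord0) -> (forall x : 'rV[R]_n, x != 0 -> 0 < bil (schur g S) x x) ->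
  exists v, simplex_vertices g v /\ gram g v = S.
Proof.
move=> sS dS pS pos; have Ssym i j : S i j = S j i by rewrite -[in LHS]sS mxE.
have sch : (schur g S)^T = schur g S.
  by apply/matrixP => i j; rewrite !mxE Ssym; ring.
have [L uL LE] := cholesky sch pos.
pose v : 'M[R]_N := \matrix_(i, j) if unlift ord0 i is Some i' then
  (if unlift ord0 j is Some j' then L i' j' else S i ord0) else (j == ord0)%:R.
have v0 j : v ord0 j = (j == ord0)%:R by rewrite mxE unlift_none.
have vl0 i : v (lift ord0 i) ord0 = S (lift ord0 i) ord0 by rewrite mxE liftK unlift_none.
have vll i j : v (lift ord0 i) (lift ord0 j) = L i j by rewrite mxE !liftK.
have gE : gram g v = S.
  apply/matrixP => i j; rewrite gram_rows bil_model ![row _ _ _ ord0]mxE.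
  have -> : \sum_(l < n) row i v 0 (lift ord0 l) * row j v 0 (lift ord0 l) =
      \sum_(l < n) v i (lift ord0 l) * v j (lift ord0 l).
    by apply: eq_bigr => l _; rewrite !mxE.
  have z j' : \sum_(l < n) v ord0 (lift ord0 l) * v j' (lift ord0 l) = 0.
    by rewrite big1// => l _; rewrite v0 mul0r.
  have z' j' : \sum_(l < n) v j' (lift ord0 l) * v ord0 (lift ord0 l) = 0.
    by rewrite big1// => l _; rewrite v0 mulr0.
  have [i'|] := unliftP ord0 i; have [j'|] := unliftP ord0 j => -> ->.
  - rewrite !vl0; under eq_bigr do rewrite !vll.
    have -> : \sum_(l < n) L i' l * L j' l = schur g S i' j'.
      by rewrite LE mxE; apply: eq_bigr => l _; rewrite mxE.
    by rewrite mxE mulrA curv2; ring.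
  - by rewrite z' mulr0 addr0 v0 eqxx mulr1 vl0.
  - by rewrite z mulr0 addr0 v0 eqxx mul1r vl0 Ssym.
  - by rewrite z mulr0 addr0 v0 eqxx mul1r dS.
exists v; split=> //; split.
- rewrite unitmxE (expand_det_row v ord0) (bigD1 ord0)//= big1 ?addr0 => [|j j0]; last first.
    by rewrite v0 (negbTE j0) mul0r.
  rewrite v0 eqxx mul1r /cofactor addn0 expr0 mul1r (_ : row' ord0 _ = L) -?unitmxE//.
  by apply/matrixP => i j; rewrite [LHS]mxE [LHS]mxE vll.
- by move=> i; rewrite gE.
- move=> gl i; have [i'|] := unliftP ord0 i => ->; first by rewrite vl0 pS.
  by rewrite v0 eqxx.
Qed.

(** Positivity of the Schur complement and, in Lobachevsky space, of the first column are open
    conditions. This gives the real neighbourhood on which the volume formula can be compared with a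
    holomorphic function. *)
Theorem gram_open g v : simplex_vertices g v -> exists2 e : R, 0 < e & forall S, S^T = S ->
  (forall i, S i i = 1) -> (forall i j, `|S i j - gram g v i j| <= e) ->
  exists v', simplex_vertices g v' /\ gram g v' = S.
Proof.
move=> sv; have [uv dv pv] := sv; have [c c0 hc] := schur_lower sv; set G := gram g v in hc *.
pose K := 1 + \sum_i \sum_j `|G i j|.
have GK i j : `|G i j| + 1 <= K.
  rewrite /K addrC lerD2l (bigD1 i)//= (bigD1 j)//= -addrA lerDl addr_ge0// sumr_ge0// => l _.
  by rewrite sumr_ge0.
have K1 : 1 <= K by rewrite (le_trans _ (GK ord0 ord0))// lerDr.
have K0 : 0 < 1 + 2 * K by move: K1; clear; lra.
have n0 : 0 < n%:R ^+ 2 + 1 :> R by rewrite ltr_wpDl// sqr_ge0.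
(* [2^-1] keeps the first column positive, its entries being at least [1]. The other bound keeps the
   change of the Schur complement, at most [e * (1 + 2 * K)] per entry, below half of its lower
   bound [c]. *)
pose e := Num.min 2^-1 (c / (2 * ((1 + 2 * K) * (n%:R ^+ 2 + 1)))).
have e0 : 0 < e by rewrite lt_min invr_gt0 ltr0n divr_gt0// !mulr_gt0.
have e12 : e <= 2^-1 by rewrite ge_min lexx.
have ec : e * (1 + 2 * K) * n%:R ^+ 2 <= c / 2.
  rewrite (@le_trans _ _ (e * ((1 + 2 * K) * (n%:R ^+ 2 + 1))))//.
    by rewrite -mulrA ler_pM2l// ler_pM2l// lerDl.
  rewrite -ler_pdivlMr ?mulr_gt0// (@le_trans _ _ (c / (2 * ((1 + 2 * K) * (n%:R ^+ 2 + 1))))) ?ge_min ?lexx ?orbT//.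
  by rewrite invfM mulrA.
exists e => // S sS dS SG; apply: schur_pos_gram => //.
  move=> gl i; have := SG i ord0; have : 1 <= G i ord0 by rewrite /G gl; apply: gram_ge1; rewrite -gl.
  by rewrite ler_norml => h /andP[+ _]; move: h e12; clear; lra.
have SK i j : `|S i j| <= K.
  rewrite -(subrK (G i j) (S i j)) (le_trans (ler_normD _ _))// (le_trans _ (GK i j))// addrC lerD2l.
  by rewrite (le_trans (SG i j))// (le_trans e12)// invf_le1// ler1n.
have GK' i j : `|G i j| <= K by rewrite (le_trans _ (GK i j))// lerDl.
have dS' i j : `|(schur g S - schur g G) i j| <= e * (1 + 2 * K).
  have -> : (schur g S - schur g G) i j = curv g * ((S (lift ord0 i) (lift ord0 j) - G (lift ord0 i) (lift ord0 j))
      - ((S (lift ord0 i) ord0 - G (lift ord0 i) ord0) * S (lift ord0 j) ord0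
         + G (lift ord0 i) ord0 * (S (lift ord0 j) ord0 - G (lift ord0 j) ord0))).
    by rewrite !mxE; ring.
  rewrite normrM (_ : `|curv g| = 1) ?mul1r; last by case: (g); rewrite /= ?normrN normr1.
  rewrite (le_trans (ler_normB _ _))// [e * _]mulrDr mulr1 lerD//.
  rewrite (le_trans (ler_normD _ _))// !normrM (_ : e * (2 * K) = e * K + K * e); last by ring.
  by rewrite lerD// ler_pM.
move=> x x0; have -> : schur g S = schur g G + (schur g S - schur g G) by rewrite addrC subrK.
have eK : 0 <= e * (1 + 2 * K) by rewrite mulr_ge0// ltW.
have := bil_sq x eK dS'; rewrite ler_norml => /andP[h _].
have h2 := ler_wpM2r (sq_ge0 x) ec; rewrite bilDw.
have := hc x; have := sq_gt0 x0; move: h h2 c0; clear.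
move: (bil _ x x) (bil (schur g S - _) x x) (sq x) (e * _ * _) => a b s t; nra.
Qed.

End GramOpen.

(** * Starting chains *)

Section Start.
Variables (R : realType) (n : nat).
Local Notation C := R[i].
Local Notation N := n.+1.
Local Notation Re := (@complex.Re R).
Local Notation Im := (@complex.Im R).

Lemma sum_sq_le m (s : 'I_m -> R) : (\sum_i s i) ^+ 2 <= m%:R * \sum_i s i ^+ 2.
Proof.
have := cauchy_schwarz (fun=> 1) s; rewrite (eq_bigr _ (fun i _ => mul1r (s i))).
by under [X in _ <= X * _]eq_bigr do rewrite expr1n; rewrite sumr_const card_ord.
Qed.

(** On the orthant the off-diagonal terms are nonnegative, and by Cauchy-Schwarz the diagonal ones
    dominate the square of the sum divided by [N]. *)
Lemma adm_nonneg (M : 'M[C]_N) : (forall i, 1 <= Re (M i i)) -> (forall i j, 0 <= Re (M i j)) ->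
  adm_with (N%:R^-1) M.
Proof.
move=> d1 p0 s s0; rewrite ler_pdivrMl ?ltr0n// (le_trans (sum_sq_le s))// ler_pM2l ?ltr0n//.
apply: ler_sum => i _; rewrite (bigD1 i)//= ler_wpDr//.
  by rewrite sumr_ge0// => j _; rewrite !mulr_ge0.
by rewrite -expr2 ler_peMl ?sqr_ge0.
Qed.

(** Convergence has two different reasons: the Lorentzian form is indefinite but has entries at
    least [1], the spherical one is positive definite. *)
Lemma adm_gram g (v : 'M[R]_N) : simplex_vertices g v -> adm (cplx_mx (gram g v)).
Proof.
case: g => sv.
  exists (N%:R^-1); first by rewrite invr_gt0 ltr0n.
  have [_ dv _] := sv; apply: adm_nonneg => [i|i j]; rewrite mxE /= ?dv//.
  by rewrite (le_trans ler01)// gram_ge1.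
have [uv _ _] := sv; pose B := \sum_j \sum_i (invmx v) i j ^+ 2 + 1.
have B0 : 0 < B.
  by rewrite ltr_wpDl// sumr_ge0// => j _; rewrite sumr_ge0// => i _; exact: sqr_ge0.
exists ((N%:R * B)^-1); first by rewrite invr_gt0 mulr_gt0// ltr0n.
move=> s _; pose x : 'rV[R]_N := \row_j s j.
have -> : \sum_i \sum_j Re (cplx_mx (gram Sphere v) i j) * (s i * s j) = sq (x *m v).
  transitivity (bil (gram Sphere v) x x).
    by rewrite bilE; apply: eq_bigr => i _; apply: eq_bigr => j _; rewrite !mxE /=; ring.
  rewrite bil_gram bil_model sq_recl /= mul1r -expr2; congr (_ + _).
rewrite ler_pdivrMl ?mulr_gt0 ?ltr0n// (le_trans (sum_sq_le s))// -mulrA ler_pM2l ?ltr0n//.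
have -> : \sum_i s i ^+ 2 = sq x by apply: eq_bigr => i _; rewrite mxE.
rewrite -{1}(mulmxK uv x) (le_trans (sq_mul _ _))// mulrC ler_wpM2r ?sq_ge0// lerDl//.
Qed.

Definition Vsq (kappa : R) (w : 'M[C]_N) : C := (kappa ^+ 2)%:C * \det w * J w ^+ 2.

Lemma adm_near (D : 'M[C]_N) : adm D -> exists2 r : R, 0 < r & forall w, mx1 (w - D) < r -> adm w.
Proof.
move=> [c c0 aD]; exists c => // w wD; exists (c - mx1 (w - D)); first by rewrite subr_gt0.
by have := adm_perturb (w - D) aD; rewrite [D + _]addrC subrK.
Qed.

Lemma Vsq_hol kappa (D : 'M[C]_N) : adm D -> exists2 r : R, 0 < r & hol_near (Vsq kappa) D r.
Proof.
move=> /adm_near[r r0 h]; exists r => // A B z _ _ /h az.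
apply: cdiffM; first by apply: cdiffM; [exact: cdiff_cst|exact: det_cdiff].
by apply: cdiffX; exact: J_cdiff.
Qed.

Lemma tr_map_mx (U V : Type) a b (h : U -> V) (M : 'M[U]_(a, b)) : (map_mx h M)^T = map_mx h M^T.
Proof. by apply/matrixP => i j; rewrite !mxE. Qed.

Lemma cplx_mxB (X Y : 'M[R]_N) i j : (cplx_mx X - cplx_mx Y) i j = (X i j - Y i j)%:C.
Proof. by rewrite !mxE rmorphB. Qed.

Lemma cplx_split (w : 'M[C]_N) : Gmat w -> exists A B : 'M[R]_N,
  [/\ A^T = A, B^T = B, forall i, A i i = 1, forall i, B i i = 0 & w = cplx_mx A + (0 +i* 1) *: cplx_mx B] /\
  (forall D : 'M[R]_N, mx1 (cplx_mx A - cplx_mx D) <= mx1 (w - cplx_mx D) /\ mx1 (cplx_mx B) <= mx1 (w - cplx_mx D)).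
Proof.
move=> [sw dw]; exists (map_mx Re w), (map_mx Im w); split.
  split.
  - by rewrite tr_map_mx sw.
  - by rewrite tr_map_mx sw.
  - by move=> i; rewrite mxE dw.
  - by move=> i; rewrite mxE dw.
  - by apply/matrixP => i j; rewrite !mxE; apply: C_eq; rewrite /=; ring.
move=> D; split; apply: ler_sum => i _; apply: ler_sum => j _; rewrite !mxE.
  by rewrite -[cplx _]/((Re (w i j))%:C) -[cplx (D i j)]/((D i j)%:C) -rmorphB cnR (le_trans _ (Re_le_cn _))// ReD ReN.
by rewrite -[cplx _]/((Im (w i j))%:C) cnR (le_trans _ (Im_le_cn _))// ImD ImN /= oppr0 addr0.
Qed.

(** A matrix [w = A + i B] is the point [z = i] of the line [A + z B]. For small real [z] the line
    consists of Gram matrices, where the volume formula is known, and [i] lies in the closed disc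
    reached by [real_identity]. *)
Lemma volume_sq_near g (v : 'M[R]_N) (f : 'M[C]_N -> C) (r0 : R) :
  (g = Lobachevsky /\ ~~ odd n) \/ g = Sphere -> simplex_vertices g v ->
  0 < r0 -> hol_near f (cplx_mx (gram g v)) r0 ->
  (forall v', simplex_vertices g v' -> mx1 (cplx_mx (gram g v') - cplx_mx (gram g v)) < r0 ->
     f (cplx_mx (gram g v')) = cplx (simplex_volume g v')) ->
  exists kappa : R, exists2 r : R, 0 < r & forall w, Gmat w -> mx1 (w - cplx_mx (gram g v)) < r ->
    f w ^+ 2 = Vsq kappa w.
Proof.
move=> hg sv r00 hol fv; have [kappa kE] := simplex_volumeE R n; exists kappa.
set D := cplx_mx (gram g v) in hol fv *.
have aD : adm D := adm_gram sv.
have [r1 r10 hV] := Vsq_hol kappa aD; have [e e0 op] := gram_open sv.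
(* For [cn z < 4] the point of the line is within [r + 4 r] of [D]. *)
pose r := Num.min (Num.min r0 r1) e / 5%:R.
have mp : 0 < Num.min (Num.min r0 r1) e by rewrite !lt_min r00 r10.
have rE : Num.min (Num.min r0 r1) e = 5%:R * r by rewrite /r mulrC divfK.
have r50 : 5%:R * r <= r0 by rewrite -rE !ge_min lexx.
have r51 : 5%:R * r <= r1 by rewrite -rE !ge_min lexx orbT.
have r5e : 5%:R * r <= e by rewrite -rE !ge_min lexx orbT.
exists r; first by rewrite divr_gt0.
move=> w Gw wD; have [A [B [[sA sB dA dB wE] /(_ (gram g v))[hA hB]]]] := cplx_split Gw.
rewrite -/D in hA hB.
pose L z := cplx_mx A + z *: (cplx_mx (A + B) - cplx_mx A).
have ABE : cplx_mx (A + B) - cplx_mx A = cplx_mx B.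
  by apply/matrixP => i j; rewrite !mxE; apply: C_eq; rewrite /=; ring.
have GA : Gmat (cplx_mx A).
  by split=> [|i]; [rewrite tr_map_mx sA|rewrite mxE dA].
have GAB : Gmat (cplx_mx (A + B)).
  have sAB : (A + B)^T = A + B by rewrite linearD /= sA sB.
  by split=> [|i]; [rewrite tr_map_mx sAB|rewrite mxE [(A + B) i i]mxE dA dB addr0].
have Lb z : cn z < 4 -> mx1 (L z - D) < 5%:R * r.
  move=> z4; rewrite /L ABE addrAC (le_lt_trans (mx1D _ _))// mx1Z.
  have : cn z * mx1 (cplx_mx B) <= 4 * mx1 (w - D).
    by apply: ler_pM; rewrite ?cn_ge0 ?mx1_ge0//; exact: ltW.
  move: hA wD; clear; move: (mx1 _) (mx1 (w - D)) (cn z * _) => x1 x2 x3; lra.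
pose F z := f (L z) ^+ 2 - Vsq kappa (L z).
have Li : L (0 +i* 1) = w by rewrite /L ABE -wE.
suff : F (0 +i* 1) = 0 by rewrite /F Li => /eqP; rewrite subr_eq0 => /eqP.
apply: (@real_identity R F 1).
- move=> z z4; apply: cdiffB.
    by apply: cdiffX; apply: hol => //; rewrite (lt_le_trans (Lb z z4)).
  by apply: hV => //; rewrite (lt_le_trans (Lb z z4)).
- exact: ltr01.
- move=> x x1; have x4 : cn x%:C < 4 by rewrite cnR (lt_le_trans x1)// ler1n.
  have LE : L x%:C = cplx_mx (A + x *: B).
    by rewrite /L ABE; apply/matrixP => i j; rewrite !mxE; apply: C_eq; rewrite /=; ring.
  have [v' [sv' gv']] : exists v', simplex_vertices g v' /\ gram g v' = A + x *: B.
    apply: op => [|i|i j]; first by rewrite linearD linearZ /= sA sB.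
      by rewrite !mxE dA dB mulr0 addr0.
    have := Lb x%:C x4; rewrite LE => /ltW h; have := le_trans (entry_le_mx1 _ i j) (le_trans h r5e).
    by rewrite cplx_mxB cnR [(A + _) i j]mxE.
  have [uv' _ _] := sv'; have aG := adm_gram sv'.
  have := Lb x%:C x4; rewrite LE -gv' => hD.
  rewrite /F LE -gv' fv//; last by rewrite (lt_le_trans hD).
  have JE : J (cplx_mx (gram g v')) = (Re (J (cplx_mx (gram g v'))))%:C.
    by apply: C_eq; [|rewrite J_real// => i j; rewrite mxE].
  rewrite /Vsq JE (kE g v' uv' aG) det_cplx (det_gram _ hg) -rmorphXn -!rmorphM -[cplx _]/((_ : R)%:C) -rmorphXn -rmorphB.
  apply/eqP; rewrite fmorph_eq0 subr_eq0; apply/eqP; rewrite !exprMn real_normK ?num_real//; ring.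
- by rewrite /cn /= expr0n add0r expr1n sqrtr1.
Qed.

Lemma exchange_big4 (I K : finType) (F : I -> I -> K -> K -> R) :
  \sum_i \sum_i' \sum_j \sum_j' F i i' j j' = \sum_j \sum_j' \sum_i \sum_i' F i i' j j'.
Proof.
rewrite pair_bigA; under eq_bigr do rewrite pair_bigA; rewrite exchange_big /= [RHS]pair_bigA.
by apply: eq_bigr => q _; rewrite [RHS]pair_bigA.
Qed.

(** [s] times [P] is again a nonnegative vector with the same sum, so even the constant is kept. *)
Lemma adm_stochastic (M : 'M[C]_N) (P : 'M[R]_(N.+1, N)) : adm M -> (forall i j, 0 <= P i j) ->
  (forall i, \sum_j P i j = 1) -> adm (map_mx (real_complex R) P *m M *m (map_mx (real_complex R) P)^T).
Proof.
move=> [c c0 aM] P0 P1; exists c => // s s0; pose t j := \sum_i s i * P i j.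
have -> : \sum_i s i = \sum_j t j.
  rewrite exchange_big; apply: eq_bigr => i _; by rewrite -mulr_sumr P1 mulr1.
have := aM t; have t0 j : 0 <= t j by rewrite sumr_ge0// => i _; rewrite mulr_ge0.
move=> /(_ t0)/le_trans; apply; rewrite le_eqVlt; apply/orP; left; apply/eqP.
have E i i' : Re ((map_mx (real_complex R) P *m M *m (map_mx (real_complex R) P)^T) i i') =
    \sum_j \sum_j' P i j * Re (M j j') * P i' j'.
  rewrite bil_rows bilE Re_sum; apply: eq_bigr => j _; rewrite Re_sum; apply: eq_bigr => j' _.
  by rewrite !mxE !cReM !cImM /=; ring.
transitivity (\sum_i \sum_i' \sum_j \sum_j' Re (M j j') * ((s i * P i j) * (s i' * P i' j'))); last first.
  apply: eq_bigr => i _; apply: eq_bigr => i' _; rewrite E mulr_suml; apply: eq_bigr => j _.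
  by rewrite mulr_suml; apply: eq_bigr => j' _; ring.
rewrite exchange_big4; apply: eq_bigr => j _; apply: eq_bigr => j' _.
rewrite /t mulr_suml mulr_sumr; apply: eq_bigr => i _; rewrite !mulr_sumr; apply: eq_bigr => i' _ //.
Qed.

(** [Sd_id] applies because degenerate simplices have zero determinant and convex combinations of
    the rows of [E] remain admissible; so the value is exact for every [m]. *)
Lemma iter_Sd_linear m (w E : 'M[C]_N) : w^T = w -> adm (E *m w *m E^T) ->
  iter m (@Sd R n C) (fun sg => gcoch w (cplx_mx sg *m E)) 1%:M = gcoch w E.
Proof.
move=> sw aE; rewrite (@iter_Sd_id R n C (fun sg => gcoch w (cplx_mx sg *m E))).
- by rewrite -[cplx_mx _]/(map_mx (real_complex R) 1%:M) map_mx1 mul1mx.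
- by move=> sg d0; rewrite gcoch_det0// det_mulmx det_cplx d0 mul0r.
- move=> P P0 P1; pose Pc := map_mx (real_complex R) P.
  have aPE : adm ((Pc *m E) *m w *m (Pc *m E)^T).
    by have := adm_stochastic aE P0 P1; rewrite trmx_mul !mulmxA.
  have PE (i : 'I_N.+1) : cplx_mx (row' i P) *m E = row' i (Pc *m E).
    by apply/matrixP => a b; rewrite !mxE; apply: eq_bigr => l _; rewrite !mxE.
  apply: (eq_trans _ (gcoch_cocycle sw aPE)); apply: eq_bigr => i _.
  exact (congr1 (fun y => (-1) ^+ i * gcoch w y) (PE i)).
exact: in_simplex1.
Qed.

Definition linear_map (E : bool -> 'M[C]_N) b (p : 'rV[R]_N) : 'rV[C]_N := map_mx (real_complex R) p *m E b.

Lemma chain_int_linear k E m (w : 'M[C]_N) : w^T = w -> (forall b, adm (E b *m w *m (E b)^T)) ->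
  chain_int k (linear_map E) m w = \sum_b cf R k b * gcoch w (E b).
Proof.
move=> sw aE; rewrite /chain_int iter_Sd_sum; apply: eq_bigr => b _; rewrite iter_SdZ; congr (_ * _).
apply: (eq_trans _ (iter_Sd_linear m sw (aE b))); apply: eq_iter_Sd => sg.
have E1 : app (linear_map E b) sg = cplx_mx sg *m E b.
  by apply/matrixP => i j; rewrite !mxE; apply: eq_bigr => l _; rewrite !mxE.
exact (congr1 (gcoch w) E1).
Qed.

Lemma ucbv_linear E b : ucbv (linear_map E b).
Proof.
move=> i; apply: (@ucb_ext _ _ (fun p => \sum_l (p 0 l)%:C * E b l i)).
  by move=> p; rewrite mxE; apply: eq_bigr => l _; rewrite mxE.
by apply: ucb_sum => l; apply: ucbM; [exact: ucb_coord|exact: ucb_cst].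
Qed.

End Start.

(** * Chains representing the squared volume at the starting point *)

Section StartingChains.
Variables (R : realType) (n : nat).
Local Notation C := R[i].
Local Notation N := n.+1.
Local Notation Re := (@complex.Re R).
Local Notation Im := (@complex.Im R).

Lemma linear_pos (E : bool -> 'M[C]_N) b (D : 'M[C]_N) c p : adm_with c (E b *m D *m (E b)^T) ->
  simp p -> c <= Re (bil D (linear_map E b p) (linear_map E b p)).
Proof.
move=> aE [p0 p1]; have := aE (fun j => p 0 j) p0; rewrite p1 expr1n mulr1.
have -> : bil D (linear_map E b p) (linear_map E b p) =
    bil (E b *m D *m (E b)^T) (map_mx (real_complex R) p) (map_mx (real_complex R) p).
  by rewrite /bil /linear_map trmx_mul !mulmxA.
move=> /le_trans; apply; rewrite le_eqVlt; apply/orP; left; apply/eqP.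
rewrite bilE Re_sum; apply: eq_bigr => i _; rewrite Re_sum; apply: eq_bigr => j _.
by rewrite [map_mx _ p 0 i]mxE [map_mx _ p 0 j]mxE !cReM !cImM /=; ring.
Qed.

(** The chain is the inclusion of the real simplex; all its facets lie in coordinate hyperplanes,
    hence the side [None]. *)
Lemma represents_sphere kappa v : simplex_vertices Sphere v ->
  represents (fun _ : 'I_1 => None) (fun _ => (1 : R)%:C) (kappa ^+ 2)%:C (@Vsq R n kappa)
    (cplx_mx (gram Sphere v)).
Proof.
move=> sv; set D := cplx_mx _; have aD : adm D := adm_gram sv.
pose E (b : bool) : 'M[C]_N := 1%:M.
have EE (w : 'M[C]_N) b : E b *m w *m (E b)^T = w by rewrite /E trmx1 mulmx1 mul1mx.
have lE b p : linear_map E b p = map_mx (real_complex R) p by rewrite /linear_map /E mulmx1.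
exists (fun _ => linear_map E); split.
- move=> _; split=> // b p j _ pj; by rewrite lE mxE pj.
- by move=> _ b; exact: ucbv_linear.
- have [c c0 ac] := aD; exists c => // _ b p sp; apply: linear_pos => //; by rewrite EE.
have [r r0 hr] := adm_near aD; exists r => //; exists 0%N => m _ w [sw _] wD.
have aw b : adm (E b *m w *m (E b)^T) by rewrite EE; exact: hr.
have cE : chain_int None (linear_map E) m w = J w.
  rewrite (chain_int_linear None m sw aw); transitivity (1 * gcoch w (E true) + 0 * gcoch w (E false)).
    by rewrite big_bool.
  by rewrite [0 * _]mul0r [_ + 0]addr0 [1 * _]mul1r /gcoch /E trmx1 mulmx1 mul1mx det1 [LHS]mul1r.
by rewrite big_ord1 cE /Vsq rmorph1 mul1r.
Qed.

Definition flip (m : nat) : 'M[C]_N := diag_mx (\row_j (-1) ^+ (j < m)%N).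

Lemma flipE m (M : 'M[C]_N) i j :
  (flip m *m M *m (flip m)^T) i j = (-1) ^+ (i < m)%N * M i j * (-1) ^+ (j < m)%N.
Proof. by rewrite tr_diag_mx mul_mx_diag mul_diag_mx !mxE. Qed.

Lemma mx1_flip m (M : 'M[C]_N) : mx1 (flip m *m M *m (flip m)^T) = mx1 M.
Proof.
apply: eq_bigr => i _; apply: eq_bigr => j _; rewrite flipE !cnM !cnX cnN cn1 !expr1n.
by rewrite mul1r mulr1.
Qed.

Lemma flip_one m : flip m *m 1%:M *m (flip m)^T = 1%:M.
Proof.
apply/matrixP => i j; rewrite flipE mxE; have [->|_] := eqVneq i j; last by rewrite mulr0n mulr0 mul0r.
by rewrite mulr1n mulr1 -expr2 sqrr_sign.
Qed.

Lemma adm_flip m (w : 'M[C]_N) : mx1 (w - 1%:M) < N%:R^-1 -> adm (flip m *m w *m (flip m)^T).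
Proof.
move=> w1; exists (N%:R^-1 - mx1 (w - 1%:M)); first by rewrite subr_gt0.
have -> : flip m *m w *m (flip m)^T = 1%:M + flip m *m (w - 1%:M) *m (flip m)^T.
  by rewrite mulmxBr mulmxBl flip_one addrC subrK.
rewrite -(mx1_flip m); apply: adm_perturb; apply: adm_nonneg => [i|i j]; rewrite mxE ?eqxx//.
by case: (i == j).
Qed.

(* Consecutive orthants of the sum share a facet; for odd [N] the last one, which is the opposite
   of the first, contributes with the opposite sign. *)
Lemma flip_telescope (w : 'M[C]_N) : ~~ odd n ->
  \sum_(k < N) (gcoch w (flip k) - gcoch w (flip k.+1)) = 2 * J w.
Proof.
move=> en; rewrite -(big_mkord xpredT (fun k => gcoch w (flip k) - gcoch w (flip k.+1))).
have tel (u : nat -> C) m : \sum_(0 <= k < m) (u k - u k.+1) = u 0%N - u m.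
  by elim: m => [|k IH]; [rewrite big_geq// subrr|rewrite big_nat_recr//= IH addrA subrK].
rewrite (tel (fun k => gcoch w (flip k))).
have f0 : flip 0 = 1%:M by apply/matrixP => i j; rewrite !mxE /= expr0.
have fN : flip N = (-1)%:M by apply/matrixP => i j; rewrite !mxE ltn_ord expr1.
rewrite f0 fN /gcoch det1 det_scalar trmx1 tr_scalar_mx mulmx1 mul1mx mul_scalar_mx mul_mx_scalar.
rewrite scalerA mulrNN mulr1 scale1r exprS -signr_odd (negbTE en) expr0 mulr1 mul1r mulN1r opprK.
by rewrite -mulr2n mulr_natl.
Qed.

(** At the identity every flipped orthant is positive, whatever the signs. [flip k] and [flip k.+1]
    differ in coordinate [k] only, so they agree on the facet where it vanishes. The divisor [4] is
    the square of the factor [2] of the telescoping sum. *)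
Lemma represents_flips kappa : ~~ odd n ->
  represents (fun k : 'I_N => Some k) (fun _ => (1 : R)%:C) (kappa ^+ 2 / 4)%:C (@Vsq R n kappa) 1%:M.
Proof.
move=> en; pose E (k : 'I_N) b := flip (if b then k : nat else k.+1).
have lE k b p j : linear_map (E k) b p 0 j = (p 0 j)%:C * (-1) ^+ (j < (if b then k : nat else k.+1))%N.
  by rewrite /linear_map /E /flip mul_mx_diag !mxE.
have N0 : 0 < N%:R^-1 :> R by rewrite invr_gt0 ltr0n.
exists (fun k => linear_map (E k)); split.
- move=> k; split=> [b p j _ pj|p j [jk] pj]; first by rewrite lE pj mul0r.
  apply/rowP => l; rewrite !lE; have [->|lj] := eqVneq l j; first by rewrite pj !mul0r.
  have lj' : ((l : nat) == j) = false by exact/negbTE.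
  by rewrite -jk ltnS [(l <= j)%N]leq_eqVlt lj'.
- by move=> k b; exact: ucbv_linear.
- exists (N%:R^-1) => // k b p sp; apply: linear_pos => //; rewrite /E flip_one.
  by apply: adm_nonneg => [i|i j]; rewrite mxE ?eqxx//; case: (i == j).
exists (N%:R^-1) => //; exists 0%N => m _ w [sw _] wD.
have cE k : (1 : R)%:C * chain_int (Some k) (linear_map (E k)) m w = gcoch w (flip k) - gcoch w (flip k.+1).
  rewrite (chain_int_linear (Some k) m sw); last by move=> b; exact: adm_flip.
  by rewrite big_bool /cf /E rmorph1 !mul1r mulN1r.
rewrite (eq_bigr _ (fun k _ => cE k)) flip_telescope// /Vsq exprMn.
have -> : (kappa ^+ 2 / 4)%:C = (kappa ^+ 2)%:C / 4 :> C by rewrite rmorphM fmorphV rmorph_nat.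
move: (J w) (\det w) (kappa ^+ 2)%:C => j d k; field; by rewrite ?pnatr_eq0.
Qed.

(** Pairing a kernel vector [v] with its conjugate gives [|v|^2 + z a = 0] with [a] real, as [A] is
    real symmetric. For non-real [z] this forces [a = 0] and then [v = 0]. *)
Lemma minor_line_neq0 (A : 'M[R]_N) (z : C) (S : {set 'I_N}) : A^T = A -> Im z != 0 ->
  principal_minor (1%:M + z *: cplx_mx A) S != 0.
Proof.
move=> sA z0; apply/negP => /det0P[v v0 vM].
pose B (i j : 'I_#|S|) : R := A (enum_val i) (enum_val j).
have Bsym (i j : 'I_#|S|) : B i j = B j i by rewrite /B -[in LHS]sA mxE.
pose a := \sum_j \sum_i v 0 i * (B i j)%:C * (v 0 j)^*.
pose q := \sum_j cn (v 0 j) ^+ 2.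
have vj j : v 0 j + z * \sum_i v 0 i * (B i j)%:C = 0.
  have := congr1 (fun X : 'rV[C]_#|S| => X 0 j) vM; rewrite [LHS]mxE [RHS]mxE; apply: etrans.
  rewrite mulr_sumr [X in X + _](_ : _ = \sum_i v 0 i *+ (i == j)).
    rewrite -big_split; apply: eq_bigr => i _ /=; rewrite !mxE (inj_eq enum_val_inj) mulrDr mulr_natr; congr (_ + _).
    by rewrite mulrCA.
  by rewrite (bigD1 j)//= eqxx mulr1n big1 ?addr0// => i ij; rewrite (negbTE ij) mulr0n.
have qa : q%:C + z * a = 0.
  rewrite /q /a rmorph_sum mulr_sumr -big_split big1// => j _ /=.
  by rewrite -mulCconj -mulr_suml mulrA -mulrDl vj mul0r.
have Ia : Im a = 0.
  have : Im a = - Im a.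
    rewrite {1}/a exchange_big /a !Im_sum -sumrN; apply: eq_bigr => i _; rewrite !Im_sum -sumrN.
    apply: eq_bigr => j _; rewrite Bsym; case: (v 0 i) (v 0 j) => x1 x2 [y1 y2]; rewrite /=; ring.
  by lra.
have := congr1 Im qa; rewrite ImD cImM Ia mulr0 add0r /= add0r => /eqP; rewrite mulf_eq0 (negbTE z0) /= => /eqP Ra.
have := congr1 Re qa; rewrite ReD cReM Ra Ia !mulr0 subrr addr0 /= => /eqP.
rewrite psumr_eq0 => [/allP h|j _]; last exact: sqr_ge0.
move/eqP: v0; apply; apply/rowP => j; rewrite mxE; apply/eqP; rewrite -cn_eq0 -sqrf_eq0.
exact: h (mem_index_enum j).
Qed.

Lemma cplx_mx_sub1 (X : 'M[R]_N) : cplx_mx X - 1%:M = cplx_mx (X - 1%:M).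
Proof. by apply/matrixP => i j; rewrite !mxE; case: (i == j); apply: C_eq; rewrite /= ?subr0. Qed.

Lemma Re_line (X : 'M[R]_N) (z : C) i j :
  Re ((1%:M + z *: (cplx_mx X - 1%:M)) i j) = (i == j)%:R + Re z * (X i j - (i == j)%:R).
Proof. by rewrite cplx_mx_sub1 !mxE; case: (i == j); rewrite ReD cReM /=; ring. Qed.

Lemma Gmat_one : Gmat (1%:M : 'M[C]_N).
Proof. by split=> [|i]; rewrite ?trmx1// mxE eqxx. Qed.

Lemma Gmat_gram g (v : 'M[R]_N) : simplex_vertices g v -> Gmat (cplx_mx (gram g v)).
Proof. by move=> [_ dv _]; split=> [|i]; rewrite ?tr_map_mx ?gram_sym// mxE dv. Qed.

(** The flipped chains are moved from the identity to the Gram matrix with [Vsq] as the function. It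
    stays holomorphic on the way because the real part of the matrix is a convex combination of the
    identity and a matrix with entries at least [1]. *)
Lemma represents_lobachevsky kappa v : ~~ odd n -> simplex_vertices Lobachevsky v ->
  (forall S : {set 'I_N}, (0 < #|S|)%N -> principal_minor (cplx_mx (gram Lobachevsky v)) S != 0) ->
  represents (fun k : 'I_N => Some k) (fun _ => (1 : R)%:C) (kappa ^+ 2 / 4)%:C (@Vsq R n kappa)
    (cplx_mx (gram Lobachevsky v)).
Proof.
move=> en sv mv; set D := cplx_mx _; have GD : Gmat D := Gmat_gram sv.
(* The parameter leaves the real axis strictly between its ends, where [minor_line_neq0] rules out
   vanishing minors. *)
pose z (t : R) : C := t +i* (t * (1 - t)).
pose gam t := 1%:M + z t *: (D - 1%:M).
have g0 : gam 0 = 1%:M by rewrite /gam /z mul0r scale0r addr0.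
have g1 : gam 1 = D by rewrite /gam /z subrr mulr0 scale1r addrC subrK.
have := @represents_path R n _ (fun k : 'I_N => Some k) (fun _ => (1 : R)%:C) (kappa ^+ 2 / 4)%:C gam (fun _ => @Vsq R n kappa).
rewrite g0 g1; apply; last exact: represents_flips.
- by move=> t _; exact: Gmat_line Gmat_one GD.
- move=> t /andP[t0 t1] S S0; have [->|tn0] := eqVneq t 0.
    rewrite g0 /principal_minor (_ : (\matrix_(i, j) _) = 1%:M) ?det1 ?oner_neq0//.
    by apply/matrixP => i j; rewrite !mxE (inj_eq enum_val_inj).
  have [->|tn1] := eqVneq t 1; first by rewrite g1; exact: mv.
  have -> : gam t = 1%:M + z t *: cplx_mx (gram Lobachevsky v - 1%:M).
    by rewrite -cplx_mx_sub1.
  apply: minor_line_neq0; first by rewrite linearB /= gram_sym trmx1.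
  by rewrite /= mulf_neq0// subr_eq0 eq_sym.
- move=> t /andP[t0 t1] e e0; pose K := mx1 (D - 1%:M) + 1.
  have K0 : 0 < K by rewrite ltr_wpDl// mx1_ge0.
  exists (e / (2 * K)); first by rewrite divr_gt0// mulr_gt0.
  move=> s /andP[s0 s1]; rewrite ltr_pdivlMr ?mulr_gt0// => st.
  have -> : gam s - gam t = (z s - z t) *: (D - 1%:M) by rewrite /gam opprD addrACA subrr add0r -scalerBl.
  rewrite mx1Z; apply: le_lt_trans st.
  have zst : cn (z s - z t) <= 2 * `|s - t|.
    rewrite (le_trans (cn_le_ReIm _))// ReD ReN ImD ImN /= mulr2n mulrDl mul1r lerD2l.
    have -> : s * (1 - s) - t * (1 - t) = (s - t) * (1 - s - t) by ring.
    rewrite normrM ler_piMr// ler_norml; move: s0 s1 t0 t1; clear; lra.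
  rewrite (_ : `|s - t| * (2 * K) = 2 * `|s - t| * K); last by ring.
  by rewrite ler_pM ?cn_ge0 ?mx1_ge0// lerDl.
- move=> t /andP[t0 t1]; have aG : adm (gam t).
    exists (N%:R^-1); first by rewrite invr_gt0 ltr0n.
    have dv i : gram Lobachevsky v i i = 1 by have [_ ->] := sv.
    have E i j : Re (gam t i j) = (i == j)%:R + t * (gram Lobachevsky v i j - (i == j)%:R).
      exact: Re_line.
    apply: adm_nonneg => [i|i j]; rewrite E; first by rewrite eqxx dv subrr mulr0 addr0.
    have x1 := gram_ge1 i j sv; case: (i == j); rewrite /= ?mulr1n ?mulr0n.
      by rewrite addr_ge0// mulr_ge0// subr_ge0.
    by rewrite subr0 add0r mulr_ge0// (le_trans ler01).
  have [r r0 hr] := Vsq_hol kappa aG; exists r => //; split=> // s _ _; exists 1 => //.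
Qed.

End StartingChains.

(** * Analytic continuation *)

Section Conversion.
Variables (R : realType) (n : nat).
Local Notation C := R[i].
Local Notation N := n.+1.
Local Notation Re := (@complex.Re R).
Local Notation Im := (@complex.Im R).

(** In the order of [R[i]] the inequality [0 < z] already says that [z] is real. *)
Lemma posC (z : C) : 0 < z -> z = (Re z)%:C /\ 0 < Re z.
Proof. by case: z => a b; rewrite ltcE /= => /andP[/eqP -> a0]. Qed.

Lemma mballE (D w : 'M[C]_N) (r : R) : mball D r%:C w <-> mx1 (w - D) < r.
Proof. by rewrite /mball /= mnormE ltcR. Qed.

(** The derivative [L] is restricted to the line; [K] exceeds [mx1 (B - A)] by one so as to stay
    positive when [A = B]. *)
Lemma hol_near_of_holomorphic (f : 'M[C]_N -> C) (D : 'M[C]_N) (r : R) :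
  holomorphic_on_G f (mball D r%:C) -> hol_near f D r.
Proof.
move=> hf A B z GA GB hz; have Gw : Gmat (A + z *: (B - A)) by exact: Gmat_line.
have [L hL] := hf _ ((mballE D _ r).2 hz) Gw.
pose K := mx1 (B - A) + 1; have K0 : 0 < K by rewrite ltr_wpDl// mx1_ge0.
apply: (@cdiffP _ _ _ (\sum_i \sum_j L i j * (B - A) i j)) => e e0.
have eK0 : 0 < (e / K)%:C :> C by rewrite -[0]/(0%:C) ltcR divr_gt0.
have [d [d0 hd]] := hL _ eK0; have [dE d0'] := posC d0.
exists (Re d / K); first by rewrite divr_gt0.
move=> v; rewrite ltr_pdivlMr// => vz.
have wE : A + v *: (B - A) - (A + z *: (B - A)) = (v - z) *: (B - A).
  by rewrite opprD addrACA subrr add0r -scalerBl.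
have := hd (A + v *: (B - A)) (Gmat_line v GA GB).
have le1 : cn (v - z) * mx1 (B - A) <= cn (v - z) * K by rewrite ler_wpM2l ?cn_ge0// lerDl.
have -> : mnorm (A + v *: (B - A) - (A + z *: (B - A))) = (cn (v - z) * mx1 (B - A))%:C.
  by rewrite mnormE wE mx1Z.
rewrite dE ltcR => /(_ (le_lt_trans le1 vz)).
have -> : \sum_i \sum_j L i j * (A + v *: (B - A) - (A + z *: (B - A))) i j =
    (\sum_i \sum_j L i j * (B - A) i j) * (v - z).
  rewrite mulr_suml; apply: eq_bigr => i _; rewrite mulr_suml; apply: eq_bigr => j _.
  transitivity (L i j * ((v - z) * (B - A) i j)); last by rewrite mulrCA mulrC.
  by congr (_ * _); rewrite wE [LHS]mxE.
rewrite cnE -rmorphM lecR => /le_trans; apply.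
apply: (le_trans (ler_wpM2l (ltW (divr_gt0 e0 K0)) le1)).
by rewrite mulrCA divfK ?lt0r_neq0// mulrC.
Qed.

(** The germs at [s] and [t] agree on the intersection of their balls, which contains a ball about
    [gam s]. *)
Lemma continues_of_continuation (gam : R -> 'M[C]_N) f (r : R -> C) :
  continuation_along gam f r -> continues gam (fun t w => f t w ^+ 2).
Proof.
move=> [hol glue] t t01; have [r0 hf] := hol t t01; have [rE r0'] := posC r0.
have [d [d0 hd]] := glue t t01; exists (Num.min (Re (r t)) d); first by rewrite lt_min r0'.
split.
  rewrite rE in hf; move=> A B z GA GB; rewrite lt_min => /andP[hz _]; apply: cdiffX.
  exact: (hol_near_of_holomorphic hf).
move=> s s01; rewrite lt_min => /andP[_ st]; have [sb sw] := hd s s01 st.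
have [rs0 _] := hol s s01; have [rsE rs0'] := posC rs0.
move: sb; rewrite rE => /mballE sb.
exists (Num.min (Re (r s)) (Re (r t) - mx1 (gam s - gam t))).
  by rewrite lt_min rs0' subr_gt0.
move=> w Gw; rewrite lt_min => /andP[w1 w2]; rewrite sw//.
- by rewrite rE; apply/mballE; rewrite (le_lt_trans (mx1_tri (gam s) _ _))// -ltrBrDr.
- by rewrite rsE; apply/mballE.
Qed.

Lemma sqr_real (z : C) (y : R) : 0 <= y -> z ^+ 2 = y%:C -> z \is Num.real.
Proof.
move=> y0; rewrite -(sqr_sqrtr y0) rmorphXn => /eqP; rewrite eqf_sqr.
have re (x : R) : x%:C \is Num.real by rewrite realE -[0]/(0%:C) !lecR le_total.
by move=> /orP[] /eqP ->; rewrite ?realN; exact: re.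
Qed.

End Conversion.

Theorem theorem3 (R : realType) (n : nat) (g : geometry)
  (hg : (g = Lobachevsky /\ ~~ odd n) \/ g = Sphere)
  (gam : R -> 'M[R[i]]_n.+1) (f : R -> 'M[R[i]]_n.+1 -> R[i])
  (r : R -> R[i]) :
  path_in (@Gmat R n `\` @Xdisc R n) gam ->
  (exists C0, gram_domain g C0 /\ gam 0 = cplx_mx C0) ->
  (exists C1, gram_domain g C1 /\ gam 1 = cplx_mx C1) ->
  continuation_along gam f r ->
  starts_with_volume g gam f r ->
  f 1 (gam 1) \is Num.real.
Proof.
move=> [inG cont] [_ [[v0 [sv0 <-]] g0]] [_ [[v1 [sv1 <-]] g1]] hc start.
have z01 : 0 <= (0 : R) <= 1 by rewrite lexx ler01.
have o01 : 0 <= (1 : R) <= 1 by rewrite lexx ler01.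
have minors t : 0 <= t <= 1 -> forall S : {set 'I_n.+1}, (0 < #|S|)%N -> principal_minor (gam t) S != 0.
  by move=> t01 S S0; apply/eqP => E; have [_] := inG t t01; apply; exists S.
have gcont t : 0 <= t <= 1 -> forall e : R, 0 < e -> exists2 d : R, 0 < d &
     forall s, 0 <= s <= 1 -> `|s - t| < d -> mx1 (gam s - gam t) < e.
  move=> t01 e e0; have e0' : 0 < e%:C :> R[i] by rewrite -[0]/(0%:C) ltcR.
  have [d [d0 hd]] := cont t t01 _ e0'; exists d => // s s01 /(hd s s01).
  by rewrite mnormE ltcR.
have [kappa [r1 r10 near]] : exists kappa : R, exists2 r1 : R, 0 < r1 &
    forall w, Gmat w -> mx1 (w - cplx_mx (gram g v0)) < r1 -> f 0 w ^+ 2 = Vsq kappa w.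
  have [h0 _] := hc; have [r0 hf] := h0 0 z01; have [rE r0'] := posC r0.
  rewrite rE g0 in hf; apply: (volume_sq_near hg sv0 r0' (hol_near_of_holomorphic hf)).
  by move=> v' sv' hv'; apply: start => //; rewrite rE g0; apply/mballE.
have fE w : Gmat w -> mx1 (w - cplx_mx (gram g v0)) < r1 -> Vsq kappa w = f 0 w ^+ 2.
  by move=> Gw /(near w Gw).
have G1 : Gmat (cplx_mx (gram g v1)) := Gmat_gram sv1.
have d1 : \det (cplx_mx (gram g v1)) = (\det v1 ^+ 2)%:C by rewrite det_cplx (det_gram _ hg).
(* [Vsq kappa] and [f 0 ^+ 2] agree near [gam 0], which is enough since a representation is local;
   the squares of the continued germs then carry it to [gam 1]. *)
have propagate (I : finType) (k : I -> option 'I_n.+1) c a :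
    represents k c a (@Vsq R n kappa) (gam 0) -> represents k c a (fun w => f 1 w ^+ 2) (gam 1).
  rewrite g0 => /(represents_ext r10 fE); rewrite -g0.
  apply: (represents_path _ minors gcont (continues_of_continuation hc)).
  by move=> t t01; have [] := inG t t01.
suff [y y0 yE] : exists2 y : R, 0 <= y & f 1 (gam 1) ^+ 2 = y%:C by exact: (sqr_real y0 yE).
case: (hg) => [[gL en]|gS].
- have rep0 : represents (fun k : 'I_n.+1 => Some k) (fun _ => (1 : R)%:C) (kappa ^+ 2 / 4)%:C (@Vsq R n kappa) (gam 0).
    rewrite g0 gL; apply: represents_lobachevsky => //; first by rewrite -gL.
    by rewrite -gL -g0; exact: minors.
  have a0 : 0 <= kappa ^+ 2 / 4 by rewrite divr_ge0// sqr_ge0.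
  have := propagate _ _ _ _ rep0; rewrite g1.
  apply: (represents_real a0 (sqr_ge0 (\det v1)) d1 G1) => k.
  rewrite gL; apply: real_retract_lorentzian => //; first exact: gram_sym.
    by rewrite -gL; have [_ ->] := sv1.
  by move=> X; apply: gram_nonpos; rewrite -gL.
- have rep0 : represents (fun _ : 'I_1 => None) (fun _ => (1 : R)%:C) (kappa ^+ 2)%:C (@Vsq R n kappa) (gam 0).
    by rewrite g0 gS; apply: represents_sphere; rewrite -gS.
  have := propagate _ _ _ _ rep0; rewrite g1.
  apply: (represents_real (sqr_ge0 kappa) (sqr_ge0 (\det v1)) d1 G1) => k.
  by rewrite gS; apply: real_retract_definite; [exact: gram_sym|exact: gram_sphere_ge0].
Qed.
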